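(* Let $G=\prod_{j=1}^{r}C_{2^j}^{k_j}$ be a finite Abelian $2$-group with $k_r>0$, write $G\cong C_{2^r}\times G_0$ with $|G_0|=2^s$, and let $q$ be an odd prime power. If $q\equiv1\pmod 4$, let $\lambda_0=v_2(q-1)$ and define $l,a_l$ by: if $\lambda_0>r+s$, $l=0$, $a_l=r+s-\lambda_0$; if $r-s+2\le\lambda_0\le r+s$ and $r+s-\lambda_0$ even, $l=\frac{r+s-\lambda_0+2}{2}$, $a_l=-2$; if $r-s+2\le\lambda_0\le r+s$ and $r+s-\lambda_0$ odd, $l=\frac{r+s-\lambda_0+1}{2}$, $a_l=-1$; if $\lambda_0\le r-s+1$, $l=r-\lambda_0+1$, $a_l=-r+s+\lambda_0-2$. If $q\equiv3\pmod4$, let $\lambda_1=v_2(q^2-1)$ and define $l,a_l$ by: if $\lambda_1>r+s-1$, $l=1$, $a_l=r+s-\lambda_1-1$; if $r-s+3\le\lambda_1\le r+s-1$ and $r+s-\lambda_1$ odd, $l=\frac{r+s-\lambda_1+1}{2}$, $a_l=-2$; if $r-s+3\le\lambda_1\le r+s-1$ and $r+s-\lambda_1$ even, $l=\frac{r+s-\lambda_1}{2}$, $a_l=-1$; if $\lambda_1\le r-s+2$, $l=r-\lambda_1+2$, $a_l=-r+s+\lambda_1-3$. Suppose that $a_l=-1$. Then for every $n\ge0$, $$v_2(\#\operatorname{Hom}(G,GL_n(\mathbb{F}_q)))\geq \lambda_0n+\sum_{i=1}^{l-1}\left\lfloor\frac{n}{2^i}\right\rfloor+\left\lfloor\frac{n}{2^{l+1}}\right\rfloor-\left\lfloor\frac{n}{2^{l+2}}\right\rfloor$$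 when $q\equiv1\pmod{4}$, and $$v_2(\#\operatorname{Hom}(G,GL_n(\mathbb{F}_q)))\geq n+(\lambda_1-1)\left\lfloor\frac{n}{2}\right\rfloor+\sum_{i=2}^{l-1}\left\lfloor\frac{n}{2^i}\right\rfloor+\left\lfloor\frac{n}{2^{l+1}}\right\rfloor-\left\lfloor\frac{n}{2^{l+2}}\right\rfloor$$ when $q\equiv3\pmod{4}$. In both cases equality holds whenever $2^{l+2}\mid n$.
   Context: $C_m$ denotes the cyclic group of order $m$. $v_2$ is the $2$-adic valuation. $\#\operatorname{Hom}(G,H)$ is the number of group homomorphisms from $G$ to $H$; $GL_n(\mathbb{F}_q)$ is the general linear group over the field with $q$ elements.
   Formalization: For q≡3 mod 4 the two middle cases use l one larger than stated (the stated l makes the equality false); s=0 with λ_1=r or r+2, where the cases defining l,a_l conflict, is excluded; sums with reversed bounds are signed: Σ_{i=1}^{-1}f=-f(0), Σ_{i=2}^{0}f=-f(1). *)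

(* Defs.v *)
From HB Require Import structures.
From mathcomp Require Import all_boot all_order all_algebra all_fingroup.
From mathcomp Require Import all_solvable all_field.

Set Implicit Arguments.
Unset Strict Implicit.
Unset Printing Implicit Defensive.

Import Order.TTheory GRing.Theory Num.Theory.
Local Open Scope ring_scope.

(* The library's 'GL_n[F] is the unit group of 'M[F]_n.-1.+1, hence GL_1(F) when
   n = 0; the group below is trivial when n = 0, as it should be. *)
Record GLn (n : nat) (F : finFieldType) :=
  MkGLn { GLmx :> 'M[F]_n; GLmxP : GLmx \in unitmx }.

Section GeneralLinearGroup.
Variables (n : nat) (F : finFieldType).
Implicit Types A B C : GLn n F.

HB.instance Definition _ := [isSub for @GLmx n F].
HB.instance Definition _ := [Finite of GLn n F by <:].

Definition GLn_one : GLn n F := MkGLn (unitmx1 F n).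

Fact GLn_inv_subproof A : invmx A \in unitmx.
Proof. by rewrite unitmx_inv GLmxP. Qed.
Definition GLn_inv A : GLn n F := MkGLn (GLn_inv_subproof A).

Fact GLn_mul_subproof A B : (A : 'M_n) *m B \in unitmx.
Proof. by rewrite unitmx_mul !GLmxP. Qed.
Definition GLn_mul A B : GLn n F := MkGLn (GLn_mul_subproof A B).

Fact GLn_mulA : associative GLn_mul.
Proof. by move=> A B C; apply: val_inj; rewrite /= mulmxA. Qed.
Fact GLn_mul1 : left_id GLn_one GLn_mul.
Proof. by move=> A; apply: val_inj; rewrite /= mul1mx. Qed.
Fact GLn_mulV : left_inverse GLn_one GLn_inv GLn_mul.
Proof. by move=> A; apply: val_inj; rewrite /= mulVmx ?GLmxP. Qed.

HB.instance Definition _ :=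
  Finite_isGroup.Build (GLn n F) GLn_mulA GLn_mul1 GLn_mulV.

End GeneralLinearGroup.

Definition homset (gT hT : finGroupType) : {set {ffun gT -> hT}} :=
  [set f : {ffun gT -> hT} |
    [forall x, forall y, f (x * y)%g == (f x * f y)%g]].

(* \prod_(1 <= j <= r) C_(2^j)^(k j): the index i : 'I_r stands for j = i.+1,
   so 2 ^ j >= 2 and 'Z_(2 ^ j) really has 2 ^ j elements. *)
Definition prodC2 (r : nat) (k : nat -> nat) : finGroupType :=
  {dffun forall i : 'I_r, {dffun forall _ : 'I_(k i.+1), 'Z_(2 ^ i.+1)}}.

(* The sum of f i over m <= i <= l - 1, with the usual convention for reversed
   bounds: it is F l - F m for any F with F (i + 1) - F i = f i.  Hence it is
   - f 0 for (m, l) = (1, 0) and - f 1 for (m, l) = (2, 1); both cases occur, and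
   reading the sum as 0 there would give false bounds (C_2, q = 5, n = 1). *)
Definition osum (m l : nat) (f : nat -> int) : int :=
  \sum_(m <= i < l) f i - \sum_(l <= i < m) f i.

(* Definition by cases of (l, a_l) for q = 1 mod 4, where lam = v_2(q - 1): every
   clause whose condition holds constrains (l, a_l). *)
Definition la_q1 (r s lam l a : int) : Prop :=
  [/\ lam > r + s -> l = 0 /\ a = r + s - lam,
      r - s + 2 <= lam <= r + s -> (2 %| (r + s - lam)%R)%Z ->
        l = ((r + s - lam + 2)%R %/ 2)%Z /\ a = - 2,
      r - s + 2 <= lam <= r + s -> ~~ (2 %| (r + s - lam)%R)%Z ->
        l = ((r + s - lam + 1)%R %/ 2)%Z /\ a = - 1
    & lam <= r - s + 1 -> l = r - lam + 1 /\ a = - r + s + lam - 2].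

(* Same for q = 3 mod 4, where lam = v_2(q ^ 2 - 1).  The clauses are compatible
   except when s = 0 and lam is r or r + 2: the first and last ones then
   contradict each other, and no (l, a_l) is defined.
   In both middle clauses l is one more than in the source, which has
   (r + s - lam + 1) / 2 and (r + s - lam) / 2.  This is a misprint there:
   a_l = r + s + 1 - lam - 2 l in the two other clauses (as is
   a_l = r + s - lam - 2 l in all clauses of la_q1), and the values - 2 and - 1
   of a_l satisfy this only for the l below.  With the misprinted l the equality
   case fails, e.g., for C_2 ^ 5, q = 3, n = 16; the lower bound obtained from the
   l below implies the one obtained from the misprinted l. *)
Definition la_q3 (r s lam l a : int) : Prop :=
  [/\ lam > r + s - 1 -> l = 1 /\ a = r + s - lam - 1,
      r - s + 3 <= lam <= r + s - 1 -> ~~ (2 %| (r + s - lam)%R)%Z ->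
        l = ((r + s - lam + 1)%R %/ 2)%Z + 1 /\ a = - 2,
      r - s + 3 <= lam <= r + s - 1 -> (2 %| (r + s - lam)%R)%Z ->
        l = ((r + s - lam)%R %/ 2)%Z + 1 /\ a = - 1
    & lam <= r - s + 2 -> l = r - lam + 2 /\ a = - r + s + lam - 3].

(* Main.v *)
(* Let H n = #Hom(G, GL_n(q)) / #GL_n(q) and let G_Q be the logarithm of the
   series with coefficients 1 / #GL_n(Q).  A homomorphism from G is a tuple of
   commuting matrices A_i with A_i^(2^(j i)) = 1.  Splitting the space into
   eigenspaces when the prescribed scalar is a square, and passing to a quadratic
   extension when it is not, gives
     log (sum_n H n x^n) = sum_t (M_t - M_(t-1)) / 2^t G_(q^(2^t)) (x^(2^t)),
   with M_t the number of homomorphisms from G to the units of the field with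
   q^(2^t) elements.
   The 2-adic input is that (Q - 1) (G_Q (x) - G_(Q^2) (x^2) / 2) has coefficients
   in Z_(2) for odd Q: Q^k - 1 times its k-th coefficient is the value at 1 / Q of
   a polynomial over Z_(2) vanishing at all roots of unity of even order dividing
   k, hence divisible by (X^k - 1) / (X^k' - 1) with k' the odd part of k.
   Hence the k-th coefficient A k of log (sum_n H n x^n) is even unless 2^l divides
   k, A (2^l) and A (2^(l + 1)) have valuations - 1 and - 3, and the other terms are
   negligible: H has the valuation of the exponential of
   A (2^l) x^(2^l) + A (2^(l + 1)) x^(2^(l + 1)), whose coefficients satisfy a
   two-term recurrence. *)

Require Import Defs.
From HB Require Import structures.
From mathcomp Require Import all_boot all_order all_algebra all_fingroup.
From mathcomp Require Import all_solvable all_field.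
From mathcomp Require Import ring lra zify.
From mathcomp Require boolp.

Set Implicit Arguments.
Unset Strict Implicit.
Unset Printing Implicit Defensive.

Import Order.TTheory GRing.Theory Num.Theory.
Local Open Scope ring_scope.

(** * Formal power series *)

(** What makes [a_l = -1] delicate is a tie. In the variable [x ^ (2 ^ l)], the square term of the
    exponential of the first leading monomial is [u ^ 2 x ^ 2 / 8], and the second leading monomial
    is [w x ^ 2 / 8], with [u] and [w] odd. Neither dominates, so no single monomial can be
    isolated; the parity pattern of the recurrence, of period four, decides, whence the condition
    [2 ^ (l + 2) | n] for equality. The other obstacle is that the denominator [Q ^ k - 1] of a
    coefficient of [G_Q] has unbounded valuation in [k]. Summation by parts rewrites the logarithm
    as the sum of [M_t / 2 ^ t] times [G_Q (x) - G_(Q ^ 2) (x ^ 2) / 2] at [Q = q ^ (2 ^ t)] and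
    [x ^ (2 ^ t)], where index [t] costs only [2 ^ t (Q - 1)]. As [M_t] is a power of 2, the balance
    is a comparison of exponents: positive below [t = l], and [- (2 e + 1)] at [t = l + e]. This is
    the origin of the valuations - 1 and - 3. *)

Record fps (R : Type) := Fps { fcoef :> nat -> R }.

HB.instance Definition _ (R : Type) := boolp.gen_eqMixin (fps R).
HB.instance Definition _ (R : Type) := boolp.gen_choiceMixin (fps R).

Lemma fpsP (R : Type) (f g : fps R) : f =1 g -> f = g.
Proof. by case: f g => [f] [g] /= /boolp.funext ->. Qed.

Section FpsZmod.
Variable R : zmodType.
Implicit Types f g : fps R.

Definition fps_zero : fps R := Fps (fun _ => 0).
Definition fps_opp f : fps R := Fps (fun n => - f n).
Definition fps_add f g : fps R := Fps (fun n => f n + g n).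

Fact fps_addA : associative fps_add.
Proof. by move=> f g h; apply: fpsP => n; rewrite /= addrA. Qed.
Fact fps_addC : commutative fps_add.
Proof. by move=> f g; apply: fpsP => n; rewrite /= addrC. Qed.
Fact fps_add0 : left_id fps_zero fps_add.
Proof. by move=> f; apply: fpsP => n; rewrite /= add0r. Qed.
Fact fps_addN : left_inverse fps_zero fps_opp fps_add.
Proof. by move=> f; apply: fpsP => n; rewrite /= addNr. Qed.

HB.instance Definition _ :=
  GRing.isZmodule.Build (fps R) fps_addA fps_addC fps_add0 fps_addN.

Lemma fps0 n : (0 : fps R) n = 0. Proof. by []. Qed.
Lemma fpsD f g n : (f + g) n = f n + g n. Proof. by []. Qed.
Lemma fpsN f n : (- f) n = - f n. Proof. by []. Qed.
Lemma fpsB f g n : (f - g) n = f n - g n. Proof. by []. Qed.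
Lemma fpsMn f m n : (f *+ m) n = f n *+ m.
Proof. by elim: m => [|m IHm] //; rewrite !mulrS fpsD IHm. Qed.
Lemma fps_sum I (r : seq I) (P : pred I) (F : I -> fps R) n :
  (\sum_(i <- r | P i) F i) n = \sum_(i <- r | P i) F i n.
Proof. by elim/big_rec2: _ => // i x y _ <-. Qed.

End FpsZmod.

Section FpsRing.
Variable R : comNzRingType.
Implicit Types f g h : fps R.

Definition fps_one : fps R := Fps (fun n => (n == 0%N)%:R).
Definition fps_mul f g : fps R := Fps (fun n => \sum_(i < n.+1) f i * g (n - i)%N).
(** Coefficient [n] of a product involves only coefficients up to [n], so identities between
    products are read off in [{poly R}] after truncation. *)
Definition fps_trunc N f : {poly R} := \poly_(i < N) f i.

Lemma fps_mul_trunc N f g n : (n < N)%N ->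
  fps_mul f g n = (fps_trunc N f * fps_trunc N g)`_n.
Proof.
move=> ltnN; rewrite coefM; apply: eq_bigr => i _; rewrite !coef_poly.
have lei : (i <= n)%N by rewrite -ltnS.
by rewrite (leq_ltn_trans lei ltnN) (leq_ltn_trans (leq_subr _ _) ltnN).
Qed.

Lemma coefM_eq (p p' q q' : {poly R}) n :
    (forall i, (i <= n)%N -> p`_i = p'`_i) ->
    (forall i, (i <= n)%N -> q`_i = q'`_i) ->
  (p * q)`_n = (p' * q')`_n.
Proof.
move=> eqp eqq; rewrite !coefM; apply: eq_bigr => i _.
by rewrite eqp -1?ltnS // eqq ?leq_subr.
Qed.

Fact fps_mulA : associative fps_mul.
Proof.
move=> f g h; apply: fpsP => n; rewrite !(@fps_mul_trunc n.+1) //.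
rewrite -(@coefM_eq (fps_trunc n.+1 f) _
    (fps_trunc n.+1 g * fps_trunc n.+1 h)) => [|//|i lein].
- rewrite mulrA; apply: coefM_eq => // i lein.
  by rewrite [RHS]coef_poly ltnS lein (@fps_mul_trunc n.+1).
- by rewrite [RHS]coef_poly ltnS lein (@fps_mul_trunc n.+1).
Qed.
Fact fps_mulC : commutative fps_mul.
Proof.
by move=> f g; apply: fpsP => n; rewrite !(@fps_mul_trunc n.+1) // mulrC.
Qed.
Fact fps_mul1 : left_id fps_one fps_mul.
Proof.
move=> f; apply: fpsP => n /=; rewrite big_ord_recl mul1r subn0 big1 ?addr0 //.
by move=> i _; rewrite mul0r.
Qed.
Fact fps_mulDl : left_distributive fps_mul +%R.
Proof.
move=> f g h; apply: fpsP => n /=; rewrite -big_split; apply: eq_bigr => i _.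
by rewrite mulrDl.
Qed.
Fact fps_one_neq0 : fps_one != 0.
Proof.
by apply/eqP => /(congr1 (fun f : fps R => f 0%N)) /eqP; rewrite /= oner_eq0.
Qed.

HB.instance Definition _ := GRing.Zmodule_isComNzRing.Build (fps R)
  fps_mulA fps_mulC fps_mul1 fps_mulDl fps_one_neq0.

Lemma fps1 n : (1 : fps R) n = (n == 0%N)%:R. Proof. by []. Qed.
Lemma fpsM f g n : (f * g) n = \sum_(i < n.+1) f i * g (n - i)%N.
Proof. by []. Qed.

Lemma fpsM0 f g : (f * g) 0%N = f 0%N * g 0%N.
Proof. by rewrite fpsM big_ord_recl big_ord0 addr0. Qed.

Lemma fpsM_eq f f' g g' n :
    (forall i, (i <= n)%N -> f i = f' i) ->
    (forall i, (i <= n)%N -> g i = g' i) -> (f * g) n = (f' * g') n.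
Proof.
move=> eqf eqg; apply: eq_bigr => i _.
by rewrite eqf -1?ltnS // eqg ?leq_subr.
Qed.

Lemma fpsX_small f m n : f 0%N = 0 -> (n < m)%N -> (f ^+ m) n = 0.
Proof.
move=> f0; elim: m n => // m IHm n ltnm.
rewrite exprS fpsM big1 // => -[[|i] ltin] _ /=; first by rewrite f0 mul0r.
rewrite IHm ?mulr0 // (leq_trans _ (ltnm : (n <= m)%N)) //.
by rewrite ltn_subrL /= -ltnS (leq_ltn_trans _ ltin).
Qed.

(** The derivation [x d/dx]: unlike [d/dx] it preserves degrees, and its values have no constant
    term. *)
Definition theta f : fps R := Fps (fun n => f n *+ n).

Lemma thetaE f n : theta f n = f n *+ n. Proof. by []. Qed.
Lemma thetaD f g : theta (f + g) = theta f + theta g.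
Proof. by apply: fpsP => n; rewrite fpsD !thetaE mulrnDl. Qed.
Lemma theta0 : theta 0 = 0.
Proof. by apply: fpsP => n; rewrite thetaE mul0rn. Qed.
Lemma theta1 : theta 1 = 0.
Proof. by apply: fpsP => -[|n]; rewrite thetaE ?mul0rn. Qed.
Lemma thetaM f g : theta (f * g) = theta f * g + f * theta g.
Proof.
apply: fpsP => n; rewrite thetaE fpsD !fpsM -big_split /= -sumrMnl.
apply: eq_bigr => i _; rewrite mulrnAl mulrnAr -mulrnDr subnKC //.
by rewrite -ltnS.
Qed.
Lemma thetaX f m : theta (f ^+ m.+1) = theta f * f ^+ m *+ m.+1.
Proof.
elim: m => [|m IHm]; first by rewrite expr1 mulr1.
by rewrite exprS thetaM IHm mulrnAr mulrCA -exprS -mulrS.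
Qed.

Definition fmono (c : R) k : fps R := Fps (fun n => if n == k then c else 0).
Lemma fmonoE c k n : fmono c k n = if n == k then c else 0.
Proof. by []. Qed.
Lemma fmonoMl c k f n :
  (fmono c k * f) n = if (k <= n)%N then c * f (n - k)%N else 0.
Proof.
rewrite fpsM; case: leqP => [lekn|ltnk].
  rewrite (bigD1 (Ordinal (lekn : (k < n.+1)%N))) //= eqxx big1 ?addr0 // => i ne.
  by rewrite /= -(inj_eq val_inj) /= in ne *; rewrite (negPf ne) mul0r.
rewrite big1 // => i _ /=; rewrite ltn_eqF ?mul0r //.
by rewrite (leq_trans (ltn_ord i)).
Qed.
Lemma fmonoM c d i j : fmono c i * fmono d j = fmono (c * d) (i + j)%N.
Proof.
apply: fpsP => n; rewrite fmonoMl !fmonoE; case: leqP => [lein|ltni].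
  rewrite -(eqn_add2r i) subnK // addnC.
  by case: eqP => // _; rewrite mulr0.
by rewrite ltn_eqF // (leq_trans ltni) // leq_addr.
Qed.
Lemma fmono1 : fmono 1 0%N = 1.
Proof. by apply: fpsP => -[]. Qed.
Lemma fps_mulr_eq0 f g : g 0%N = 1 -> f * g = 0 -> f = 0.
Proof.
move=> g0 fg; apply: fpsP => n; have [m] := ubnP n.
elim: m n => // m IHm n ltn; have : (f * g) n = 0 by rewrite fg.
rewrite fpsM big_ord_recr /= subnn g0 mulr1 big1 ?add0r // => i _.
by rewrite IHm ?mul0r // (leq_trans (ltn_ord i)).
Qed.

(** The substitution of [c * x] for the variable. *)
Definition fscale (c : R) f : fps R := Fps (fun n => c ^+ n * f n).
Lemma fscaleE c f n : fscale c f n = c ^+ n * f n. Proof. by []. Qed.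
Lemma fscaleM c f g : fscale c (f * g) = fscale c f * fscale c g.
Proof.
apply: fpsP => n; rewrite fscaleE !fpsM mulr_sumr; apply: eq_bigr => i _.
rewrite !fscaleE mulrACA -exprD subnKC //; by rewrite -ltnS.
Qed.
Lemma fscale1 c : fscale c 1 = 1.
Proof.
by apply: fpsP => -[|n]; rewrite fscaleE fps1 ?mulr0 // mulr1 expr0.
Qed.
Lemma fscaleD c f g : fscale c (f + g) = fscale c f + fscale c g.
Proof. by apply: fpsP => n; rewrite !(fscaleE, fpsD) mulrDr. Qed.
Lemma fscaleA c d f : fscale c (fscale d f) = fscale (c * d) f.
Proof. by apply: fpsP => n; rewrite !fscaleE mulrA exprMn. Qed.
Lemma fscale_id f : fscale 1 f = f.
Proof. by apply: fpsP => n; rewrite fscaleE expr1n mul1r. Qed.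
Lemma theta_fscale c f : theta (fscale c f) = fscale c (theta f).
Proof. by apply: fpsP => n; rewrite !(thetaE, fscaleE) mulrnAr. Qed.

Lemma fscale_mono c d k : fscale c (fmono d k) = fmono (c ^+ k * d) k.
Proof.
by apply: fpsP => n; rewrite fscaleE !fmonoE; case: eqP => [->|]; rewrite ?mulr0.
Qed.

(** The substitution of [x ^ m] for the variable. *)
Definition fsub m f : fps R :=
  Fps (fun n => if (m %| n)%N then f (n %/ m)%N else 0).
Lemma fsubE m f n :
  fsub m f n = if (m %| n)%N then f (n %/ m)%N else 0.
Proof. by []. Qed.
Lemma fsubD m f g : fsub m (f + g) = fsub m f + fsub m g.
Proof. by apply: fpsP => n; rewrite !(fsubE, fpsD); case: ifP; rewrite ?addr0. Qed.
Lemma fsubM m f g : (0 < m)%N -> fsub m (f * g) = fsub m f * fsub m g.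
Proof.
move=> m0; apply: fpsP => n.
have E h i : (i <= n)%N -> fsub m h i = (fps_trunc n.+1 h \Po 'X^m)`_i.
  move=> lein; rewrite coef_comp_poly_Xn // coef_poly fsubE.
  by rewrite ltnS (leq_trans (leq_div _ _) lein).
rewrite E // (_ : (fsub m f * fsub m g) n =
    ((fps_trunc n.+1 f \Po 'X^m) * (fps_trunc n.+1 g \Po 'X^m))`_n); last first.
  rewrite coefM; apply: eq_bigr => i _.
  by rewrite !E ?leq_subr // -ltnS.
rewrite -comp_polyM !coef_comp_poly_Xn //; case: ifP => // _.
rewrite coef_poly ltnS leq_div (@fps_mul_trunc n.+1) //.
by rewrite ltnS leq_div.
Qed.
Lemma fsub_mono m c k : (0 < m)%N -> fsub m (fmono c k) = fmono c (k * m)%N.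
Proof.
move=> m0; apply: fpsP => n; rewrite fsubE !fmonoE; case: ifP => [/dvdnP[d ->]|ndv].
  by rewrite mulnK // eqn_pmul2r.
by case: eqP => // en; rewrite en dvdn_mull in ndv.
Qed.
Lemma theta_fsub m f : theta (fsub m f) = fsub m (theta f) *+ m.
Proof.
apply: fpsP => n; rewrite fpsMn !(thetaE, fsubE).
by case: ifP => [/divnK {2}<-|_]; rewrite ?mul0rn // mulrnA.
Qed.

End FpsRing.

Arguments fmono {R} c%_R k%_N.
Arguments fsub {R} m%_N f.

Section FpsMap.
Variables (R S : comNzRingType) (s : {rmorphism R -> S}).
Definition fmap (f : fps R) : fps S := Fps (fun n => s (f n)).
Lemma fmapE f n : fmap f n = s (f n). Proof. by []. Qed.
Lemma fmapM f g : fmap (f * g) = fmap f * fmap g.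
Proof.
apply: fpsP => n; rewrite fmapE !fpsM rmorph_sum; apply: eq_bigr => i _.
by rewrite rmorphM.
Qed.
Lemma fmapD f g : fmap (f + g) = fmap f + fmap g.
Proof. by apply: fpsP => n; rewrite fmapE rmorphD. Qed.
Lemma fmap_fscale c f : fmap (fscale c f) = fscale (s c) (fmap f).
Proof. by apply: fpsP => n; rewrite fmapE !fscaleE rmorphM rmorphXn. Qed.
Lemma fmap_mono c k : fmap (fmono c k) = fmono (s c) k.
Proof. by apply: fpsP => n; rewrite fmapE !fmonoE; case: ifP; rewrite ?rmorph0. Qed.
Lemma theta_fmap f : theta (fmap f) = fmap (theta f).
Proof. by apply: fpsP => n; rewrite fmapE !thetaE rmorphMn. Qed.
End FpsMap.

(* [H = exp A], stated through logarithmic derivatives so as to make sense over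
   any ring. *)
Definition isexp (R : comNzRingType) (A H : fps R) : Prop :=
  [/\ A 0%N = 0, H 0%N = 1 & theta H = theta A * H].

(** * Exponentials and logarithms of power series *)

Section Exp.
Variable R : comNzRingType.
Implicit Types A B H K : fps R.

Lemma isexpM A B H K : isexp A H -> isexp B K -> isexp (A + B) (H * K).
Proof.
move=> [A0 H0 eH] [B0 K0 eK]; split.
- by rewrite fpsD A0 B0 addr0.
- by rewrite fpsM0 H0 K0 mul1r.
- by rewrite thetaM thetaD eH eK mulrDl -mulrA (mulrCA H).
Qed.

Lemma isexp0 : isexp (0 : fps R) 1.
Proof. by split; rewrite // theta0 theta1 mul0r. Qed.

Lemma isexp_prod I (r : seq I) (P : pred I) (A H : I -> fps R) :
    (forall i, P i -> isexp (A i) (H i)) ->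
  isexp (\sum_(i <- r | P i) A i) (\prod_(i <- r | P i) H i).
Proof.
by move=> e; elim/big_rec2: _ => [|i A' H' Pi]; [exact: isexp0 | apply/isexpM/e].
Qed.

Lemma isexp_fscale c A H : isexp A H -> isexp (fscale c A) (fscale c H).
Proof.
by case=> A0 H0 eH; split; rewrite ?fscaleE ?A0 ?H0 ?mulr0 ?mulr1 //
  !theta_fscale eH fscaleM.
Qed.

Lemma isexp_fsub m A H : (0 < m)%N -> isexp A H -> isexp (fsub m A) (fsub m H).
Proof.
move=> m0 [A0 H0 eH]; split; rewrite ?fsubE ?dvdn0 ?div0n //.
by rewrite !theta_fsub eH fsubM // mulrnAl.
Qed.

Lemma isexp_fmap (S : comNzRingType) (s : {rmorphism R -> S}) A H :
  isexp A H -> isexp (fmap s A) (fmap s H).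
Proof.
by case=> A0 H0 eH; split; rewrite ?fmapE ?A0 ?H0 ?rmorph0 ?rmorph1 //
  !theta_fmap eH fmapM.
Qed.

End Exp.

Section ExpUniq.
Variable R : comUnitRingType.
Hypothesis unitS : forall n, n.+1%:R \is a @GRing.unit R.
Implicit Types A B H K : fps R.

Lemma mulrSn_inj (n : nat) (x y : R) : x *+ n.+1 = y *+ n.+1 -> x = y.
Proof.
by rewrite -(mulr_natr x) -(mulr_natr y); apply: mulIr; apply: unitS.
Qed.

Lemma isexp_recE A H n : isexp A H ->
  H n.+1 *+ n.+1 = \sum_(i < n.+1) A i.+1 *+ i.+1 * H (n - i)%N.
Proof.
case=> A0 H0 /(congr1 (fun f : fps R => f n.+1)); rewrite thetaE fpsM => ->.
by rewrite big_ord_recl thetaE mulr0n mul0r add0r.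
Qed.

(** The local form of uniqueness. It later allows the logarithm of a series to be cut to finitely
    many monomials. *)
Lemma isexp_eq A B H K n : isexp A H -> isexp B K ->
  (forall i, (i <= n)%N -> A i = B i) -> H n = K n.
Proof.
move=> eA eB eAB; have [m] := ubnP n.
elim: m n eAB => // m IHm [_ _|n eAB ltnm]; first by case: eA eB => _ -> _ [].
apply: (@mulrSn_inj n); rewrite (isexp_recE _ eA) (isexp_recE _ eB).
apply: eq_bigr => i _; rewrite eAB // IHm // => [j lej|].
  by rewrite eAB // (leq_trans lej) // leqW // leq_subr.
by rewrite (leq_ltn_trans (leq_subr _ _)).
Qed.

Lemma isexp_uniq A H K : isexp A H -> isexp A K -> H = K.
Proof. by move=> eH eK; apply: fpsP => n; apply: (isexp_eq eH eK). Qed.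

Lemma isexp_inj A B H : isexp A H -> isexp B H -> A = B.
Proof.
move=> eA eB; apply: fpsP => n; have [m] := ubnP n.
elim: m n => // m IHm [_|n ltnm]; first by case: eA eB => -> _ _ [->].
have /eqP := isexp_recE n eA; rewrite (isexp_recE _ eB) !big_ord_recr /=.
rewrite subnn; case: (eA) => _ -> _; rewrite !mulr1.
rewrite (eq_bigr (fun i : 'I_n => A i.+1 *+ i.+1 * H (n - i)%N)) => [|i _].
  by move=> /eqP /addrI /mulrSn_inj.
by rewrite IHm // (leq_ltn_trans (ltn_ord i)).
Qed.

(** For [A 0 = 0], [A ^+ k] vanishes below degree [k], so the sum up to [n] is the full one. *)
Definition fexp A : fps R :=
  Fps (fun n => \sum_(k < n.+1) (A ^+ k) n / k`!%:R).

(** The logarithm of [1 + X], for [X 0 = 0]: the omitted terms only have degrees above [n]. *)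
Definition flog (X : fps R) : fps R :=
  Fps (fun n => \sum_(k < n) (-1) ^+ k * (X ^+ k.+1) n / k.+1%:R).

Lemma flogE (X : fps R) n :
  flog X n = \sum_(k < n) (-1) ^+ k * (X ^+ k.+1) n / k.+1%:R.
Proof. by []. Qed.

Lemma unit_fact n : n`!%:R \is a @GRing.unit R.
Proof. by rewrite -[n`!]prednK ?fact_gt0 ?unitS. Qed.

Lemma isexp_fexp A : A 0%N = 0 -> isexp A (fexp A).
Proof.
move=> A0; split=> //; first by rewrite /= big_ord_recl big_ord0 addr0 divr1.
apply: fpsP => n; rewrite thetaE.
pose T N : fps R := Fps (fun m => \sum_(k < N) (A ^+ k) m / k`!%:R).
transitivity ((theta A * T n) n).
  rewrite /= big_ord_recl expr0 mulrnDl -mulrnAl -thetaE theta1 mul0r add0r.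
  transitivity (\sum_(k < n) (theta A * A ^+ k) n / k`!%:R).
    rewrite -sumrMnl; apply: eq_bigr => k _; rewrite lift0 -mulrnAl -thetaE thetaX fpsMn.
    rewrite factS natrM invrM ?unit_fact ?unitS // mulrA mulrAC mulrnAl -mulrnAr.
    by rewrite -(mulr_natr (k.+1%:R^-1)) mulVr ?unitS ?mulr1.
  transitivity (\sum_(k < n) \sum_(i < n.+1)
      A i *+ i * ((A ^+ k) (n - i)%N / k`!%:R)).
    by apply: eq_bigr => k _; rewrite fpsM mulr_suml; apply: eq_bigr => i _; rewrite mulrA.
  by rewrite exchange_big; apply: eq_bigr => i _; rewrite /= -mulr_sumr.
(* [theta A] has no constant term, so only coefficients of index below [n] of the exponential occur,
   where the partial sum [T n] is already exact. *)
rewrite fpsM [RHS]fpsM; apply: eq_bigr => -[[|i] lti] _.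
  by rewrite thetaE mulr0n !mul0r.
congr (_ * _) => /=; rewrite [RHS](big_ord_widen_cond n (fun=> true)
  (fun k => (A ^+ k) (n - i.+1)%N / k`!%:R)); last first.
  rewrite /= ltn_subrL /= -ltnS (leq_ltn_trans _ lti) //.
rewrite [RHS]big_mkcond; apply: eq_bigr => k _ /=.
by case: ifPn => //; rewrite -leqNgt => ltk; rewrite fpsX_small ?mul0r.
Qed.

Lemma isexp_flog (X : fps R) : X 0%N = 0 -> isexp (flog X) (1 + X).
Proof.
move=> X0; split; rewrite ?fpsD ?fps1 ?X0 ?addr0 //; first by rewrite /= big_ord0.
apply: fpsP => n; rewrite thetaD theta1 add0r.
pose T N : fps R := \sum_(k < N) (- X) ^+ k.
have geo N : T N * (1 + X) = 1 - (- X) ^+ N.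
  by rewrite -opprB subrX1 -mulNr opprB opprK mulrC.
have thetaT N m : (m <= N)%N -> theta (flog X) m = (theta X * T N) m.
  move=> leN; rewrite thetaE flogE (big_ord_widen_cond N (fun=> true)
    (fun k => (-1) ^+ k * (X ^+ k.+1) m / k.+1%:R)) // -sumrMnl big_mkcond.
  rewrite /T mulr_sumr fps_sum; apply: eq_bigr => k _.
  case: ifPn => [ltk|].
    rewrite -mulrnAl -mulrnAr -thetaE thetaX fpsMn mulrnAr mulrnAl -mulrnAr.
    rewrite -(mulr_natr (k.+1%:R^-1)) mulVr ?unitS ?mulr1 //.
    rewrite (exprNn X) mulrCA.
    have -> h : ((-1) ^+ k * h : fps R) m = (-1) ^+ k * h m.
      by rewrite -signr_odd -[in RHS]signr_odd !mulr_sign; case: odd.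
    by [].
  rewrite -leqNgt => ltk; rewrite fpsM big1 // => -[[|i] lti] _.
    by rewrite thetaE mulr0n mul0r.
  rewrite fpsX_small ?mulr0 ?fpsN ?X0 ?oppr0 //= (leq_trans _ ltk) //.
  by rewrite ltn_subrL /= -ltnS (leq_ltn_trans _ lti).
transitivity ((theta X * T n * (1 + X)) n); last first.
  by apply: fpsM_eq => // i lein; rewrite -thetaT.
(* The remainder [(- X) ^+ n] of the geometric series starts in degree [n], and [theta X] in degree
   1. *)
rewrite -mulrA geo mulrBr mulr1 fpsB [X in _ - X]fpsM big1 ?subr0 //.
move=> -[[|i] lti] _; first by rewrite thetaE mulr0n mul0r.
rewrite fpsX_small ?mulr0 ?fpsN ?X0 ?oppr0 //=.
by rewrite ltn_subrL /= -ltnS (leq_ltn_trans _ lti).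
Qed.

End ExpUniq.

Arguments fcoef : simpl never.

(** * The 2-local integers and a Frobenius congruence *)

Definition z2 : {pred rat} := fun x => odd `|denq x|%N.

Lemma z2P (x : rat) :
  reflect (exists2 d : nat, odd d & x * d%:R \is a Num.int) (x \in z2).
Proof.
apply: (iffP idP) => [ox|[d od /intrP[m em]]].
  exists `|denq x|%N => //.
  by rewrite -[X in x * X]/(`|denq x|%N%:~R) absz_denq -numqE intr_int.
suff: (`|denq x| %| d)%N.
  by move=> /dvdnP[e de]; move: od; rewrite de oddM => /andP[].
have: (denq x %| numq x * d%:Z)%Z.
  apply/dvdzP; exists m; apply: (@intr_inj rat).
  by rewrite !rmorphM /= numqE -em mulrAC.
by rewrite mulrC Gauss_dvdzl // coprimezE coprime_sym coprime_num_den.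
Qed.

Fact z2_subring : subring_closed z2.
Proof.
split=> [|x y /z2P[d od ix] /z2P[e oe iy]|x y /z2P[d od ix] /z2P[e oe iy]].
- by apply/z2P; exists 1%N => //; rewrite mulr1 rpred1.
- apply/z2P; exists (d * e)%N; first by rewrite oddM od.
  rewrite natrM mulrBl mulrA [X in _ - X]mulrCA rpredB // rpredM ?rpred_nat //.
- apply/z2P; exists (d * e)%N; first by rewrite oddM od.
  by rewrite natrM mulrACA rpredM.
Qed.
HB.instance Definition _ := GRing.isSubringClosed.Build rat z2 z2_subring.

Lemma z2_nat n : n%:R \in z2. Proof. exact: rpred_nat. Qed.
Lemma z2_invodd n : odd n -> n%:R^-1 \in z2.
Proof.
move=> on; apply/z2P; exists n => //; rewrite mulVf ?rpred1 // pnatr_eq0.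
by case: n on.
Qed.

Lemma z2_dvd n e : n%:R / 2 ^+ e \in z2 -> (2 ^ e %| n)%N.
Proof.
move=> /z2P[d od /intrP[m em]].
have c : coprime (2 ^ e) d by rewrite coprimeXl // coprime2n.
rewrite -(Gauss_dvdl _ c); apply/dvdnP; exists `|m|%N.
have : (n * d)%:R = (m * (2 ^ e)%:Z)%:~R :> rat.
  rewrite intrM -em natrM -pmulrn natrX.
  by rewrite mulrAC divfK // expf_neq0.
by rewrite pmulrn => /intr_inj /(congr1 absz); rewrite abszM.
Qed.

(** With [x = m / d], the numerator of [x ^ 2 - x] is [m * (m - d)], even because [d] is odd: the
    identity is a Frobenius lift on [z2]. *)
Lemma z2_sqr_sub x : x \in z2 -> exists2 y, y \in z2 & x ^+ 2 - x = y *+ 2.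
Proof.
move=> x2; have [d od /intrP[m em]] := z2P _ x2.
have d0 : d%:R != 0 :> rat by rewrite pnatr_eq0; case: d od {em}.
have xE : x = m%:~R / d%:R by rewrite -em mulfK.
exists (((m * (m - d%:Z)) %/ 2)%Z%:~R / d%:R / d%:R).
  by rewrite !rpredM ?z2_invodd // rpred_int.
have -> : x ^+ 2 - x = (m * (m - d%:Z))%:~R / d%:R / d%:R.
  rewrite rmorphM rmorphB /= -[d%:~R]/(d%:R) xE.
  by field.
have e2 : (2 %| m * (m - d%:Z))%Z.
  rewrite dvdzE abszM Euclid_dvdM // -!dvdzE.
  have [//|] := boolP (2 %| m)%Z; rewrite /= !dvdzE !dvdn2 !negbK.
  by case: m {em xE} => n /= on; lia.
rewrite -{1}(divzK e2) rmorphM /=; ring.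
Qed.

Definition divby (A : comNzRingType) (S : {pred A}) (m : nat) (x : A) :=
  exists2 y, y \in S & x = y *+ m.

Section DivBy.
Variables (A : comNzRingType) (S : subringClosed A) (m : nat).

Lemma divby0 : divby S m 0.
Proof. by exists 0; rewrite ?rpred0 // mul0rn. Qed.
Lemma divbyD x y : divby S m x -> divby S m y -> divby S m (x + y).
Proof.
by case=> a aS -> [b bS ->]; exists (a + b); rewrite ?rpredD // mulrnDl.
Qed.
Lemma divbyN x : divby S m x -> divby S m (- x).
Proof. by case=> a aS ->; exists (- a); rewrite ?rpredN // mulNrn. Qed.
Lemma divby_sum I (r : seq I) (P : pred I) F :
  (forall i, P i -> divby S m (F i)) -> divby S m (\sum_(i <- r | P i) F i).
Proof. by apply: big_ind; [exact: divby0 | exact: divbyD]. Qed.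
Lemma divbyM k x y : divby S m x -> divby S k y -> divby S (m * k) (x * y).
Proof.
case=> a aS -> [b bS ->]; exists (a * b); rewrite ?rpredM //.
by rewrite mulrnAr mulrnAl mulrnA.
Qed.
Lemma divbyMr x y : divby S m x -> y \in S -> divby S m (x * y).
Proof. by case=> a aS -> bS; exists (a * y); rewrite ?rpredM // mulrnAl. Qed.

End DivBy.

(** Horner induction: squaring [P * 'X + c] adds to the two squares only an even cross term. The
    conclusion has the shape of the hypothesis on [s], so the lemma can be iterated over polynomial
    rings. *)
Lemma frobenius_lift (A : comNzRingType) (S : subringClosed A)
    (s : {rmorphism A -> A}) :
    {in S, forall c, s c \in S} ->
    {in S, forall c, divby S 2 (c ^+ 2 - s c)} ->
  {in polyOver S, forall P : {poly A},
    divby (polyOver_pred S) 2 (P ^+ 2 - (map_poly s P \Po 'X^2))}.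
Proof.
move=> sS hS P; elim/poly_ind: P => [_|P c IHP /polyOverP PcS].
  by rewrite map_poly0 comp_poly0 expr0n /= subr0; apply: divby0.
have cS : c \in S by have := PcS 0%N; rewrite -cons_poly_def coef_cons.
have PS : P \in polyOver S.
  by apply/polyOverP => i; have := PcS i.+1; rewrite -cons_poly_def coef_cons.
have [p pS ep] := IHP PS; have [d dS ed] := hS c cS.
exists (p * 'X^2 + c%:P * P * 'X + d%:P).
  by rewrite !rpredD ?rpredM ?polyOverC ?polyOverX ?rpredX ?polyOverX.
rewrite rmorphD rmorphM /= map_polyX map_polyC /= comp_polyD comp_polyM.
rewrite comp_polyX comp_polyC.
have -> : (P * 'X + c%:P) ^+ 2 - ((map_poly s P \Po 'X^2) * 'X^2 + (s c)%:P) =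
  (P ^+ 2 - (map_poly s P \Po 'X^2)) * 'X^2 + (c ^+ 2 - s c)%:P
   + (c%:P * P * 'X) *+ 2.
  rewrite polyCB polyC_exp; ring.
by rewrite ep ed polyCMn; ring.
Qed.

Lemma rat_unitS n : n.+1%:R \is a @GRing.unit rat.
Proof. by rewrite unitfE pnatr_eq0. Qed.

Lemma rpoly_unitS n : n.+1%:R \is a @GRing.unit {poly rat}.
Proof. by rewrite -(rmorph_nat (@polyC rat)) rmorph_unit // rat_unitS. Qed.

(** * The logarithm of the series with coefficients 1 / #GL_n(Q) *)

(* [qratio] is the quotient E (Q y) / E (y) for E the series with coefficients
   1 / #GL_n(Q): as a series in y, its coefficients are polynomials in u = 1 / Q,
   written 'X here, and it is determined by [qratio_rec]. *)
Fixpoint qratio_fuel (N k : nat) : {poly rat} :=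
  if N is N'.+1 then
    if k == 0%N then 1 else
      (k == 1%N)%:R - \sum_(i < k.-1)
        qratio_fuel N' i.+1 * qratio_fuel N' (k.-1 - i)%N * 'X^(k.-1 - i)
  else 0.

Lemma qratio_fuelE N N' k : (k < N)%N -> (k < N')%N -> qratio_fuel N k = qratio_fuel N' k.
Proof.
elim: N N' k => // N IHN [//|N'] [//|k] /= ltN ltN'; congr (_ - _).
apply: eq_bigr => -[i /= lti] _.
by congr (_ * _ * _); apply: IHN; lia.
Qed.

Definition qratio : fps {poly rat} := Fps (fun k => qratio_fuel k.+1 k).

Lemma qratio0 : qratio 0%N = 1. Proof. by []. Qed.
Lemma qratioS k : qratio k.+1 = (k == 0%N)%:R
  - \sum_(i < k) qratio i.+1 * qratio (k - i)%N * 'X^(k - i).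
Proof.
transitivity ((k == 0%N)%:R - \sum_(i < k)
    qratio_fuel k.+1 i.+1 * qratio_fuel k.+1 (k - i)%N * 'X^(k - i) : {poly rat}) => //.
congr (_ - _); apply: eq_bigr => i _.
move: (nat_of_ord i) (ltn_ord i) => {}i lti.
by congr (_ * _ * _); apply: qratio_fuelE; lia.
Qed.

(** Dividing [E (Q y) = E y + y * E (u y)] by [E y] gives [r y = 1 + y / r (u y)], a continued
    fraction of Rogers-Ramanujan type. *)
Lemma qratio_rec : qratio * fscale 'X qratio = fscale 'X qratio + fmono 1 1.
Proof.
apply: fpsP => -[|k]; first by rewrite fpsM0 fpsD qratio0 mul1r addr0.
rewrite fpsM fpsD big_ord_recl big_ord_recr qratio0 mul1r subn0 /=; congr (_ + _).
rewrite /bump add1n subnn fscaleE expr0 qratio0 !mulr1 qratioS addrCA.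
rewrite [X in _ + (X - _)](eq_bigr (fun i : 'I_k => qratio i.+1 * qratio (k - i)%N * 'X^(k - i))).
  by rewrite subrr addr0 fmonoE eqSS; case: eqP.
by move=> i _; rewrite add1n subSS fscaleE mulrA mulrAC.
Qed.

Lemma qratio_z2 k : qratio k \in polyOver z2.
Proof.
have [n] := ubnP k; elim: n k => // n IHn [_|k ltn]; first by rewrite rpred1.
rewrite qratioS rpredB ?rpred_nat // rpred_sum // => i _.
move: (nat_of_ord i) (ltn_ord i) => {}i lti.
by rewrite !rpredM ?polyOverXn // IHn //; lia.
Qed.

(** As [qratio] stands for [E (Q y) / E y], this is [log E (Q y) - log E y], whence the factor
    [Q ^ k - 1] of [Glog_qlog]. *)
Definition qlog : fps {poly rat} := flog (qratio - 1).

Lemma isexp_qlog : isexp qlog qratio.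
Proof.
have := isexp_flog rpoly_unitS (X := qratio - 1).
by rewrite (addrC 1) subrK; apply; rewrite fpsB qratio0 subrr.
Qed.

Local Notation psi := (comp_poly ('X^2 : {poly rat})).

Definition qlog_red (k : nat) : {poly rat} :=
  qlog k - (2^-1)%:P * fsub 2 (fmap psi qlog) k.

(** Two Frobenius lifts in succession: [psi] on polynomials in [u] over [z2], then squaring of [y]
    over those polynomials. In two variables, [r (u ^ 2, y ^ 2) = r (u, y) ^ 2] modulo 2. *)
Lemma qratio_frobenius k :
  divby (polyOver_pred z2) 2 ((fsub 2 (fmap psi qratio) - qratio * qratio) k).
Proof.
have tr_over : fps_trunc k.+1 qratio \in polyOver (polyOver_pred z2).
  by apply/polyOverP => i; rewrite coef_poly; case: ifP; rewrite ?rpred0 ?qratio_z2.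
have psiS : {in polyOver_pred z2, forall c, psi c \in polyOver_pred z2}.
  by move=> c cS; apply: polyOver_comp; rewrite ?polyOverXn.
have psi2 : {in polyOver_pred z2, forall c : {poly rat},
    divby (polyOver_pred z2) 2 (c ^+ 2 - psi c)}.
  move=> c cS; have := @frobenius_lift _ _ (idfun : {rmorphism rat -> rat}) _ _ c cS.
  rewrite map_poly_id //; apply=> // x xz.
  by have [y yz e] := z2_sqr_sub xz; exists y.
have [s sS es] := frobenius_lift psiS psi2 tr_over.
exists (- s`_k); first by rewrite rpredN; apply: (polyOverP sS).
have := congr1 (fun p : {poly {poly rat}} => p`_k) es.
rewrite coefMn mulNrn => <-; rewrite coefB opprB fpsB expr2.
rewrite -(@fps_mul_trunc _ k.+1) //; congr (_ - _).
rewrite coef_comp_poly_Xn // fsubE; case: ifP => // _.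
by rewrite coef_map /= coef_poly ltnS leq_div.
Qed.

(** The valuation of [n + 1] is at most [n]. Hence [2 ^ (j + 1) / (j + 1)] is even, as needed for
    the logarithm of a series congruent to 1 modulo 2. *)
Lemma expn2_div_z2 n : (2 ^ n)%:R / n.+1%:R \in z2.
Proof.
have n0 : (0 < n.+1)%N by [].
have [m om em] : exists2 m, odd m & n.+1 = (2 ^ logn 2 n.+1 * m)%N.
  exists (n.+1`_2^')%N; first by rewrite odd_2'nat part_pnat.
  by rewrite -p_part partnC.
have le : (logn 2 n.+1 <= n)%N.
  rewrite -ltnS (leq_trans (ltn_expl _ (ltnSn 1))) //.
  by rewrite dvdn_leq // pfactor_dvdnn.
rewrite em natrM invfM mulrA -{1}(subnK le) expnD natrM mulfK.
  by rewrite rpredM ?z2_nat ?z2_invodd.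
by rewrite pnatr_eq0 -lt0n expn_gt0.
Qed.

(** Dwork's argument: [W = exp delta] is the quotient of [r (u ^ 2, y ^ 2)] by [r (u, y) ^ 2], hence
    1 modulo 2; so its logarithm [delta] is even, and [qlog_red] is [- delta / 2]. *)
Lemma qlog_red_z2 k : qlog_red k \in polyOver z2.
Proof.
pose delta := fsub 2 (fmap psi qlog) - (qlog + qlog).
have d0 : delta 0%N = 0.
  by rewrite !(fpsB, fpsD, fsubE) dvdn0 div0n fmapE; case: isexp_qlog => -> _ _; rewrite rmorph0 addr0 subr0.
have eW := isexp_fexp rpoly_unitS d0; set W := fexp delta in eW.
have W0 : W 0%N = 1 by case: eW.
have eL := isexp_fsub (ltn0Sn 1) (isexp_fmap psi isexp_qlog).
have eR := isexpM eW (isexpM isexp_qlog isexp_qlog).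
have WE : fsub 2 (fmap psi qratio) = W * (qratio * qratio).
  by apply: (isexp_uniq rpoly_unitS eL); rewrite /delta subrK in eR.
pose V := W - 1.
have VE : V * (qratio * qratio) = fsub 2 (fmap psi qratio) - qratio * qratio.
  by rewrite WE mulrBl mul1r.
have rr2 n : (qratio * qratio) n \in polyOver_pred z2.
  by rewrite fpsM rpred_sum // => i _; rewrite rpredM ?qratio_z2.
(* [V * r ^ 2] is even and [r ^ 2] has constant term 1, so evenness passes to [V] degree by
   degree. *)
have V2 n : divby (polyOver_pred z2) 2 (V n).
  have [m] := ubnP n; elim: m n => // m IHm n ltn.
  have := qratio_frobenius n; rewrite -VE fpsM big_ord_recr /= subnn.
  rewrite fpsM0 qratio0 !mulr1 => h; rewrite -[V n](addKr (\sum_(i < n) V i * (qratio * qratio) (n - i)%N)).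
  apply: divbyD h; apply: divbyN; apply: divby_sum => i _.
  by apply: divbyMr (rr2 _); apply: IHm; exact: leq_trans (ltn_ord i) _.
have VX j n : divby (polyOver_pred z2) (2 ^ j.+1) ((V ^+ j.+1) n).
  elim: j n => [|j IHj] n; first by rewrite expr1.
  by rewrite exprS fpsM expnS; apply: divby_sum => i _; apply: divbyM.
have dE : delta = flog V.
  apply: (isexp_inj rpoly_unitS eW).
  have := isexp_flog rpoly_unitS (X := V).
  by rewrite (addrC 1) subrK; apply; rewrite fpsB W0 subrr.
have [y yS ey] : divby (polyOver_pred z2) 2 (delta k).
  rewrite dE flogE; apply: divby_sum => j _; rewrite -mulrA.
  rewrite mulrC; apply: divbyMr; last exact: rpred_sign.
  have [y yS ->] := VX j k; exists (y * ((2 ^ j)%:R / j.+1%:R)%:P).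
    by rewrite rpredM // polyOverC expn2_div_z2.
  rewrite polyCM rmorphV ?rat_unitS // !rmorph_nat expnS.
  by rewrite mulnC mulrnA -(mulr_natr y) mulrA mulrnAl.
rewrite (_ : qlog_red k = - y) ?rpredN //.
have two : (2^-1)%:P *+ 2 = 1 :> {poly rat}.
  by rewrite -polyCMn -(mulr_natr (2^-1 : rat)) mulVf.
rewrite /qlog_red -[qlog k]mul1r -two mulrnAl -mulrnAr -mulrBr.
have -> : qlog k *+ 2 - fsub 2 (fmap psi qlog) k = - delta k.
  by rewrite /delta !(fpsB, fpsD) mulr2n opprB.
by rewrite ey mulrN mulrnAr -mulrnAl two mul1r.
Qed.

(** * Products over the powers of a root of unity *)

Section UnityCycle.
Variables (C : fieldType) (z : C) (d : nat) (r : fps C).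
Hypotheses (dgt0 : (0 < d)%N) (pz : d.-primitive_root z) (r0 : r 0%N = 1).
Hypothesis (r_rec : r * fscale z r = fscale z r + fmono 1 1).

Let y n : fps C := fmono (z ^+ n) 1.

(* By [r_rec], the 2 x 2 matrix ((1, y n), (1, 0)) maps (r_(n+1), 1) to
   r_(n+1) (r_n, 1), where r_n (y) = r (z^n y).  Hence S below is an eigenvalue of the
   product ((a, b), (c, e)) of these matrices for n < d.  Its trace is invariant
   under y -> z y and of degree less than d in y, so it is constant, equal to 1. *)
Fixpoint continuant (u v : fps C) (n : nat) : fps C :=
  if n is n'.+1 then
    if n' is n''.+1 then continuant u v n' + y n'' * continuant u v n'' else v
  else u.

Lemma continuantSS u v n : continuant u v n.+2 = continuant u v n.+1 + y n * continuant u v n.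
Proof. by []. Qed.

Let a := continuant 1 1.
Let c := continuant 0 1.
Let b n := if n is n'.+1 then y n' * a n' else 0.
Let e n := if n is n'.+1 then y n' * c n' else 1.

Let aS n : a n.+1 = a n + b n.
Proof. by case: n => [|n]; rewrite /a ?addr0 // continuantSS. Qed.
Let cS n : c n.+1 = c n + e n.
Proof. by case: n => [|n]; rewrite /c ?add0r // continuantSS. Qed.

Let rn n := fscale (z ^+ n) r.
Let P n := \prod_(i < n) rn i.+1.

Let rnS n : rn n * rn n.+1 = rn n.+1 + y n.
Proof.
have := congr1 (fscale (z ^+ n)) r_rec.
rewrite fscaleM fscaleD fscaleA -exprSr => ->; congr (_ + _).
by rewrite fscale_mono expr1 mulr1.
Qed.

Let eigen n : a n * rn n + b n = P n * r /\ c n * rn n + e n = P n.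
Proof.
elim: n => [|n [IH1 IH2]].
  rewrite /P big_ord0 /rn expr0 fscale_id /a /c /=; split; ring.
rewrite /P big_ord_recr -/(P n) /= aS cS; split.
  have -> : P n * rn n.+1 * r = P n * r * rn n.+1 by ring.
  rewrite -IH1; have := rnS n; rewrite /b -/(b n) => h.
  have -> : (a n * rn n + b n) * rn n.+1 = a n * (rn n * rn n.+1) + b n * rn n.+1 by ring.
  by rewrite h; ring.
rewrite -IH2; have h := rnS n.
have -> : (c n * rn n + e n) * rn n.+1 = c n * (rn n * rn n.+1) + e n * rn n.+1 by ring.
by rewrite h; ring.
Qed.

Let det n : a n * e n - b n * c n = \prod_(j < n) (- y j).
Proof.
elim: n => [|n IH]; first by rewrite big_ord0 /a /c /=; ring.
by rewrite big_ord_recr /= -IH aS cS; ring.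
Qed.

Let shift_y n : fscale z (y n) = y n.+1.
Proof. by rewrite fscale_mono expr1 -exprS. Qed.

(** Both sides satisfy the same recurrence of order two, whence the pairs of consecutive values.
    Together with [shift_c], this expands the matrix product at its first factor instead of its
    last. *)
Let shift_a n : fscale z (a n) = c n.+1 /\ fscale z (a n.+1) = c n.+2.
Proof.
elim: n => [|n [IH1 IH2]].
  by rewrite /a /c continuantSS /= fscale1 mulr0 addr0.
by split=> //; rewrite [a n.+2]continuantSS [c n.+3]continuantSS fscaleD fscaleM shift_y -/(a _) IH1 IH2.
Qed.

Let shift_c n : fscale z (a n) + y 0 * fscale z (c n) = a n.+1 /\
  fscale z (a n.+1) + y 0 * fscale z (c n.+1) = a n.+2.
Proof.
elim: n => [|n [IH1 IH2]].
  have fs0 : fscale z 0 = 0 by apply: fpsP => n; rewrite fscaleE mulr0.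
  rewrite /a /c !continuantSS /= fscale1 fs0; split; ring.
split=> //.
have -> : fscale z (a n.+2) = fscale z (a n.+1) + y n.+1 * fscale z (a n).
  by rewrite [a n.+2]continuantSS fscaleD fscaleM shift_y.
have -> : fscale z (c n.+2) = fscale z (c n.+1) + y n.+1 * fscale z (c n).
  by rewrite [c n.+2]continuantSS fscaleD fscaleM shift_y.
rewrite [a n.+3]continuantSS -/(a _) -[continuant 1 1 n.+1]/(a n.+1) -IH2 -IH1; ring.
Qed.

Let tr := a d + e d.

(** As [y d = y 0], the shift only moves the first factor of the product to the end, which preserves
    the trace. *)
Let tr_shift : fscale z tr = tr.
Proof.
rewrite /tr fscaleD; case: d dgt0 pz => // d' _ pz'.
have [-> _] := shift_a d'.+1; rewrite cS.
have [<- _] := shift_c d'; have [-> _] := shift_a d'.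
rewrite /e fscaleM shift_y /y (prim_expr_order pz') expr0; ring.
Qed.

Let continuant_deg (u v : fps C) n : (forall i, (0 < i)%N -> u i = 0) -> (forall i, (0 < i)%N -> v i = 0) ->
  forall i, (n < i.*2)%N -> continuant u v n i = 0.
Proof.
move=> hu hv; have [m] := ubnP n; elim: m n => // m IHm [|[|n]] ltn i lti.
- by apply: hu; lia.
- by apply: hv; lia.
rewrite continuantSS fpsD fmonoMl IHm ?add0r; [|lia..].
by case: ifP => // i0; rewrite IHm ?mulr0 //; lia.
Qed.

Let tr1 : tr = 1.
Proof.
have one i : (0 < i)%N -> (1 : fps C) i = 0 by case: i.
have zero i : (0 < i)%N -> (0 : fps C) i = 0 by [].
apply: fpsP => i; have [ltid|leid] := ltnP i d.
  case: i ltid => [_|i ltid].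
    rewrite fpsD; have a0 n : a n 0%N = 1.
      have [m] := ubnP n; elim: m n => // m IHm [|[|n]] // ltn.
      by rewrite [a _]continuantSS fpsD fmonoMl addr0 IHm //; lia.
    by rewrite a0; case: d dgt0 => // d' _; rewrite /e fmonoMl addr0.
  have /eqP := congr1 (fun f : fps C => f i.+1) tr_shift.
  rewrite /= fscaleE -subr_eq0 -{2}[tr i.+1]mul1r -mulrBl mulf_eq0.
  case/orP=> [|/eqP->]; last by [].
  rewrite subr_eq0 -(prim_order_dvd pz) => /dvdn_leq.
  by move=> /(_ isT); rewrite leqNgt ltid.
rewrite fps1; rewrite fpsD [a d i](continuant_deg one one); last by lia.
case: i leid => [|i] leid; first by lia.
rewrite add0r; case: d dgt0 leid => // d' _ leid; rewrite /e fmonoMl subn1 /=.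
case: d' leid => [|d'] leid; first by rewrite [c 0]/(0 : fps C) mulr0.
rewrite /c; case: i leid => [|i] leid; first by lia.
by rewrite (continuant_deg zero one) ?mulr0 //; lia.
Qed.

Lemma unity_cycle : let S := \prod_(i < d) fscale (z ^+ i) r in
  S * S = S + fmono 1 d.
Proof.
move=> S; have PS : P d = S.
  rewrite /P /S; case: d dgt0 pz => // d' _ pz'.
  by rewrite big_ord_recr big_ord_recl /= /rn (prim_expr_order pz') expr0 mulrC.
have rd : rn d = r by rewrite /rn (prim_expr_order pz) fscale_id.
have [] := eigen d; rewrite PS rd => e1 e2.
(* Evaluating the factorization of [X ^ d - 1] at 0 shows that the product of the [- z ^+ j] is -
   1. *)
have detE : \prod_(j < d) (- y j) = - fmono 1 d.
  have -> : \prod_(j < d) (- y j) = fmono (\prod_(j < d) (- z ^+ j)) d.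
    elim: d => [|n IH]; first by rewrite !big_ord0 fmono1.
    rewrite !big_ord_recr /= IH mulrN /y fmonoM addn1 mulrN.
    by apply: fpsP => i; rewrite fpsN !fmonoE; case: eqP; rewrite ?oppr0.
  have := congr1 (fun p : {poly C} => p.[0]) (factor_Xn_sub_1 pz).
  rewrite /= big_mkord horner_prod !hornerE.
  rewrite (eq_bigr (fun i : 'I_d => - z ^+ i)) => [->|i _]; last by rewrite !hornerE ?sub0r.
  rewrite expr0n eqn0Ngt dgt0 sub0r; apply: fpsP => i; rewrite fpsN !fmonoE.
  by case: eqP; rewrite ?oppr0.
(* The characteristic equation, applied to the eigenvector [(r, 1)]; then [r] is cancelled, having
   constant term 1. *)
have key : (S * S - tr * S - fmono 1 d) * r = 0.
  have -> : fmono 1 d = - (a d * e d - b d * c d) by rewrite det detE opprK.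
  have -> : (S * S - tr * S - - (a d * e d - b d * c d)) * r =
     (S - e d) * (S * r - b d - a d * r) + b d * (S - e d - c d * r) by rewrite /tr; ring.
  by rewrite -e1 -[in S - e d - _]e2; ring.
have := fps_mulr_eq0 r0 key; rewrite tr1 mul1r => /eqP.
by rewrite -addrA -opprD subr_eq0 => /eqP.
Qed.

End UnityCycle.

(** The difference of two solutions is killed by [S + T - 1], whose constant term is 1. This makes
    cycles of different lengths comparable. *)
Lemma quad_fps_uniq (C : comNzRingType) (S T : fps C) (w : fps C) :
    S 0%N = 1 -> T 0%N = 1 -> S * S = S + w -> T * T = T + w -> S = T.
Proof.
move=> S0 T0 eS eT; apply/eqP; rewrite -subr_eq0; apply/eqP.
apply: (@fps_mulr_eq0 _ _ (S + T - 1)).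
  by rewrite fpsB fpsD S0 T0 fps1 addrK.
have -> : (S - T) * (S + T - 1) = S * S - T * T - S + T by ring.
by rewrite eS eT; ring.
Qed.

Definition eval_algC (z : algC) : {rmorphism {poly rat} -> algC} :=
  (horner_eval z) \o (map_poly ratr).

Lemma eval_algCX z : eval_algC z 'X = z.
Proof. by rewrite /eval_algC /= map_polyX /horner_eval hornerX. Qed.

Lemma eval_algC_sqr z p : eval_algC (z ^+ 2) p = eval_algC z (p \Po 'X^2).
Proof.
by rewrite /eval_algC /= /horner_eval map_comp_poly map_polyXn horner_comp hornerXn.
Qed.

Lemma algC_unitS n : n.+1%:R \is a @GRing.unit algC.
Proof. by rewrite unitfE pnatr_eq0. Qed.

Lemma qratio_at z : let r := fmap (eval_algC z) qratio in
  r * fscale z r = fscale z r + fmono 1 1.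
Proof.
move=> r; have := congr1 (fmap (eval_algC z)) qratio_rec.
by rewrite fmapM fmapD fmap_fscale fmap_mono rmorph1 eval_algCX.
Qed.

Lemma cycle_log (z : algC) d : (0 < d)%N -> d.-primitive_root z ->
  exists2 S : fps algC, S 0%N = 1 /\ S * S = S + fmono 1 d &
    isexp (\sum_(i < d) fscale (z ^+ i) (fmap (eval_algC z) qlog)) S.
Proof.
move=> d0 pz; have r0 : fmap (eval_algC z) qratio 0%N = 1 by rewrite fmapE qratio0 rmorph1.
have := unity_cycle d0 pz r0 (qratio_at z); set S := \prod_(i < d) _ => /= eS.
have iS : isexp (\sum_(i < d) fscale (z ^+ i) (fmap (eval_algC z) qlog)) S.
  by apply: isexp_prod => i _; apply/isexp_fscale/isexp_fmap/isexp_qlog.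
by exists S => //; split=> //; case: iS.
Qed.

Lemma sum_fscale_dvd (C : comNzRingType) (z : C) d k (f : fps C) :
  z ^+ d = 1 -> (d %| k)%N -> (\sum_(i < d) fscale (z ^+ i) f) k = f k *+ d.
Proof.
move=> zd /dvdnP[m ->]; rewrite fps_sum (eq_bigr (fun=> f (m * d)%N)).
  by rewrite sumr_const card_ord.
by move=> i _; rewrite fscaleE -exprM mulnA mulnC exprM zd expr1n mul1r.
Qed.

(** With [d = 2 e], let [S] be the product for [z] and [T] the one for [z ^ 2], of order [e]. Both
    [S] and [T (y ^ 2)] solve [S ^ 2 = S + y ^ d], so they coincide. Coefficient [k] of their
    logarithms gives [d * qlog k] at [z] equal to [e * qlog (k / 2)] at [z ^ 2]. *)
Lemma qlog_red_root (z : algC) d k : (0 < d)%N -> (2 %| d)%N -> (d %| k)%N ->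
  d.-primitive_root z -> root (map_poly ratr (qlog_red k)) z.
Proof.
move=> d0 /dvdnP[e de] dk pz.
have e0 : (0 < e)%N by lia.
have pz2 : e.-primitive_root (z ^+ 2).
  have := dvdn_prim_root pz (_ : (e %| d)%N).
  by rewrite de mulKn // => -> //; rewrite dvdn_mulr.
have [S [S0 eS] iS] := cycle_log d0 pz.
have [T [T0 eT] iT] := cycle_log e0 pz2.
have ST : S = fsub 2 T.
  apply: (quad_fps_uniq S0 _ eS); first by rewrite fsubE dvdn0 div0n.
  by rewrite -fsubM // eT fsubD fsub_mono // -de.
have := congr1 (fun f : fps algC => f k)
  (isexp_inj algC_unitS iS (eq_ind_r (isexp _) (isexp_fsub (ltn0Sn 1) iT) ST)).
have k2 : (2 %| k)%N by apply: dvdn_trans dk; rewrite de dvdn_mull.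
have ek : (e %| k %/ 2)%N by rewrite dvdn_divRL // -de.
rewrite /= fsubE k2 (sum_fscale_dvd _ (prim_expr_order pz) dk).
rewrite (sum_fscale_dvd _ (prim_expr_order pz2) ek).
rewrite !fmapE eval_algC_sqr de mulnC mulrnA => /(pmulrnI e0) eq.
rewrite /root -[_.[z]]/(eval_algC z (qlog_red k)) /qlog_red rmorphB rmorphM fsubE k2 fmapE -eq.
have -> : eval_algC z (2^-1)%:P = 2^-1.
  by rewrite /eval_algC /= /horner_eval map_polyC hornerC /= fmorphV rmorph_nat.
by rewrite -(mulr_natl (eval_algC z (qlog k))) mulKf ?pnatr_eq0 // subrr.
Qed.

(** The roots of [X ^ k - 1] are simple: those of even order are roots of [qlog_red k], and those of
    odd order have an order dividing the odd part of [k]. *)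
Lemma qlog_red_dvd k : (0 < k)%N ->
  ('X^k - 1 %| qlog_red k * ('X^(k`_2^')%N - 1))%R.
Proof.
move=> k0; set k' := (k`_2^')%N; rewrite -(dvdp_map (ratr : rat -> algC)).
have mapXn n : map_poly ratr ('X^n - 1) = 'X^n - 1 :> {poly algC}.
  by rewrite rmorphB rmorph1 /= map_polyXn.
rewrite rmorphM /= !mapXn.
have [w pw] := C_prim_root_exists k0; rewrite -(factor_Xn_sub_1 pw).
rewrite -(big_map (fun i => w ^+ i) xpredT (fun x => 'X - x%:P)).
apply: uniq_roots_dvdp; last first.
  rewrite uniq_rootsE map_inj_in_uniq ?iota_uniq // => i j.
  rewrite !mem_index_iota /= => ltik ltjk /eqP; rewrite (eq_prim_root_expr pw).
  by rewrite !modn_small // => /eqP.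
apply/allP => _ /mapP[i _ ->]; set x := w ^+ i.
have xk : x ^+ k = 1 by rewrite /x exprAC (prim_expr_order pw) expr1n.
have [d pd dk] := prim_order_exists k0 xk.
have d0 : (0 < d)%N by apply: prim_order_gt0 pd.
rewrite rootM; have [d2|odd_d] := boolP (2 %| d)%N; first by rewrite (qlog_red_root d0 d2 dk pd).
apply/orP; right; rewrite /root !(hornerXn, hornerE) subr_eq0.
rewrite -(prim_order_dvd pd) /k' -(part_pnat_id (_ : (2^').-nat d)%N); last by rewrite p'natE.
exact: partn_dvd.
Qed.

(** Division by the monic [X ^ k - 1] creates no denominators: [chi_i] and [chi_(i - k)] differ by a
    coefficient of the left-hand side. *)
Lemma qlog_red_factor k : (0 < k)%N -> exists2 chi : {poly rat}, chi \in polyOver z2 &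
  qlog_red k * ('X^(k`_2^')%N - 1) = chi * ('X^k - 1).
Proof.
move=> k0; have /dvdpP[chi echi] := qlog_red_dvd k0; exists chi => //.
apply/polyOverP => i; have [m] := ubnP i; elim: m i => // m IHm i lti.
have : (qlog_red k * ('X^(k`_2^')%N - 1)) \in polyOver z2.
  by rewrite rpredM ?qlog_red_z2 // rpredB ?polyOverXn ?rpred1.
move/polyOverP/(_ i); rewrite echi mulrBr mulr1 coefB coefMXn.
case: ltnP => [_|leki]; first by rewrite sub0r rpredN.
by move=> h; rewrite -[chi`_i](subKr chi`_(i - k)) rpredB // IHm //; lia.
Qed.

(** * Specialization of the logarithm at [u = 1 / Q] *)

Definition glcard (n Q : nat) : nat :=
  (Q ^ 'C(n, 2) * \prod_(1 <= i < n.+1) (Q ^ i - 1))%N.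

Lemma glcardS n Q : glcard n.+1 Q = (Q ^ n * (Q ^ n.+1 - 1) * glcard n Q)%N.
Proof.
rewrite /glcard big_nat_recr //= binS bin1 expnD.
by rewrite mulnACA mulnC.
Qed.

Definition Eser (Q : nat) : fps rat := Fps (fun n => (glcard n Q)%:R^-1).
Definition Glog (Q : nat) : fps rat := flog (Eser Q - 1).

Lemma glcard0 Q : glcard 0 Q = 1%N.
Proof. by rewrite /glcard big_geq. Qed.

Lemma Eser0 Q : Eser Q 0%N = 1.
Proof. by rewrite /Eser /fcoef glcard0 invr1. Qed.

Lemma isexp_Glog Q : isexp (Glog Q) (Eser Q).
Proof.
have := isexp_flog rat_unitS (X := Eser Q - 1).
by rewrite (addrC 1) subrK; apply; rewrite fpsB Eser0 subrr.
Qed.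

Section Glog.
Variable Q : nat.
Hypothesis Q1 : (1 < Q)%N.
Let q : rat := Q%:R.
Let u : rat := q^-1.

Let q_neq0 : q != 0.
Proof. by rewrite pnatr_eq0 -lt0n ltnW. Qed.

Lemma qX_sub1_neq0 n : (0 < n)%N -> q ^+ n - 1 != 0.
Proof.
move=> n0; rewrite subr_eq0 -natrX pnatr_eq1 gtn_eqF //.
by rewrite -{1}(expn0 Q) ltn_exp2l.
Qed.

Lemma EserS n : (q ^+ n.+1 - 1) * Eser Q n.+1 = u ^+ n * Eser Q n.
Proof.
rewrite /Eser /fcoef glcardS; move: (glcard n Q) => g.
rewrite !natrM natrB ?expn_gt0 ?(ltnW Q1) // !natrX -/q.
by rewrite (mulrC (q ^+ n)) -mulrA invfM mulVKf ?qX_sub1_neq0 // invfM exprVn.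
Qed.

Let ev : {rmorphism {poly rat} -> rat} := horner_eval u.

(** By the functional equations of [r] and [E], the series [D = r E - E (Q y)] satisfies
    [r (u y) * D y = - y * D (u y)], which expresses each coefficient of [D] through lower ones. So
    [D = 0], and logarithms can be taken in [r E = E (Q y)]. *)
Lemma Glog_qlog k : (q ^+ k - 1) * Glog Q k = (qlog k).[u].
Proof.
pose r := fmap ev qratio; pose E := Eser Q.
have evX : ev 'X = u by rewrite /ev /= /horner_eval hornerX.
have rE : r * fscale u r = fscale u r + fmono 1 1.
  have := congr1 (fmap ev) qratio_rec.
  by rewrite fmapM fmapD fmap_fscale fmap_mono rmorph1 evX.
have r0 : r 0%N = 1 by rewrite fmapE qratio0 rmorph1.
have uqE f : fscale u (fscale q f) = f by rewrite fscaleA mulVf ?fscale_id.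
have Erec : fscale q E = E + fmono 1 1 * fscale u E.
  apply: fpsP => -[|n]; rewrite fpsD fmonoMl fscaleE.
    by rewrite expr0 mul1r addr0.
  rewrite subn1 fscaleE mul1r -EserS mulrBl mul1r addrC subrK //.
pose D := r * E - fscale q E.
have D0 : D 0%N = 0 by rewrite fpsB fpsM0 fscaleE r0 Eser0 expr0 subrr.
have eD : fscale u r * D = - (fmono 1 1 * fscale u D).
  rewrite /D fscaleD -[fscale u (- _)](_ : - E = _); last first.
    by apply: fpsP => n; rewrite fscaleE !fpsN mulrN -fscaleE uqE.
  rewrite fscaleM mulrBr (mulrA (fscale u r) r) (mulrC (fscale u r) r) rE Erec; ring.
have Dz : D = 0.
  apply: fpsP => n; have [m] := ubnP n; elim: m n => // m IHm [//|n] ltn.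
  have /eqP := congr1 (fun f : fps rat => f n.+1) eD.
  rewrite /= fpsN fmonoMl subn1 fscaleE IHm // fps0 !mulr0 oppr0 fpsM.
  rewrite big_ord_recl big1 ?addr0 => [|i _].
    by rewrite fscaleE expr0 r0 !mul1r subn0 => /eqP.
  by rewrite IHm ?fps0 ?mulr0 // lift0 subSS; lia.
have rEE : r * E = fscale q E by apply/eqP; rewrite -subr_eq0 -/D Dz.
have := isexpM (isexp_fmap ev isexp_qlog) (isexp_Glog Q).
rewrite -/r -/E rEE => i1; have i2 := isexp_fscale q (isexp_Glog Q).
have /(congr1 (fun f : fps rat => f k)) := isexp_inj rat_unitS i2 i1.
by rewrite /= fscaleE fpsD fmapE mulrBl mul1r => ->; rewrite addrK.
Qed.

End Glog.

Definition Gred (Q : nat) : fps rat :=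
  Fps (fun k => Glog Q k - 2^-1 * fsub 2 (Glog (Q ^ 2)) k).

Lemma GredE Q k : Gred Q k = Glog Q k - 2^-1 * fsub 2 (Glog (Q ^ 2)) k.
Proof. by []. Qed.

Lemma Gred_qlog_red Q k : (1 < Q)%N ->
  (Q%:R ^+ k - 1) * Gred Q k = (qlog_red k).[Q%:R^-1].
Proof.
move=> Q1; rewrite GredE mulrBr Glog_qlog // /qlog_red hornerD hornerN hornerM hornerC.
congr (_ - _); rewrite mulrCA; congr (_ * _); rewrite !fsubE.
case: ifP => [d2|_]; last by rewrite mulr0 horner0.
have Q2 : (1 < Q ^ 2)%N by rewrite -{1}(exp1n 2) ltn_exp2r.
rewrite fmapE /= horner_comp hornerXn exprVn -(natrX _ Q 2) -Glog_qlog //.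
by rewrite natrX -exprM mulnC divnK.
Qed.

Lemma odd_geo Q n : odd Q -> odd (\sum_(i < n) Q ^ i)%N = odd n.
Proof.
move=> oQ; elim: n => [|n IH]; first by rewrite big_ord0.
by rewrite big_ord_recr oddD IH oddX oQ orbT addbT.
Qed.

(** The odd part [k'] of [k] costs nothing: [Q ^ k' - 1] is [Q - 1] times a sum of [k'] odd terms, a
    unit of [z2]. *)
Lemma Gred_z2 Q k : odd Q -> (1 < Q)%N -> (0 < k)%N ->
  (Q%:R - 1) * Gred Q k \in z2.
Proof.
move=> oQ Q1 k0; have [chi chiS echi] := qlog_red_factor k0.
set k' := (k`_2^')%N in echi; set q : rat := Q%:R; pose u := q^-1.
have q0 : q != 0 by rewrite pnatr_eq0 -lt0n ltnW.
have k'k : (k' <= k)%N by rewrite dvdn_leq // dvdn_part.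
have k'0 : (0 < k')%N by rewrite part_gt0.
have qk := qX_sub1_neq0 Q1 k0.
have := congr1 (fun p : {poly rat} => p.[u]) echi.
have hX n : ('X^n - 1 : {poly rat}).[u] = u ^+ n - 1 by rewrite !(hornerXn, hornerE).
rewrite /= !hornerM !hX -[(qlog_red k).[u]](Gred_qlog_red k Q1) -/q => e.
pose s := (\sum_(i < k') Q ^ i)%N.
have os : odd s.
  by rewrite odd_geo // odd_2'nat part_pnat.
have es : q ^+ k' - 1 = (q - 1) * s%:R.
  by rewrite subrX1 natr_sum; congr (_ * _); apply: eq_bigr => i _; rewrite natrX.
have s0 : s%:R != 0 :> rat by rewrite pnatr_eq0; case: s os {es}.
(* Writing [u ^ n - 1] as [- u ^ n (Q ^ n - 1)] on both sides cancels [Q ^ k - 1], the dangerous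
   denominator. *)
have -> : (q - 1) * Gred Q k = u ^+ (k - k') * chi.[u] / s%:R.
  apply: (mulIf s0); rewrite mulfVK // mulrAC -es.
  apply: (mulIf qk); have uq n : q ^+ n * u ^+ n = 1.
    by rewrite -exprMn mulfV // expr1n.
  have uq1 n : u ^+ n - 1 = - (u ^+ n * (q ^+ n - 1)).
    by rewrite mulrBr mulr1 mulrC uq opprB.
  move: e; rewrite !uq1 !mulrN => /oppr_inj.
  have -> : u ^+ k = u ^+ (k - k') * u ^+ k' by rewrite -exprD subnK.
  rewrite -/q => e.
  apply: (mulfI (expf_neq0 k' (invr_neq0 q0))); rewrite -/u.
  transitivity ((q ^+ k - 1) * Gred Q k * (u ^+ k' * (q ^+ k' - 1))); first by ring.
  by rewrite e; ring.
have uz : u \in z2 by rewrite z2_invodd.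
rewrite !rpredM ?z2_invodd ?rpredX //.
by rewrite horner_coef rpred_sum // => i _; rewrite rpredM ?rpredX // (polyOverP chiS).
Qed.

(** Here the bound of [Gred_z2] is attained, which fixes the exact valuations of the two leading
    coefficients. *)
Lemma Gred1 Q : (1 < Q)%N -> Gred Q 1 = (Q%:R - 1)^-1.
Proof.
move=> Q1; rewrite GredE fsubE /= mulr0 subr0.
have := isexp_recE 0 (isexp_Glog Q).
rewrite big_ord_recl big_ord0 subnn Eser0 mulr1 addr0 !mulr1n => <-.
by rewrite /Eser /fcoef /glcard bin_small // big_nat1 expn0 mul1n expn1 natrB // ltnW.
Qed.

(** * Valuation of the exponential *)

Lemma logn2_odd n : odd n -> logn 2 n = 0%N.
Proof. by move=> on; rewrite lognE; case: (2 %| n)%N (dvdn2 n) => //=; rewrite ?andbF // on. Qed.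

Lemma logn2_fact n : logn 2 n`! = (n %/ 2 + logn 2 (n %/ 2)`!)%N.
Proof.
have E m : logn 2 (m.*2)`! = (m + logn 2 m`!)%N.
  elim: m => // m IHm; rewrite doubleS !factS !lognM ?muln_gt0 ?fact_gt0 //.
  rewrite (logn2_odd (_ : odd m.*2.+1)) ?oddS ?odd_double // IHm -doubleS -mul2n lognM //.
  rewrite (_ : logn 2 2 = 1%N) //; lia.
rewrite divn2 -[in LHS](odd_double_half n); case: (odd n); last exact: E.
by rewrite add1n factS lognM ?fact_gt0 // E logn2_odd //= odd_double.
Qed.

Lemma logn2_fact_lt n : (0 < n)%N -> (logn 2 n`! < n)%N.
Proof.
have [m] := ubnP n; elim: m n => // m IHm n ltn n0; rewrite logn2_fact.
have [->|h0] := posnP (n %/ 2); first by [].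
have := IHm _ _ h0; have := ltn_Pdiv (isT : (1 < 2)%N) n0; lia.
Qed.

Lemma logn2_factD m n k : (m + n <= k)%N ->
  (logn 2 m`! + logn 2 n`! <= logn 2 k`!)%N.
Proof.
move=> le; rewrite -lognM ?fact_gt0 //; apply: dvdn_leq_log; rewrite ?fact_gt0 //.
have [le1 le2] : (m + n <= k)%N /\ (m <= m + n)%N by split=> //; apply: leq_addr.
rewrite -(bin_fact le1) -(bin_fact le2) addKn.
by apply/dvdn_mull/dvdn_mulr/dvdn_mull.
Qed.

(** The power of 2 allowed in the denominator of coefficient [n]. With [N = n / 2 ^ l], it is the
    one of [twoterm N / (2 ^ N N!)]: the numerator is divisible by [2 ^ (N / 2 - N / 4)], and
    Legendre's formula is applied twice to [N!]. *)
Definition vphi (l n : nat) : nat :=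
  (n %/ 2 ^ l + 2 * (n %/ 2 ^ l.+2) + logn 2 (n %/ 2 ^ l.+2)`!)%N.

Lemma vphi0 l : vphi l 0 = 0%N. Proof. by rewrite /vphi !div0n. Qed.

(** Superadditivity makes the bound stable under products of series. *)
Lemma vphiD l i j : (vphi l i + vphi l j <= vphi l (i + j))%N.
Proof.
rewrite /vphi; have d m : (i %/ m + j %/ m <= (i + j) %/ m)%N.
  have [->|m0] := posnP m; first by rewrite !divn0.
  by rewrite leq_divRL // mulnDl leq_add ?leq_trunc_div.
by have := d (2 ^ l)%N; have := d (2 ^ l.+2)%N; have := logn2_factD (d (2 ^ l.+2)%N); lia.
Qed.

Lemma vphiMl l n : vphi l (2 ^ l * n) = vphi 0 n.
Proof.
rewrite /vphi mulKn ?expn_gt0 // expn0 divn1.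
by rewrite -(addn2 l) expnD divnMl ?expn_gt0.
Qed.

(** [z2e] is the maximal ideal of the local ring [z2], and [z2o] its group of units, the residue
    field having two elements. *)
Definition z2e (x : rat) := x / 2 \in z2.
Definition z2o (x : rat) := z2e (x - 1).

Lemma z2e_z2 x : z2e x -> x \in z2.
Proof. by move=> h; rewrite -[x](divfK (_ : 2 != 0)) // rpredM // z2_nat. Qed.
Lemma z2o_z2 x : z2o x -> x \in z2.
Proof. by move=> /z2e_z2 h; rewrite -[x](subrK 1) rpredD ?rpred1. Qed.
Lemma z2eD x y : z2e x -> z2e y -> z2e (x + y).
Proof. by rewrite /z2e mulrDl => hx hy; rewrite rpredD. Qed.
Lemma z2eMr x y : z2e x -> y \in z2 -> z2e (x * y).
Proof. by rewrite /z2e mulrAC => hx hy; rewrite rpredM. Qed.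
Lemma z2oM x y : z2o x -> z2o y -> z2o (x * y).
Proof.
move=> hx hy; rewrite /z2o (_ : x * y - 1 = (x - 1) * y + (y - 1)); last by ring.
by apply: z2eD => //; apply: z2eMr => //; apply: z2o_z2.
Qed.
Lemma z2ooD x y : z2o x -> z2o y -> z2e (x + y).
Proof.
move=> hx hy; rewrite (_ : x + y = (x - 1) + (y - 1) + 1 * 2); last by ring.
by apply: z2eD; [apply: z2eD | rewrite /z2e mulfK ?rpred1].
Qed.
Lemma z2eoD x y : z2e x -> z2o y -> z2o (x + y).
Proof. by move=> hx hy; rewrite /z2o -addrA; apply: z2eD. Qed.
Lemma z2o_nat n : odd n -> z2o n%:R.
Proof.
move=> on; rewrite /z2o /z2e -[n]odd_double_half on natrD addrC addKr.
by rewrite -muln2 natrM mulfK ?z2_nat.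
Qed.
Lemma z2e_nat n : ~~ odd n -> z2e n%:R.
Proof.
move=> on; rewrite /z2e -[n]odd_double_half (negPf on) add0n.
by rewrite -muln2 natrM mulfK ?z2_nat.
Qed.
Lemma z2o_invodd n : odd n -> z2o n%:R^-1.
Proof.
move=> on; have n0 : n%:R != 0 :> rat by rewrite pnatr_eq0; case: n on.
rewrite /z2o (_ : _ - 1 = (1 - n%:R) * n%:R^-1); last by field.
apply: z2eMr; last exact: z2_invodd.
by rewrite /z2e -opprB mulNr rpredN; apply: z2o_nat.
Qed.

Lemma fact_2part n : exists2 m, odd m & n`! = (2 ^ logn 2 n`! * m)%N.
Proof.
exists (n`!`_2^')%N; first by rewrite odd_2'nat part_pnat.
by rewrite -p_part partnC ?fact_gt0.
Qed.

Section TwoTerm.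
Variables u w : rat.
Hypotheses (uo : z2o u) (wo : z2o w).

(* [2 ^ n n!] times the coefficients of exp (u x / 2 + w x^2 / 8). *)
Fixpoint twoterm (n : nat) : rat :=
  if n is n'.+1 then
    if n' is n''.+1 then u * twoterm n' + w * n'%:R * twoterm n'' else u
  else 1.

Lemma twotermSS n : twoterm n.+2 = u * twoterm n.+1 + w * n.+1%:R * twoterm n.
Proof. by []. Qed.

(** Four steps of the recurrence bring a pair of odd numbers back to such a pair, up to one factor
    2. That factor appears at the second entry after [4 M], a sum of two odd terms. *)
Lemma twoterm4 M : exists a b, [/\ z2o a, z2o b, twoterm (4 * M) = 2 ^+ M * a &
  twoterm (4 * M).+1 = 2 ^+ M * b].
Proof.
elim: M => [|M [a [b [ao bo ea eb]]]].
  by exists 1, u; split; rewrite ?muln0 ?expr0 ?mul1r //; apply: (@z2o_nat 1).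
set c := (u * b + w * (4 * M).+1%:R * a) / 2.
have cz : c \in z2.
  apply: (@z2ooD (u * b)); [exact: z2oM | apply: z2oM ao; apply: z2oM wo _].
  by apply: z2o_nat; rewrite oddS oddM.
have e2 : twoterm (4 * M).+2 = 2 ^+ M.+1 * c.
  by rewrite twotermSS ea eb /c exprS; field.
set d := u * c + w * (2 * M).+1%:R * b.
have dz : d \in z2.
  by do ?[by [] | exact: z2o_z2 | exact: z2_nat | apply: rpredD | apply: rpredM].
have e3 : twoterm (4 * M).+3 = 2 ^+ M.+1 * d.
  rewrite twotermSS e2 eb /d (_ : (4 * M).+2 = (2 * (2 * M).+1)%N); last by lia.
  by rewrite natrM exprS; ring.
set a' := u * d + w * (4 * M).+3%:R * c.
have e4 : twoterm (4 * M).+4 = 2 ^+ M.+1 * a'.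
  by rewrite twotermSS e3 e2 /a'; ring.
have a'o : z2o a'.
  (* The parity of [c] is unknown; after regrouping, its coefficient is a sum of two odd numbers, so
     the last term alone makes [a'] odd. *)
  rewrite (_ : a' = (u * u + w * (4 * M).+3%:R) * c + u * w * (2 * M).+1%:R * b); last first.
    by rewrite /a' /d; ring.
  apply: z2eoD; first apply: z2eMr cz.
    by apply: z2ooD; apply: z2oM => //; apply: z2o_nat; rewrite !oddS oddM.
  by apply: z2oM => //; apply: z2oM; [exact: z2oM | apply: z2o_nat; rewrite oddS oddM].
exists a', (u * a' + w * (4 * M).+4%:R * d).
rewrite (_ : (4 * M.+1)%N = (4 * M).+4); last by lia.
split=> //; last by rewrite twotermSS e4 e3; ring.
rewrite addrC; apply: z2eoD; last exact: z2oM.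
apply: z2eMr dz; rewrite mulrC; apply: z2eMr (z2o_z2 wo).
by apply: z2e_nat; rewrite !oddS oddM.
Qed.

(** Over a block of four, [N / 2 - N / 4] takes the values [M, M, M + 1, M + 1]. *)
Lemma twoterm_val N : twoterm N / 2 ^+ (N %/ 2 - N %/ 4) \in z2.
Proof.
have [a [b [ao bo ea eb]]] := twoterm4 (N %/ 4).
set M := (N %/ 4)%N in ea eb *.
have twoX n : (2 : rat) ^+ n != 0 by rewrite expf_neq0.
have cz : (u * b + w * (4 * M).+1%:R * a) / 2 \in z2.
  apply: (@z2ooD (u * b)); [exact: z2oM | apply: z2oM ao; apply: z2oM wo _].
  by apply: z2o_nat; rewrite oddS oddM.
have NE : N = (4 * M + N %% 4)%N by rewrite mulnC -divn_eq.
have lt4 : (N %% 4 < 4)%N by rewrite ltn_mod.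
have uz := z2o_z2 uo; have wz := z2o_z2 wo.
case E: (N %% 4)%N lt4 NE => [|[|[|[|//]]]] _ NE.
- have -> : (N %/ 2 - M = M)%N by lia.
  by rewrite NE addn0 ea mulrC mulKf ?z2o_z2.
- have -> : (N %/ 2 - M = M)%N by lia.
  by rewrite NE addn1 eb mulrC mulKf ?z2o_z2.
- have -> : (N %/ 2 - M = M.+1)%N by lia.
  rewrite NE addn2 twotermSS ea eb exprS (_ : _ / _ = (u * b + w * (4 * M).+1%:R * a) / 2) //.
  by field.
- have -> : (N %/ 2 - M = M.+1)%N by lia.
  rewrite NE addn3 twotermSS twotermSS ea eb exprS (_ : _ / _ = u * ((u * b + w * (4 * M).+1%:R * a) / 2)
     + w * (2 * M).+1%:R * b).
    by do ?[by [] | exact: z2o_z2 | exact: z2_nat | apply: rpredD | apply: rpredM].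
  have -> : (4 * M).+2%:R = 2 * (2 * M).+1%:R :> rat by rewrite -natrM; congr _%:R; lia.
  by field.
Qed.

Definition twoterm_exp : fps rat := Fps (fun n => twoterm n / (2 ^+ n * n`!%:R)).

Lemma isexp_twoterm_exp : isexp (fmono (u / 2) 1 + fmono (w / 8) 2) twoterm_exp.
Proof.
split; first by rewrite fpsD !fmonoE addr0.
  by rewrite /twoterm_exp /fcoef /= expr0 mul1r divr1.
have f0 n : n`!%:R != 0 :> rat by rewrite pnatr_eq0 -lt0n fact_gt0.
have th c k : theta (fmono c k) = fmono (c *+ k) k :> fps rat.
  by apply: fpsP => n; rewrite thetaE !fmonoE; case: eqP => [->|]; rewrite ?mul0rn.
have tE n : twoterm_exp n = twoterm n / (2 ^+ n * n`!%:R) by [].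
apply: fpsP => n; rewrite thetaD !th mulrDl fpsD !fmonoMl thetaE !tE.
case: n => [|[|n]]; rewrite ?mulr0n ?addr0 //.
  by rewrite !subn1 /= expr0 expr1 !mulr1 mulr1n.
rewrite (_ : (0 < n.+2)%N = true) // (_ : (1 < n.+2)%N = true) //.
rewrite twotermSS !subSS !subn0 !factS -[LHS]mulr_natr mulr1n -(mulr_natr (w / 8)) !exprS.
rewrite !(natrM _ n.+2) !(natrM _ n.+1).
have e2 : (2 : rat) ^+ n != 0 by rewrite expf_neq0.
have n1 : n.+1%:R != 0 :> rat by rewrite pnatr_eq0.
have n2 : n.+2%:R != 0 :> rat by rewrite pnatr_eq0.
move: (f0 n) n1 n2 e2; move: (n`!%:R) (n.+1%:R) (n.+2%:R) (2 ^+ n) (twoterm n) (twoterm n.+1) => f x y e s t hf hx hy he.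
by field; rewrite hf hx hy he.
Qed.

Lemma twoterm_exp_val N : exists2 x, x \in z2 & 2 ^+ vphi 0 N * twoterm_exp N = x /\
  ((4 %| N)%N -> z2o x).
Proof.
have [m om em] := fact_2part N.
have L : logn 2 N`! = (N %/ 2 + N %/ 4 + logn 2 (N %/ 4)`!)%N.
  by rewrite logn2_fact logn2_fact -divnMA addnA.
exists (twoterm N / 2 ^+ (N %/ 2 - N %/ 4) / m%:R).
  by rewrite rpredM ?twoterm_val ?z2_invodd.
split; last first.
  move=> /dvdnP[M eN]; have [a [b [ao _ ea _]]] := twoterm4 M.
  have -> : (N %/ 2 - N %/ 4 = M)%N by lia.
  by rewrite eN mulnC ea (mulrC (2 ^+ M)) mulfK ?expf_neq0 //; apply: z2oM ao (z2o_invodd om).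
rewrite /twoterm_exp /fcoef {1}em natrM natrX.
rewrite /vphi expn0 divn1 -[(2 ^ 2)%N]/4%N.
have E : (N + 2 * (N %/ 4) + logn 2 (N %/ 4)`! + (N %/ 2 - N %/ 4) = N + logn 2 N`!)%N.
  by rewrite L; lia.
have m0 : m%:R != 0 :> rat by rewrite pnatr_eq0; case: m om {em}.
have tX n : (2 : rat) ^+ n != 0 by rewrite expf_neq0.
have := congr1 (fun n => (2 : rat) ^+ n) E.
rewrite /= [in LHS]exprD [in RHS]exprD.
move: (tX N) (tX (logn 2 N`!)) (tX (N %/ 2 - N %/ 4)%N).
move: (2 ^+ N) (2 ^+ logn 2 N`!) (2 ^+ (N %/ 2 - N %/ 4)) (2 ^+ (_ + _)) => A B C D A0 B0 C0 e.
apply: (mulIf C0); rewrite [RHS]mulrAC divfK // mulrAC e; field.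
by rewrite m0 B0 A0.
Qed.

End TwoTerm.

(** * Perturbation by exponentials of negligible monomials *)

Section Bounded.
Variable l : nat.
Implicit Types f g : fps rat.

Definition bounded f := forall n, 2 ^+ vphi l n * f n \in z2.
Definition strict f := f 0%N = 1 /\ forall n, (0 < n)%N -> z2e (2 ^+ vphi l n * f n).

Lemma strict_bounded f : strict f -> bounded f.
Proof.
case=> f0 fS [|n]; last exact: z2e_z2 (fS _ _).
by rewrite vphi0 f0 mulr1 rpred1.
Qed.

Lemma vphi_mulE f g n i : (i <= n)%N -> exists2 c, c \in z2 &
  2 ^+ vphi l n * (f i * g (n - i)%N) =
  2 ^+ vphi l i * f i * (2 ^+ vphi l (n - i) * g (n - i)%N) * c.
Proof.
move=> lein; exists (2 ^+ (vphi l n - (vphi l i + vphi l (n - i)))).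
  by rewrite rpredX ?(z2_nat 2).
have le := vphiD l i (n - i); rewrite subnKC // in le.
by rewrite -[in LHS](subnKC le) !exprD; ring.
Qed.

(** Apart from [f n * g 0], each term of the convolution is even after scaling, through its factor
    from [g]. A strict factor thus never changes the parity that decides equality. *)
Lemma bounded_strict f g n : bounded f -> strict g ->
  z2e (2 ^+ vphi l n * (f * g) n - 2 ^+ vphi l n * f n).
Proof.
move=> fb [g0 gS]; rewrite fpsM big_ord_recr /= subnn g0 mulr1 mulrDr addrK mulr_sumr.
elim/big_rec: _ => [|i x _ hx]; first by rewrite /z2e mul0r rpred0.
apply: z2eD hx; have [c cz ->] := vphi_mulE f g (ltnW (ltn_ord i)).
apply: z2eMr cz; rewrite (mulrC (2 ^+ vphi l i * f i)); apply: z2eMr (fb i).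
by have := gS (n - i)%N; rewrite subn_gt0 => ->.
Qed.

Lemma strictM f g : strict f -> strict g -> strict (f * g).
Proof.
move=> fs gs; split; first by rewrite fpsM0 fs.1 gs.1 mulr1.
move=> n n0; rewrite -[_ * _](subrK (2 ^+ vphi l n * f n)).
by apply: z2eD; [apply: bounded_strict gs; apply: strict_bounded | apply: fs.2].
Qed.

Lemma strict1 : strict 1.
Proof. by split=> // -[//|n] _; rewrite fps1 mulr0 /z2e mul0r rpred0. Qed.

Lemma strict_prod I (r : seq I) (P : pred I) (F : I -> fps rat) :
  (forall i, P i -> strict (F i)) -> strict (\prod_(i <- r | P i) F i).
Proof. by apply: big_ind; [exact: strict1 | exact: strictM]. Qed.

End Bounded.

Definition exp_mono1 (c : rat) : fps rat := Fps (fun n => c ^+ n / n`!%:R).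

Lemma isexp_exp_mono1 c : isexp (fmono c 1) (exp_mono1 c).
Proof.
have E n : exp_mono1 c n = c ^+ n / n`!%:R by [].
split; first by []; first by rewrite E expr0 divr1.
apply: fpsP => n; rewrite thetaE E (_ : theta _ = fmono c 1); last first.
  by apply: fpsP => k; rewrite thetaE fmonoE; case: eqP => [->|]; rewrite ?mulr1n ?mul0rn.
rewrite fmonoMl; case: n => [|n]; first by rewrite mulr0n.
rewrite subSS subn0 E factS (natrM _ n.+1) exprS -[LHS]mulr_natr /=.
have n1 : n.+1%:R != 0 :> rat by rewrite pnatr_eq0.
have f0 : n`!%:R != 0 :> rat by rewrite pnatr_eq0 -lt0n fact_gt0.
by move: (n.+1%:R) (n`!%:R) n1 f0 => x y x0 y0; field; rewrite x0 y0.
Qed.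

Definition exp_mono (c : rat) (N : nat) : fps rat := fsub N (exp_mono1 c).

Lemma isexp_exp_mono c N : (0 < N)%N -> isexp (fmono c N) (exp_mono c N).
Proof.
by move=> N0; have := isexp_fsub N0 (isexp_exp_mono1 c); rewrite fsub_mono // mul1n.
Qed.

Lemma pow2_div_fact k i : (0 < i)%N -> (i <= k)%N -> z2e (2 ^+ k / i`!%:R).
Proof.
move=> i0 lek; have [m om em] := fact_2part i; have L := logn2_fact_lt i0.
rewrite em natrM natrX /z2e invfM mulrA mulrAC.
have -> : 2 ^+ k = 2 ^+ (k - (logn 2 i`!).+1) * (2 * 2 ^+ logn 2 i`!) :> rat.
  by rewrite -exprS -exprD subnK //; lia.
have t0 : 2 ^+ logn 2 i`! != 0 :> rat by rewrite expf_neq0.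
rewrite mulrA mulfK // mulrK ?unitfE //.
by rewrite rpredM ?z2_invodd // rpredX ?(z2_nat 2).
Qed.

Lemma exp_mono_coef c N n : (0 < N)%N -> (0 < n)%N ->
  exp_mono c N n = 0 \/ exists i, [/\ (0 < i)%N, n = (N * i)%N & exp_mono c N n = c ^+ i / i`!%:R].
Proof.
move=> N0 n0; rewrite /exp_mono fsubE; case: ifP => [/dvdnP[i en]|_]; last by left.
right; exists i; rewrite en mulnK // mulnC; split=> //.
by move: n0; rewrite en muln_gt0 => /andP[].
Qed.

Lemma exp_mono0 c N : exp_mono c N 0%N = 1.
Proof. by rewrite /exp_mono fsubE dvdn0 div0n; case: (isexp_exp_mono1 c). Qed.

Lemma z2e0 : z2e 0. Proof. by rewrite /z2e mul0r rpred0. Qed.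

(** The term [c ^ i / i!] loses at most [k * i] factors 2 from [c] and fewer than [i] from [i!]; the
    extra [i] in the hypothesis gives strictness. *)
Lemma exp_mono_strict l (c : rat) N k : (0 < N)%N ->
    2 ^+ k * c \in z2 ->
    (forall i, (0 < i)%N -> (k * i + i <= vphi l (N * i))%N) ->
  strict l (exp_mono c N).
Proof.
move=> N0 cz hk; split; first exact: exp_mono0.
move=> n n0; have [->|[i [i0 -> ->]]] := exp_mono_coef c N0 n0.
  by rewrite mulr0; apply: z2e0.
have le := hk i i0; move: (vphi l (N * i)) le => v le.
rewrite (_ : _ * _ = (2 ^+ (v - k * i)%N / i`!%:R) * (2 ^+ k * c) ^+ i).
  by apply: z2eMr; [apply: pow2_div_fact => //; lia | rewrite rpredX].
have -> : 2 ^+ v = 2 ^+ (v - k * i)%N * 2 ^+ k ^+ i :> rat.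
  by rewrite -exprM -exprD subnK //; lia.
by rewrite exprMn; ring.
Qed.

Lemma exp_mono_strict_half l (c : rat) N : (0 < N)%N -> z2e c -> strict l (exp_mono c N).
Proof.
move=> N0 cz; split; first exact: exp_mono0.
move=> n n0; have [->|[i [i0 -> ->]]] := exp_mono_coef c N0 n0.
  by rewrite mulr0; apply: z2e0.
rewrite (mulrC (2 ^+ _)); apply: z2eMr; last by rewrite rpredX ?(z2_nat 2).
have -> : c ^+ i = (c / 2) ^+ i * 2 ^+ i by rewrite -exprMn divfK.
rewrite -mulrA mulrC; apply: z2eMr; [exact: pow2_div_fact | by rewrite rpredX].
Qed.

Lemma fps_sum_mono (A : fps rat) (P : pred nat) n i : (i < n)%N ->
  (\sum_(0 <= N < n | P N) fmono (A N) N) i = if P i then A i else 0.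
Proof.
move=> ltin; rewrite fps_sum; case: ifP => Pi.
  rewrite big_mkcond (bigD1_seq i) ?mem_index_iota ?iota_uniq //= Pi fmonoE eqxx.
  rewrite big1 ?addr0 // => j ne; case: ifP => // _.
  by rewrite fmonoE eq_sym (negPf ne).
by rewrite big1 // => j Pj; rewrite fmonoE; case: eqP Pj Pi => // -> ->.
Qed.

(** The excluded pairs [m = 1], [e < 2] are the two leading monomials, where the inequality fails at
    [i = 1]. For [m = 1] and [e = 2] it holds with nothing to spare but the valuation of [i!]. *)
Lemma vphi_large l e m i : (odd m) -> (0 < i)%N ->
    ~~ ((m == 1%N) && (e < 2)%N) ->
  ((2 * e + 1) * i + i <= vphi l (2 ^ (l + e) * m * i))%N.
Proof.
move=> om i0 em; rewrite expnD -!mulnA vphiMl.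
have m0 : (0 < m)%N by case: m om {em}.
rewrite /vphi expn0 divn1 -[(2 ^ 2)%N]/4%N.
have m3 : (e < 2)%N -> (3 * i <= m * i)%N.
  by move=> e2; rewrite leq_mul2r; apply/orP; right; case: m om em m0 => [|[|[|m]]] //; rewrite e2.
case: e em m3 => [|[|e]] em m3.
- by move: (m3 isT); rewrite expn0 mul1n; move: (m * i)%N (logn _ _) => X Y; lia.
- by move: (m3 isT); rewrite expn1; move: (m * i)%N (logn _ _) => X Y; lia.
have -> : (2 ^ e.+2 * (m * i) %/ 4 = 2 ^ e * (m * i))%N.
  by rewrite -(addn2 e) expnD mulnAC -[(2 ^ 2)%N]/4%N mulnK.
have : (e.+1 <= 2 ^ e)%N by apply: ltn_expl.
rewrite -(addn2 e) expnD -[(2 ^ 2)%N]/4%N; move: (2 ^ e)%N => E leE.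
have : (e.+1 * i <= E * (m * i))%N by rewrite leq_mul // leq_pmull.
move: (E * (m * i))%N (E * 4 * (m * i))%N (mulnAC E 4 (m * i))%N => X Y hY; nia.
Qed.

Section ExpValuation.
Variables (l : nat) (A H : fps rat).
Hypothesis AH : isexp A H.
Hypothesis small : forall N, ~~ (2 ^ l %| N)%N -> z2e (A N).
Hypothesis large : forall e m, odd m -> 2 ^+ (2 * e + 1) * A (2 ^ (l + e) * m)%N \in z2.
Hypothesis lead0 : z2o (2 * A (2 ^ l)%N).
Hypothesis lead1 : z2o (8 * A (2 ^ l.+1)%N).

Theorem exp_valuation n : let v := 2 ^+ vphi l n * H n in
  v \in z2 /\ ((2 ^ l.+2 %| n)%N -> z2o v).
Proof.
move=> v; have L0 k : (0 < 2 ^ k)%N by rewrite expn_gt0.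
pose u := 2 * A (2 ^ l)%N; pose w := 8 * A (2 ^ l.+1)%N.
pose U := fsub (2 ^ l) (twoterm_exp u w).
pose P N := [&& (0 < N)%N, N != (2 ^ l)%N & N != (2 ^ l.+1)%N].
(* Monomials above degree [n] cannot reach coefficient [n], so a finite product of exponentials
   suffices. *)
pose W := \prod_(0 <= N < n.+1 | P N) exp_mono (A N) N.
have eU : isexp (fmono (A (2 ^ l)%N) (2 ^ l) + fmono (A (2 ^ l.+1)%N) (2 ^ l.+1)) U.
  have := isexp_fsub (L0 l) (isexp_twoterm_exp u w).
  rewrite fsubD !fsub_mono // mul1n -expnS /u /w.
  by rewrite mulrC mulKf // mulrC mulKf.
have eW : isexp (\sum_(0 <= N < n.+1 | P N) fmono (A N) N) W.
  by apply: isexp_prod => N /and3P[N0 _ _]; apply: isexp_exp_mono.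
have HE : H n = (U * W) n.
  apply: (isexp_eq rat_unitS AH (isexpM eU eW)) => i lein.
  rewrite !fpsD fps_sum_mono ?ltnS // !fmonoE /P.
  have ne : (2 ^ l)%N != (2 ^ l.+1)%N by rewrite eqn_exp2l // ltn_eqF.
  case: eqVneq => [->|ni].
    by rewrite (negPf ne) andbF !addr0.
  case: eqVneq => [->|ni']; first by rewrite andbF add0r addr0.
  case: posnP => [->|_] /=; rewrite !add0r //.
  by case: AH.
have sW : strict l W.
  apply: strict_prod => N /and3P[N0 n1 n2].
  have [d|nd] := boolP (2 ^ l %| N)%N; last exact: exp_mono_strict_half (small nd).
  have [N' N'0 eN] : exists2 N', (0 < N')%N & N = (2 ^ l * N')%N.
    case/dvdnP: d N0 => N' ->; rewrite muln_gt0 => /andP[N'0 _].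
    by exists N' => //; rewrite mulnC.
  have [m om eN'] : exists2 m, odd m & N' = (2 ^ logn 2 N' * m)%N.
    exists (N'`_2^')%N; first by rewrite odd_2'nat part_pnat.
    by rewrite -p_part partnC.
  set e := logn 2 N' in eN'; rewrite eN' mulnA -expnD in eN.
  rewrite eN; apply: exp_mono_strict (large e om) _; first by rewrite -eN.
  move=> i i0; apply: vphi_large => //; apply: contra n1.
  move=> /andP[/eqP m1 e2]; rewrite eN m1 muln1 in n2 *.
  by case: e e2 n2 {eN' eN} => [|[|//]]; rewrite ?addn0 ?addn1 ?eqxx.
have vU k : exists2 x, x \in z2 & 2 ^+ vphi l k * U k = x /\ ((2 ^ l.+2 %| k)%N -> z2o x).
  rewrite /U fsubE; case: ifP => [/dvdnP[N ->]|nd]; last first.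
    exists 0; rewrite ?rpred0 // mulr0; split=> // d; move: nd.
    by rewrite (dvdn_trans _ d) // -(addn2 l) expnD dvdn_mulr.
  rewrite mulnK // [(N * _)%N]mulnC vphiMl.
  have [x xz [ex xo]] := twoterm_exp_val lead0 lead1 N; exists x => //; split=> // d.
  by apply: xo; move: d; rewrite -(addn2 l) expnD dvdn_pmul2l.
have bU : bounded l U by move=> k; have [x xz [-> _]] := vU k.
have hd := bounded_strict n bU sW.
have [x xz [ex xo]] := vU n; rewrite ex in hd.
have -> : v = (v - x) + x by rewrite subrK.
rewrite /v HE; split; first by rewrite rpredD // z2e_z2.
by move=> d; apply: z2eoD hd (xo d).
Qed.

End ExpValuation.

(** * Counting commuting tuples of matrices *)

(** Scalars [a i] other than 1 are needed for the induction in [isexp_Hser], which extracts square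
    roots of one of them at a time. *)
Definition ctuples (F : finFieldType) (n m : nat) (a : 'I_m -> F)
    (j : 'I_m -> nat) : {set {ffun 'I_m -> 'M[F]_n}} :=
  [set A : {ffun 'I_m -> 'M[F]_n} |
    [forall i, forall k, A i *m A k == A k *m A i] &&
    [forall i, A i ^+ (2 ^ j i) == (a i)%:M]].

Definition units (F : finFieldType) (n : nat) : {set 'M[F]_n} :=
  [set P | P \in unitmx].

Lemma ctuplesP (F : finFieldType) n m (a : 'I_m -> F) j
    (A : {ffun 'I_m -> 'M[F]_n}) :
  reflect ((forall i k, A i *m A k = A k *m A i) /\
           (forall i, A i ^+ (2 ^ j i) = (a i)%:M))
    (A \in ctuples n a j).
Proof.
rewrite inE; apply: (iffP andP) => [[/forallP h1 /forallP h2]|[h1 h2]]; split.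
- by move=> i k; apply/eqP; apply: (forallP (h1 i)).
- by move=> i; apply/eqP.
- by apply/forallP => i; apply/forallP => k; rewrite h1.
- by apply/forallP => i; rewrite h2.
Qed.

Section ConjCount.
Variables (F : finFieldType) (n m : nat) (a : 'I_m -> F) (j : 'I_m -> nat).
Variables (i0 : 'I_m) (e : nat) (J : 'M[F]_n).
Implicit Types A : {ffun 'I_m -> 'M[F]_n}.
Local Notation T := (ctuples n a j).

Definition conjt (P : 'M[F]_n) A : {ffun 'I_m -> 'M[F]_n} :=
  [ffun i => invmx P *m A i *m P].

Lemma conj_expr (P X : 'M[F]_n) k : P \in unitmx ->
  (invmx P *m X *m P) ^+ k = invmx P *m X ^+ k *m P.
Proof.
move=> uP; elim: k => [|k IH]; first by rewrite !expr0 mulmx1 mulVmx.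
rewrite !exprS IH -[_ * _]/(_ *m _) -[X * _]/(X *m _) !mulmxA.
by rewrite -(mulmxA _ P (invmx P)) mulmxV // mulmx1.
Qed.

Lemma conjt_ctuples P A : P \in unitmx -> A \in T -> conjt P A \in T.
Proof.
move=> uP /ctuplesP[h1 h2]; apply/ctuplesP; split=> [i k|i]; rewrite !ffunE.
  have E X Y : invmx P *m X *m P *m (invmx P *m Y *m P) = invmx P *m (X *m Y) *m P.
    by rewrite !mulmxA -(mulmxA _ P (invmx P)) mulmxV // mulmx1.
  by rewrite !E h1.
by rewrite conj_expr // h2 mul_mx_scalar -scalemxAl mulVmx // scalemx1.
Qed.

Lemma conjtK P : P \in unitmx -> cancel (conjt P) (conjt (invmx P)).
Proof.
move=> uP A; apply/ffunP => i; rewrite !ffunE invmxK !mulmxA mulmxV // mul1mx.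
by rewrite -mulmxA mulmxV // mulmx1.
Qed.

Definition pw A := A i0 ^+ e.

(** Double counting of the pairs [(A, P)] where [P] conjugates [pw A] to [J]: for fixed [A] such [P]
    form a coset of the centralizer of [J], and for fixed [P] conjugation is a bijection onto the
    tuples with [pw A = J]. *)
Lemma conj_count :
  (#|[set A in T | [exists P, (P \in units F n) && (P *m pw A == J *m P)]]| *
   #|[set P in units F n | P *m J == J *m P]|)%N =
  (#|units F n| * #|[set A in T | pw A == J]|)%N.
Proof.
transitivity (\sum_(A in T) \sum_(P in units F n | P *m pw A == J *m P) 1)%N.
  rewrite -sum_nat_const [RHS](bigID (fun A => [exists P, (P \in units F n) && (P *m pw A == J *m P)])) /=.
  rewrite [X in (_ + X)%N]big1 ?addn0 => [|A /andP[_]]; last first.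
    rewrite negb_exists => /forallP h; rewrite big_pred0 // => P.
    by apply: negbTE; apply: h.
  rewrite big_mkcond [RHS]big_mkcond; apply: eq_bigr => A _; rewrite inE.
  case: ifP => // /andP[AT /existsP[P0 /andP[]]]; rewrite inE => uP0 /eqP eP0.
  rewrite sum1_card -(card_imset _ (_ : injective (mulmx^~ P0))); last first.
    by move=> X Y /(congr1 (mulmx^~ (invmx P0))); rewrite /= !mulmxK.
  apply: eq_card => P; rewrite [RHS]inE /=; apply/imsetP/andP => [[Q]|[]].
    rewrite !inE => /andP[uQ /eqP cQ] ->; rewrite unitmx_mul uQ uP0; split=> //.
    by rewrite -mulmxA eP0 !mulmxA cQ.
  rewrite inE => uP /eqP eP; exists (P *m invmx P0); last by rewrite mulmxKV.
  rewrite !inE unitmx_mul uP unitmx_inv uP0 /= mulmxA -eP -!mulmxA; apply/eqP.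
  by congr (P *m _); rewrite -[J](mulmxK uP0) -eP0 -(mulmxA P0) mulKmx.
rewrite (exchange_big_dep (mem (units F n))) /=; last by move=> A P _ /andP[].
rewrite -sum_nat_const; apply: eq_bigr => P; rewrite inE => uP.
rewrite sum1dep_card -[RHS](card_imset _ (can_inj (conjtK uP))).
apply: eq_card => A; rewrite inE uP /=; apply/andP/imsetP => [[AT /eqP eA]|[B]].
  exists (conjt (invmx P) A); last first.
    by rewrite -{1}(invmxK P) conjtK // unitmx_inv.
  rewrite inE conjt_ctuples ?unitmx_inv //= /pw ffunE conj_expr ?unitmx_inv //.
  by rewrite invmxK -/(pw A) eA mulmxK.
rewrite inE => /andP[BT /eqP eB] ->; split; first exact: conjt_ctuples.
by rewrite /pw ffunE conj_expr // -/(pw B) eB !mulmxA mulmxV // mul1mx.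
Qed.

End ConjCount.

Lemma card_units (F : finFieldType) n : #|units F n| = glcard n #|F|.
Proof.
case: n => [|n].
  rewrite glcard0 (_ : units F 0 = [set 1%:M]) ?cards1 //.
  apply/setP => P; have -> : P = 1%:M by rewrite [P]flatmx0 [RHS]flatmx0.
  by rewrite !inE unitmx1 eqxx.
rewrite /glcard -(card_GL F (ltn0Sn n)) cardsT /= card_sub.
by apply: eq_card => A; rewrite inE.
Qed.

Lemma row_base_rank (F : fieldType) s n (X : 'M[F]_(s, n)) k : \rank X = k ->
  exists2 U : 'M[F]_(k, n), row_free U & (U :=: X)%MS.
Proof. by move=> <-; exists (row_base X); [apply: row_base_free | apply: eq_row_base]. Qed.

(** * Tuples with a square scalar: splitting into eigenspaces *)

Section Split.
Variables (F : finFieldType) (p q m : nat) (a : 'I_m -> F) (j : 'I_m -> nat).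
Variables (i0 : 'I_m) (J0 : nat) (b : F).
Hypotheses (ji0 : j i0 = J0.+1) (ai0 : a i0 = b ^+ 2) (b2 : b *+ 2 != 0).

Local Notation T := (ctuples (p + q) a j).
Local Notation pw := (pw i0 (2 ^ J0)).

Let J : 'M[F]_(p + q) := block_mx b%:M 0 0 (- b)%:M.
Let a1 := [eta a with i0 |-> b].
Let a2 := [eta a with i0 |-> - b].
Let j' := [eta j with i0 |-> J0].

Lemma comm_signJ (X : 'M[F]_(p + q)) : X *m J = J *m X ->
  X = block_mx (ulsubmx X) 0 0 (drsubmx X).
Proof.
rewrite -[X]submxK /J !mulmx_block !mul0mx !mulmx0 !addr0 !add0r.
rewrite !mul_mx_scalar !mul_scalar_mx => /eq_block_mx[_ e1 e2 _].
have h (s t : nat) (Y : 'M[F]_(s, t)) : - b *: Y = b *: Y -> Y = 0.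
  move/eqP; rewrite eq_sym -subr_eq0 scaleNr opprK -scalerDl -mulr2n scaler_eq0.
  by rewrite (negPf b2) => /eqP.
by rewrite block_mxKul block_mxKdr (h _ _ _ e1) (h _ _ _ (esym e2)).
Qed.

Lemma signJ_comm (X : 'M[F]_p) (Y : 'M[F]_q) :
  block_mx X 0 0 Y *m J = J *m block_mx X 0 0 Y.
Proof.
rewrite /J !mulmx_block !mul0mx !mulmx0 !addr0 !add0r.
by rewrite !mul_mx_scalar !mul_scalar_mx.
Qed.

Lemma block_diagM (X X' : 'M[F]_p) (Y Y' : 'M[F]_q) :
  block_mx X 0 0 Y *m block_mx X' 0 0 Y' = block_mx (X *m X') 0 0 (Y *m Y').
Proof. by rewrite mulmx_block !mul0mx !mulmx0 !addr0 !add0r. Qed.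

Lemma block_diagX (X : 'M[F]_p) (Y : 'M[F]_q) k :
  (block_mx X 0 0 Y) ^+ k = block_mx (X ^+ k) 0 0 (Y ^+ k).
Proof.
elim: k => [|k IH]; first by rewrite !expr0 -[LHS]/(1%:M) -scalar_mx_block.
by rewrite !exprS IH -[_ * _]/(_ *m _) block_diagM.
Qed.

Lemma card_signJ_centralizer :
  #|[set P in units F (p + q) | P *m J == J *m P]| = (#|units F p| * #|units F q|)%N.
Proof.
rewrite -cardsX -(card_in_imset (f := fun x : 'M_p * 'M_q => block_mx x.1 0 0 x.2)).
  apply: eq_card => P; rewrite !inE; apply/andP/imsetP => [[uP /eqP cP]|[[X Y]]].
    have e := comm_signJ cP; exists (ulsubmx P, drsubmx P) => //=.
    move: uP; rewrite {1}e !inE !unitmxE det_ublock unitrM => /andP[-> ->] //.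
  rewrite !inE /= => /andP[uX uY] ->; rewrite signJ_comm eqxx; split=> //.
  by rewrite unitmxE det_ublock unitrM -!unitmxE uX.
by move=> [X Y] [X' Y'] _ _ /= /eq_block_mx[-> _ _ ->].
Qed.

Lemma ctuples_pwP (A : {ffun 'I_m -> 'M[F]_(p + q)}) :
  reflect [/\ (forall i k, A i *m A k = A k *m A i),
              (forall i, i != i0 -> A i ^+ (2 ^ j i) = (a i)%:M)
            & A i0 ^+ (2 ^ J0) = J]
    (A \in [set A in T | pw A == J]).
Proof.
rewrite inE; apply: (iffP andP) => [[/ctuplesP[h1 h2] /eqP h3]|[h1 h2 h3]]; split=> //.
  apply/ctuplesP; split=> // i; have [->|/h2 //] := eqVneq i i0.
  rewrite ji0 expnSr exprM h3 expr2 -[_ * _]/(_ *m _) /J block_diagM.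
  by rewrite -!scalar_mxM mulrNN -expr2 -ai0 -scalar_mx_block.
by rewrite /pw h3.
Qed.

Lemma ctuples_etaP n c (A : {ffun 'I_m -> 'M[F]_n}) :
  reflect [/\ (forall i k, A i *m A k = A k *m A i),
              (forall i, i != i0 -> A i ^+ (2 ^ j i) = (a i)%:M)
            & A i0 ^+ (2 ^ J0) = c%:M]
    (A \in ctuples n [eta a with i0 |-> c] j').
Proof.
apply: (iffP (ctuplesP _ _ _)) => [[h1 h2]|[h1 h2 h3]].
  split; [exact: h1 | move=> i ni; by have := h2 i; rewrite /= (negPf ni) |].
  by have := h2 i0; rewrite /= eqxx.
by split=> // i; rewrite /=; case: eqVneq => [->|/h2].
Qed.

Lemma card_ctuples_signJ :
  #|[set A in T | pw A == J]| = (#|ctuples p a1 j'| * #|ctuples q a2 j'|)%N.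
Proof.
pose f (x : {ffun 'I_m -> 'M[F]_p} * {ffun 'I_m -> 'M[F]_q}) :
  {ffun 'I_m -> 'M[F]_(p + q)} := [ffun i => block_mx (x.1 i) 0 0 (x.2 i)].
have finj : injective f.
  move=> [X Y] [X' Y'] /ffunP e; congr (_, _); apply/ffunP => i;
  by have := e i; rewrite !ffunE /= => /eq_block_mx[].
rewrite -cardsX -(card_imset _ finj); apply: eq_card => A.
apply/ctuples_pwP/imsetP => [[h1 h2 h3]|[[X Y]]].
  have d i : A i = block_mx (ulsubmx (A i)) 0 0 (drsubmx (A i)).
    apply: comm_signJ; rewrite -h3.
    have : GRing.comm (A i) (A i0) by apply: h1.
    by move/(commrX (2 ^ J0)).
  exists ([ffun i => ulsubmx (A i)], [ffun i => drsubmx (A i)]); last first.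
    by apply/ffunP => i; rewrite /f !ffunE; exact: d.
  rewrite inE /=; apply/andP; split; apply/ctuples_etaP; split=> [i k|i ni|];
    rewrite !ffunE.
  - by have e := h1 i k; rewrite (d i) (d k) !block_diagM in e; case/eq_block_mx: e.
  - by have e := h2 i ni; rewrite (d i) block_diagX (scalar_mx_block p q) in e; case/eq_block_mx: e.
  - by have e := h3; rewrite (d i0) block_diagX in e; case/eq_block_mx: e.
  - by have e := h1 i k; rewrite (d i) (d k) !block_diagM in e; case/eq_block_mx: e.
  - by have e := h2 i ni; rewrite (d i) block_diagX (scalar_mx_block p q) in e; case/eq_block_mx: e.
  - by have e := h3; rewrite (d i0) block_diagX in e; case/eq_block_mx: e.
rewrite inE /= => /andP[/ctuples_etaP[x1 x2 x3] /ctuples_etaP[y1 y2 y3]] ->.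
split=> [i k|i ni|]; rewrite /f !ffunE /=.
- by rewrite !block_diagM x1 y1.
- by rewrite block_diagX x2 // y2 // -scalar_mx_block.
- by rewrite block_diagX x3 y3.
Qed.

(** For [X = B + b] and [Y = B - b], [X * Y = 0] and [X - Y = 2 b] is invertible. So the row spaces
    of [X] and [Y] are complementary, [B] acts on them as [b] and [- b], and the rank of [X] is the
    only invariant. *)
Lemma signJ_conj (B : 'M[F]_(p + q)) : B *m B = (b ^+ 2)%:M ->
  reflect (exists2 P, P \in unitmx & P *m B = J *m P) (\rank (B + b%:M)%R == p).
Proof.
move=> BB; apply: (iffP eqP) => [rk|[P uP eP]]; last first.
  have -> : B + b%:M = invmx P *m (J + b%:M) *m P.
    rewrite mulmxDr mulmxDl -(mulmxA _ J) -eP mulKmx //; congr (_ + _).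
    by rewrite mul_mx_scalar -scalemxAl mulVmx // scalemx1.
  rewrite mxrankMfree ?row_free_unit // eqmxMfull ?row_full_unit ?unitmx_inv //.
  rewrite (scalar_mx_block p q) /J add_block_mx !addr0 -!raddfD /= addNr.
  rewrite raddf0 rank_diag_block_mx mxrank0 addn0 -mulr2n.
  by rewrite -scalemx1 mxrank_scale_nz // mxrank1.
set X := B + b%:M in rk *; pose Y := B - b%:M.
have XY : X *m Y = 0.
  rewrite /X /Y mulmxBr !mulmxDl BB mul_scalar_mx !mul_mx_scalar.
  by rewrite scale_scalar_mx -expr2 (addrC (b *: B)) subrr.
have YX : Y *m X = 0.
  rewrite /X /Y mulmxDr !mulmxBl BB mul_scalar_mx !mul_mx_scalar.
  by rewrite scale_scalar_mx -expr2 addrA subrK subrr.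
have XmY : X - Y = (b *+ 2)%:M.
  by rewrite /X /Y opprB addrC addrA subrK -raddfD.
have full : row_full (X + Y)%MS.
  rewrite -sub1mx -[1%:M](scalerK b2) scalemx1 -XmY scalemx_sub // addmx_sub ?addsmxSl //.
  by rewrite eqmx_opp addsmxSr.
have rkXY : (\rank (X + Y)%MS = p + q)%N by apply/eqP.
have rkY : \rank Y = q.
  have := mulmx0_rank_max XY; have := (mxrank_adds_leqif X Y).1.
  by rewrite rk rkXY; lia.
have [U1 f1 e1] := row_base_rank rk; have [U2 f2 e2] := row_base_rank rkY.
exists (col_mx U1 U2).
  rewrite -row_full_unit -sub1mx.
  apply: (submx_trans (_ : (1%:M <= X + Y)%MS)); first by rewrite sub1mx.
  by rewrite -addsmxE; apply: addsmxS; rewrite ?e1 ?e2.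
have a1E : U1 *m B = b%:M *m U1.
  have /submxP[D ->] : (U1 <= X)%MS by rewrite e1.
  have : X *m (B - b%:M) = 0 by [].
  by rewrite mulmxBr => /eqP; rewrite subr_eq0 => /eqP eX; rewrite -mulmxA eX mul_mx_scalar mul_scalar_mx -scalemxAr.
have a2E : U2 *m B = (- b)%:M *m U2.
  have /submxP[D ->] : (U2 <= Y)%MS by rewrite e2.
  have : Y *m (B + b%:M) = 0 by [].
  rewrite mulmxDr => /eqP; rewrite addr_eq0 => /eqP eY.
  by rewrite -mulmxA eY mul_mx_scalar mul_scalar_mx mulmxN -scalemxAr scaleNr.
by rewrite /J mul_col_mx a1E a2E mul_block_col !mul0mx addr0 add0r.
Qed.

Lemma split_count_block :
  (#|[set A in T | \rank (pw A + b%:M)%R == p]| * (#|units F p| * #|units F q|))%N =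
  (#|units F (p + q)| * (#|ctuples p a1 j'| * #|ctuples q a2 j'|))%N.
Proof.
rewrite -card_signJ_centralizer -card_ctuples_signJ -conj_count; congr (_ * _)%N.
apply: eq_card => A; rewrite [LHS]inE [RHS]inE; apply: andb_id2l => /ctuplesP[_ h2].
have BB : pw A *m pw A = (b ^+ 2)%:M.
  by rewrite -ai0 -h2 ji0 expnSr exprM expr2.
apply/(signJ_conj BB)/existsP => [[P uP eP]|[P /andP[]]].
  by exists P; rewrite inE uP eP eqxx.
by rewrite inE => uP /eqP eP; exists P.
Qed.

End Split.

(** Tuples are sorted by the dimension [k] of an eigenspace; dividing by the group orders turns the
    counts of [split_count_block] into a Cauchy product. *)
Lemma split_count (F : finFieldType) (m : nat) (a : 'I_m -> F)
    (j : 'I_m -> nat) (i0 : 'I_m) (J0 : nat) (b : F) (n : nat) :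
    j i0 = J0.+1 -> a i0 = b ^+ 2 -> b *+ 2 != 0 ->
  let j' := [eta j with i0 |-> J0] in
  #|ctuples n a j|%:R / (glcard n #|F|)%:R =
  \sum_(k < n.+1)
    (#|ctuples k [eta a with i0 |-> b] j'|%:R / (glcard k #|F|)%:R) *
    (#|ctuples (n - k) [eta a with i0 |-> - b] j'|%:R / (glcard (n - k) #|F|)%:R)
  :> rat.
Proof.
move=> ji0 ai0 b2 j'.
have gl0 k : (glcard k #|F|)%:R != 0 :> rat.
  rewrite pnatr_eq0 -lt0n -card_units card_gt0; apply/set0Pn; exists 1%:M.
  by rewrite inE unitmx1.
apply: (canLR (mulfK (gl0 n))).
pose R (A : {ffun 'I_m -> 'M[F]_n}) := \rank (pw i0 (2 ^ J0) A + b%:M)%R.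
have -> : #|ctuples n a j| = (\sum_(k < n.+1) #|[set A in ctuples n a j | R A == k]|)%N.
  rewrite -sum1_card (partition_big (fun A => inord (R A) : 'I_n.+1) xpredT) //=.
  apply: eq_bigr => k _; rewrite sum1dep_card; apply: eq_card => A; rewrite [RHS]inE [LHS]inE.
  by congr (_ && _); rewrite -val_eqE /= inordK // ltnS rank_leq_row.
rewrite natr_sum mulr_suml; apply: eq_bigr => k _.
have lekn : (k <= n)%N by rewrite -ltnS.
have := @split_count_block F k (n - k) m a j i0 J0 b ji0 ai0 b2.
rewrite subnKC // !card_units -/j' => /(congr1 (fun x => x%:R : rat)).
set c0 := #|_|; set c1 := #|_|; set c2 := #|_| => e.
have {}e : c0%:R * ((glcard k #|F|)%:R * (glcard (n - k) #|F|)%:R) =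
    (glcard n #|F|)%:R * (c1%:R * c2%:R) :> rat by rewrite -!natrM e.
apply: (mulIf (mulf_neq0 (gl0 k) (gl0 (n - k)%N))); rewrite [LHS]e.
move: (gl0 k) (gl0 (n - k)%N); move: (glcard k #|F|)%:R (glcard (n - k) #|F|)%:R.
by move=> x y x0 y0; field; rewrite x0 y0.
Qed.

(** * Tuples with a nonsquare scalar: restriction from a quadratic extension *)

Section QuadExt.
Variables (F : finFieldType) (c : F).

(** The pair [(x, y)] stands for [x + y sqrt c]. The proof that [c] is not a square is an argument
    of the type because the field structure depends on it. *)
Definition qext of (forall x : F, x ^+ 2 != c) : Type := (F * F)%type.

Variable nsq : forall x : F, x ^+ 2 != c.
Local Notation K := (qext nsq).

HB.instance Definition _ := Finite.copy K (F * F)%type.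
HB.instance Definition _ := GRing.Zmodule.copy K (F * F)%type.

Definition qmul (x y : K) : K :=
  (x.1 * y.1 + c * x.2 * y.2, x.1 * y.2 + x.2 * y.1).
Definition qone : K := (1, 0).
Definition qinv (x : K) : K :=
  (x.1 / (x.1 ^+ 2 - c * x.2 ^+ 2), - x.2 / (x.1 ^+ 2 - c * x.2 ^+ 2)).

Fact qmulA : associative qmul.
Proof. by move=> [x1 x2] [y1 y2] [z1 z2]; congr (_, _) => /=; ring. Qed.
Fact qmulC : commutative qmul.
Proof. by move=> [x1 x2] [y1 y2]; congr (_, _) => /=; ring. Qed.
Fact qmul1 : left_id qone qmul.
Proof. by move=> [x1 x2]; congr (_, _) => /=; ring. Qed.
Fact qmulDl : left_distributive qmul +%R.
Proof. by move=> [x1 x2] [y1 y2] [z1 z2]; congr (_, _) => /=; ring. Qed.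
Fact qone_neq0 : qone != 0.
Proof. by rewrite xpair_eqE oner_eq0. Qed.

HB.instance Definition _ := GRing.Zmodule_isComNzRing.Build K
  qmulA qmulC qmul1 qmulDl qone_neq0.

Lemma qnorm_neq0 (x : K) : x != 0 -> x.1 ^+ 2 - c * x.2 ^+ 2 != 0.
Proof.
case: x => x1 x2; rewrite xpair_eqE /= => nz.
have [x20|x20] := eqVneq x2 0.
  by rewrite x20 eqxx andbT in nz; rewrite x20 expr0n mulr0 subr0 expf_eq0.
apply: contra (nsq (x1 / x2)); rewrite subr_eq0 => /eqP e.
by rewrite expr_div_n e mulfK // expf_eq0.
Qed.

Fact qmulVf (x : K) : x != 0 -> qmul (qinv x) x = qone.
Proof.
by move=> /qnorm_neq0 n0; case: x n0 => x1 x2 /= n0; congr (_, _) => /=; field.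
Qed.
Fact qinv0 : qinv 0 = 0.
Proof. by rewrite /qinv /= !mul0r oppr0 mul0r. Qed.

HB.instance Definition _ := GRing.ComNzRing_isField.Build K qmulVf qinv0.

Definition qextF : finFieldType := K.

Lemma card_qext : #|qextF| = (#|F| ^ 2)%N.
Proof. by rewrite -mulnn -card_prod. Qed.

Definition qbase (x : F) : K := (x, 0).
Definition qgen : K := (0, 1).

Fact qbase_zmod : zmod_morphism qbase.
Proof. by move=> x y; congr (_, _) => /=; rewrite subr0. Qed.
Fact qbase_monoid : monoid_morphism qbase.
Proof. by split=> // x y; congr (_, _) => /=; ring. Qed.
HB.instance Definition _ := GRing.isZmodMorphism.Build F K qbase qbase_zmod.
HB.instance Definition _ := GRing.isMonoidMorphism.Build F K qbase qbase_monoid.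

Lemma qgen_sqr : qgen ^+ 2 = qbase c.
Proof. by rewrite expr2; congr (_, _) => /=; ring. Qed.

End QuadExt.

Section Restriction.
Variables (F : finFieldType) (c : F) (nsq : forall x : F, x ^+ 2 != c) (p : nat).
Local Notation K := (qextF nsq).

Definition mre (Z : 'M[K]_p) : 'M[F]_p := \matrix_(i, k) (Z i k).1.
Definition mim (Z : 'M[K]_p) : 'M[F]_p := \matrix_(i, k) (Z i k).2.
Definition mqx (X Y : 'M[F]_p) : 'M[K]_p := \matrix_(i, k) ((X i k, Y i k) : K).

(** Restriction of scalars in the basis [1, sqrt c], for row vectors. Its image is the centralizer
    of [J], the matrix of multiplication by [sqrt c]. *)
Definition restr (Z : 'M[K]_p) : 'M[F]_(p + p) :=
  block_mx (mre Z) (mim Z) (c *: mim Z) (mre Z).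

Lemma qsum1 (I : finType) (f : I -> K) : (\sum_i f i).1 = \sum_i (f i).1.
Proof. by apply: (big_morph (fun x : K => x.1)). Qed.
Lemma qsum2 (I : finType) (f : I -> K) : (\sum_i f i).2 = \sum_i (f i).2.
Proof. by apply: (big_morph (fun x : K => x.2)). Qed.

Lemma mreM Z Z' : mre (Z *m Z') = mre Z *m mre Z' + c *: (mim Z *m mim Z').
Proof.
apply/matrixP => i k; rewrite !mxE qsum1 mulr_sumr -big_split; apply: eq_bigr => t _.
by rewrite !mxE mulrA.
Qed.
Lemma mimM Z Z' : mim (Z *m Z') = mre Z *m mim Z' + mim Z *m mre Z'.
Proof.
apply/matrixP => i k; rewrite !mxE qsum2 -big_split; apply: eq_bigr => t _.
by rewrite !mxE.
Qed.

Lemma restrM Z Z' : restr (Z *m Z') = restr Z *m restr Z'.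
Proof.
rewrite /restr mulmx_block mreM mimM -!scalemxAr -!scalemxAl; congr block_mx.
  by rewrite scalerDr addrC.
by rewrite addrC.
Qed.

Lemma restr_scalar x : restr ((qbase nsq x)%:M) = x%:M.
Proof.
rewrite /restr (scalar_mx_block p p).
have -> : mre (qbase nsq x)%:M = x%:M by apply/matrixP => i k; rewrite !mxE; case: eqP.
have -> : mim (qbase nsq x)%:M = 0 by apply/matrixP => i k; rewrite !mxE; case: eqP.
by rewrite scaler0.
Qed.

Lemma restr1 : restr 1%:M = 1%:M.
Proof. by rewrite -(restr_scalar 1) rmorph1. Qed.

Lemma restrX Z k : restr (Z ^+ k) = restr Z ^+ k.
Proof.
elim: k => [|k IH]; first by rewrite !expr0; exact: restr1.
by rewrite !exprS -IH -[Z * _]/(Z *m _) restrM.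
Qed.

Lemma restr_inj : injective restr.
Proof.
move=> Z Z' /eq_block_mx[/matrixP e1 /matrixP e2 _ _]; apply/matrixP => i k.
have := e1 i k; have := e2 i k; rewrite !mxE.
by case: (Z i k) (Z' i k) => [x y] [x' y'] /= -> ->.
Qed.

Let J : 'M[F]_(p + p) := block_mx 0 1%:M c%:M 0.

Lemma restr_gen : restr ((qgen nsq)%:M) = J.
Proof.
rewrite /restr /J.
have -> : mre (qgen nsq)%:M = 0 by apply/matrixP => i k; rewrite !mxE; case: eqP.
have -> : mim (qgen nsq)%:M = 1%:M by apply/matrixP => i k; rewrite !mxE; case: eqP.
by rewrite scalemx1.
Qed.

Lemma comm_restr (X : 'M[F]_(p + p)) : X *m J = J *m X -> exists Z, X = restr Z.
Proof.
rewrite -[X]submxK /J !mulmx_block !mul0mx !mulmx0 !addr0 !add0r !mul1mx !mulmx1.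
rewrite mul_mx_scalar mul_scalar_mx => /eq_block_mx[e1 e2 _ _].
exists (mqx (ulsubmx X) (ursubmx X)); rewrite /restr.
have -> : mre (mqx (ulsubmx X) (ursubmx X)) = ulsubmx X by apply/matrixP => i k; rewrite !mxE.
have -> : mim (mqx (ulsubmx X) (ursubmx X)) = ursubmx X by apply/matrixP => i k; rewrite !mxE.
by rewrite -e2 e1.
Qed.

Lemma restr_comm Z : restr Z *m J = J *m restr Z.
Proof. by rewrite -restr_gen -!restrM scalar_mxC. Qed.

(** The inverse of [restr Z] commutes with [J] too, hence is itself of the form [restr Z']. *)
Lemma restr_unit Z : (restr Z \in unitmx) = (Z \in unitmx).
Proof.
apply/idP/idP => [u|u]; last first.
  have := restrM Z (invmx Z); rewrite mulmxV // restr1 => e.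
  by have [] := mulmx1_unit (esym e).
have [Z' e] : exists Z', invmx (restr Z) = restr Z'.
  apply: comm_restr; apply: (can_inj (mulKmx u)).
  by rewrite mulmxA mulmxV // mul1mx mulmxA restr_comm mulmxK.
have : restr (Z *m Z') = restr 1%:M by rewrite restrM -e mulmxV ?restr1.
by move/restr_inj/mulmx1_unit => [].
Qed.

Lemma card_restr_centralizer :
  #|[set P in units F (p + p) | P *m J == J *m P]| = #|units K p|.
Proof.
rewrite -(card_imset _ restr_inj); apply: eq_card => P; rewrite !inE.
apply/andP/imsetP => [[uP /eqP/comm_restr[Z eZ]]|[Z]].
  by exists Z => //; rewrite inE -restr_unit -eZ.
by rewrite inE -restr_unit => uZ ->; rewrite restr_comm.
Qed.

Variables (m : nat) (a : 'I_m -> F) (j : 'I_m -> nat) (i0 : 'I_m) (J0 : nat).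
Hypotheses (ji0 : j i0 = J0.+1) (ai0 : a i0 = c).

Local Notation T := (ctuples (p + p) a j).
Local Notation pw := (pw i0 (2 ^ J0)).
Let aK := [eta (fun i => qbase nsq (a i)) with i0 |-> (qgen nsq : K)].
Let j' := [eta j with i0 |-> J0].

Lemma J_sqr : J *m J = c%:M.
Proof.
rewrite /J mulmx_block !mul0mx !mulmx0 !addr0 !add0r mul1mx mulmx1.
by rewrite -scalar_mx_block.
Qed.

Lemma card_ctuples_restr :
  #|[set A in T | pw A == J]| = #|ctuples p aK j'|.
Proof.
pose f (Z : {ffun 'I_m -> 'M[K]_p}) : {ffun 'I_m -> 'M[F]_(p + p)} :=
  [ffun i => restr (Z i)].
have finj : injective f.
  move=> Z Z' /ffunP e; apply/ffunP => i.
  by have := e i; rewrite !ffunE => /restr_inj.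
rewrite -(card_imset _ finj); apply: eq_card => A; rewrite inE.
apply/andP/imsetP => [[/ctuplesP[h1 h2] /eqP h3]|[Z /ctuplesP[h1 h2] ->]].
  have d i : exists Z, A i == restr Z.
    have [Z ->] : exists Z, A i = restr Z; last by exists Z.
    apply: comm_restr; rewrite -h3.
    have : GRing.comm (A i) (A i0) by apply: h1.
    by move/(commrX (2 ^ J0)).
  have dE i : A i = restr (xchoose (d i)) by apply/eqP; apply: (xchooseP (d i)).
  exists [ffun i => xchoose (d i)]; last by apply/ffunP => i; rewrite !ffunE.
  apply/ctuplesP; split=> [i k|i]; rewrite !ffunE.
    by apply: restr_inj; rewrite !restrM -!dE.
  apply: restr_inj; rewrite restrX -dE /=.
  case: eqVneq => [->|_]; last by rewrite h2 restr_scalar.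
  by rewrite [LHS]h3 restr_gen.
have e0 : restr (Z i0) ^+ (2 ^ J0) = J.
  by have := h2 i0; rewrite /= eqxx -restrX => ->; rewrite restr_gen.
split; last by rewrite /pw ffunE e0.
apply/ctuplesP; split=> [i k|i]; rewrite !ffunE; first by rewrite -!restrM h1.
have [->|ni] := eqVneq i i0.
  by rewrite ji0 expnSr exprM e0 expr2 -[_ * _]/(_ *m _) J_sqr ai0.
by have := h2 i; rewrite /= (negPf ni) -restrX => ->; rewrite restr_scalar.
Qed.

End Restriction.

Section NonSquare.
Variables (F : finFieldType) (c : F) (nsq : forall x : F, x ^+ 2 != c).
Variables (n : nat) (B : 'M[F]_n).
Hypothesis BB : B *m B = c%:M.

Lemma cyclic_step p (X : 'M[F]_(p, n)) : row_free (col_mx X (X *m B)) ->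
  (p + p < n)%N -> exists Y : 'M[F]_(1 + p, n), row_free (col_mx Y (Y *m B)).
Proof.
move=> fX ltpn; set W := col_mx X (X *m B) in fX.
have rkW : \rank W = (p + p)%N by apply/eqP.
have stabW : (W *m B <= W)%MS.
  rewrite /W mul_col_mx -mulmxA BB mul_mx_scalar -!addsmxE addsmxC.
  by rewrite addsmxS // scalemx_sub.
have [i vW] : exists i, ~~ (row i (1%:M : 'M[F]_n) <= W)%MS.
  by apply/row_subPn; rewrite sub1mx /row_full rkW ltn_eqF.
set v := row i 1%:M in vW.
(* Otherwise [v] would be, modulo the stable space [W], an eigenvector of [B], and its eigenvalue a
   square root of [c]. *)
have v2W : ~~ (v *m B <= W + v)%MS.
  apply: contra vW => /sub_addsmxP[[x y] /= e].
  have {e} e : v *m B = x *m W + y 0 0 *: v.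
    by rewrite e {1}[y]mx11_scalar mul_scalar_mx.
  have ne : c - y 0 0 ^+ 2 != 0 by rewrite subr_eq0 eq_sym nsq.
  rewrite -[v](scalerK ne); apply: scalemx_sub.
  have -> : (c - y 0 0 ^+ 2) *: v = x *m W *m B + y 0 0 *: (x *m W).
    have : v *m B *m B = c *: v by rewrite -mulmxA BB mul_mx_scalar.
    rewrite e mulmxDl -scalemxAl e scalerDr scalerA -expr2 addrA scalerBl => <-.
    by rewrite addrK.
  by rewrite addmx_sub ?scalemx_sub ?submxMl // -mulmxA (submx_trans _ stabW) // submxMl.
exists (col_mx v X).
have lt1 : (\rank W < \rank (W + v)%MS)%N.
  apply: rank_ltmx; rewrite ltmxE addsmxSl /=; apply: contra vW.
  by apply: submx_trans; apply: addsmxSr.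
have lt2 : (\rank (W + v) < \rank (W + v + v *m B)%MS)%N.
  apply: rank_ltmx; rewrite ltmxE addsmxSl /=; apply: contra v2W.
  by apply: submx_trans; apply: addsmxSr.
rewrite -row_leq_rank; apply: leq_trans (_ : _ <= \rank (W + v + v *m B)%MS)%N _.
  by rewrite rkW in lt1; lia.
have colL s t (Y : 'M[F]_(s, n)) (Z : 'M[F]_(t, n)) : (Y <= col_mx Y Z)%MS.
  by rewrite -addsmxE addsmxSl.
have colR s t (Y : 'M[F]_(s, n)) (Z : 'M[F]_(t, n)) : (Z <= col_mx Y Z)%MS.
  by rewrite -addsmxE addsmxSr.
apply: mxrankS; rewrite !addsmx_sub /W col_mx_sub mul_col_mx.
by do ![apply/andP; split]; do ?[exact: submx_trans (colL _ _ _ _) (colL _ _ _ _) |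
  exact: submx_trans (colR _ _ _ _) (colL _ _ _ _) |
  exact: submx_trans (colL _ _ _ _) (colR _ _ _ _) |
  exact: submx_trans (colR _ _ _ _) (colR _ _ _ _)].
Qed.

(** The bound is [n.+1] and not [n] so that, for [n] odd, it yields [n + 1] independent rows, the
    contradiction behind [nonsquare_even]. *)
Lemma cyclic_basis p : (p + p <= n.+1)%N ->
  exists X : 'M[F]_(p, n), row_free (col_mx X (X *m B)).
Proof.
elim: p => [_|p IHp lep].
  by exists 0; rewrite /row_free; apply/eqP; rewrite flatmx0 mxrank0.
have [X fX] := IHp (ltac:(lia)).
by apply: (cyclic_step fX); lia.
Qed.

Lemma nonsquare_even : ~~ odd n.
Proof.
apply/negP => on; have le : (uphalf n + uphalf n <= n.+1)%N.
  by have := odd_double_half n; rewrite uphalf_half on -addnn; lia.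
have [X] := cyclic_basis le.
rewrite -row_leq_rank => h; have := leq_trans h (rank_leq_col (col_mx X (X *m B))).
by have := odd_double_half n; rewrite uphalf_half on -addnn; lia.
Qed.

End NonSquare.

(** By [cyclic_basis], all matrices with square [c] are conjugate to one [J], with centralizer the
    general linear group over [K]: a single class replaces the sum over [k] of the split case. *)
Lemma nonsplit_count (F : finFieldType) (c : F) (nsq : forall x : F, x ^+ 2 != c)
    (m : nat) (a : 'I_m -> F) (j : 'I_m -> nat) (i0 : 'I_m) (J0 : nat) (n : nat) :
    j i0 = J0.+1 -> a i0 = c ->
  let K := qextF nsq in
  let aK := [eta (fun i => qbase nsq (a i)) with i0 |-> (qgen nsq : K)] in
  let j' := [eta j with i0 |-> J0] in
  #|ctuples n a j|%:R / (glcard n #|F|)%:R =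
  (if (2 %| n)%N then
     #|ctuples (n %/ 2) aK j'|%:R / (glcard (n %/ 2) (#|F| ^ 2))%:R
   else 0) :> rat.
Proof.
move=> ji0 ai0 K aK j'.
have BB p A : A \in ctuples p a j -> pw i0 (2 ^ J0) A *m pw i0 (2 ^ J0) A = c%:M.
  by move=> /ctuplesP[_ h2]; rewrite -ai0 -h2 ji0 expnSr exprM expr2.
have [/dvdnP[p en]|n2] := boolP (2 %| n)%N; last first.
  rewrite (_ : #|_| = 0%N) ?mul0r //; apply: eq_card0 => A; apply/negP => AT.
  by have := nonsquare_even nsq (BB _ _ AT); rewrite -dvdn2 (negPf n2).
have {}en : n = (p + p)%N by lia.
rewrite en (_ : (p + p) %/ 2 = p)%N; last by lia.
have gl0 (F' : finFieldType) k : (glcard k #|F'|)%:R != 0 :> rat.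
  rewrite pnatr_eq0 -lt0n -card_units card_gt0; apply/set0Pn; exists 1%:M.
  by rewrite inE unitmx1.
rewrite -(card_qext nsq) -/K.
have := conj_count a j i0 (2 ^ J0) (block_mx 0 1%:M c%:M 0 : 'M[F]_(p + p)).
rewrite card_restr_centralizer (card_ctuples_restr nsq _ ji0 ai0) -/K -/aK -/j'.
rewrite (_ : [set A in _ | [exists P, _]] = ctuples (p + p) a j); last first.
  apply/setP => A; rewrite [LHS]inE; apply: andb_idr => AT.
  have [X fX] := cyclic_basis nsq (BB _ _ AT) (leqnSn (p + p)).
  apply/existsP; exists (col_mx X (X *m pw i0 (2 ^ J0) A)).
  rewrite inE -row_free_unit fX mul_col_mx mul_block_col !mul0mx addr0 add0r mul1mx.
  by rewrite -mulmxA (BB _ _ AT) mul_mx_scalar mul_scalar_mx eqxx.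
rewrite !card_units => /(congr1 (fun x => x%:R : rat)).
set c0 := #|_|; set c1 := #|ctuples p _ _| => e.
have {}e : c0%:R * (glcard p #|K|)%:R = (glcard (p + p) #|F|)%:R * c1%:R :> rat.
  by rewrite -!natrM e.
apply: (mulIf (gl0 K p)); rewrite mulfVK //; apply: (mulIf (gl0 F (p + p)%N)).
by rewrite mulrAC mulfVK // e mulrC.
Qed.

(** * Roots of scalars in finite fields, and the logarithm of the counting series *)

Lemma gcdn_exp2 j N : (0 < N)%N -> gcdn (2 ^ j) N = (2 ^ minn j (logn 2 N))%N.
Proof.
move=> N0; case: leqP => [le|/ltnW le].
  by apply/gcdn_idPl; rewrite pfactor_dvdn.
rewrite -{1}(partnC 2%N N0) p_part Gauss_gcdl; first exact/gcdn_idPr/dvdn_exp2l.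
by rewrite coprimeXl // coprime2n odd_2'nat part_pnat.
Qed.

Lemma odd_predK n : odd n -> (n.-1 = n.-1./2 * 2)%N.
Proof. by case: n => //= n on; rewrite muln2 -{1}[n]odd_double_half (negPf on). Qed.

(* The number of y in the field with Q elements such that y ^ (2 ^ j) = x, for
   x != 0 in a subfield F. *)
Definition cnum (F : finFieldType) (x : F) (j Q : nat) : nat :=
  let g := gcdn (2 ^ j) (Q - 1) in if x ^+ ((Q - 1) %/ g) == 1 then g else 0%N.

Section Cnum.
Variable F : finFieldType.
Hypothesis oF : odd #|F|.
Implicit Types x b : F.

Lemma two_neq0 : 2%:R != 0 :> F.
Proof.
have q0 : #|F|%:R = 0 :> F.
  have : \sum_(x : F) x = \sum_(x : F) (x + 1) by rewrite (reindex_inj (addIr 1)).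
  rewrite big_split /= sumr_const -[LHS]addr0 => /addrI e.
  by rewrite [RHS]e.
apply/eqP => e2; move/eqP: q0.
by rewrite -[#|F|]odd_double_half oF natrD -muln2 natrM e2 mulr0 addr0 oner_eq0.
Qed.

Lemma expf_cardX x t : x ^+ (#|F| ^ t) = x.
Proof. by elim: t => // t IH; rewrite expnS exprM expf_card. Qed.

Lemma expf_cardX_sub1 x t : x != 0 -> x ^+ (#|F| ^ t - 1) = 1.
Proof.
move=> x0; apply: (mulfI x0); rewrite -exprS mulr1 subn1 prednK ?expf_cardX //.
by rewrite expn_gt0 ltnW ?finNzRing_gt1.
Qed.

Lemma cnum_0 x t : x != 0 -> cnum x 0 (#|F| ^ t) = 1%N.
Proof. by move=> x0; rewrite /cnum expn0 gcd1n divn1 expf_cardX_sub1 // eqxx. Qed.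

Lemma cnum_1 j Q : (1 < Q)%N -> cnum (1 : F) j Q = (2 ^ minn j (logn 2 (Q - 1)))%N.
Proof. by move=> Q1; rewrite /cnum expr1n eqxx gcdn_exp2 // subn_gt0. Qed.

(** If [2 ^ J.+1] divides [Q - 1], then [b] and [- b] have equally many roots. Otherwise the
    exponent in the criterion is odd, hence sensitive to the sign, and at most one of them has
    roots. *)
Lemma cnum_split b J Q : odd Q -> (1 < Q)%N ->
  cnum (b ^+ 2) J.+1 Q = (cnum b J Q + cnum (- b) J Q)%N.
Proof.
move=> oQ Q1; have N0 : (0 < Q - 1)%N by rewrite subn_gt0.
rewrite /cnum !gcdn_exp2 //; set N := (Q - 1)%N in N0 *; set v := logn 2 N.
have [ltJv|leqvJ] := ltnP J v.
  rewrite !(minn_idPl _) // 1?ltnW //.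
  have -> : (N %/ 2 ^ J = 2 * (N %/ 2 ^ J.+1))%N.
    have d : (2 ^ J.+1 %| N)%N by rewrite pfactor_dvdn.
    by rewrite -{1}(divnK d) expnS mulnA mulnK ?expn_gt0 // mulnC.
  rewrite !exprM sqrrN expnS; case: eqP => _ //.
  by rewrite mul2n addnn.
rewrite !(minn_idPr _) //; last by rewrite leqW.
have oo : odd (N %/ 2 ^ v).
  by rewrite -{1}(partnC 2%N N0) p_part -/v mulKn ?expn_gt0 // odd_2'nat part_pnat.
set o := (N %/ _)%N in oo *.
rewrite exprAC sqrf_eq1 exprNn -signr_odd oo expr1 mulN1r eqr_oppLR.
case: eqP => [->|_] /=; last by rewrite add0n.
have ne : (1 : F) != - 1 by rewrite -addr_eq0 -mulr2n two_neq0.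
by rewrite (negPf ne) addn0.
Qed.

(** Euler's criterion, through a generator [z] of the multiplicative group: if the power were 1, the
    exponent of [c] in base [z] would be even. *)
Lemma nonsquare_expf c : c != 0 -> (forall x : F, x ^+ 2 != c) ->
  c ^+ (#|F|.-1)./2 = - 1.
Proof.
move=> c0 nsq; have q1 : (1 < #|F|)%N by apply: finNzRing_gt1.
have oq := odd_predK oF.
have cq : c ^+ #|F|.-1 = 1.
  by have := expf_cardX_sub1 1 c0; rewrite expn1 subn1.
have : (c ^+ (#|F|.-1)./2 == 1) || (c ^+ (#|F|.-1)./2 == - 1).
  by rewrite -sqrf_eq1 -exprM -oq cq.
case/orP => [/eqP c1|/eqP //]; exfalso.
have q'0 : (0 < #|F|.-1)%N by rewrite -subn1 subn_gt0.
pose rs := enum [pred x : F | x != 0].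
have /hasP[z _ pz] : has (#|F|.-1).-primitive_root rs.
  apply: has_prim_root => //.
  - apply/allP => x; rewrite mem_enum inE unity_rootE => x0.
    by have := expf_cardX_sub1 1 x0; rewrite expn1 subn1 => ->.
  - exact: enum_uniq.
  - by rewrite -cardE -(cardC1 (0 : F)); apply/eq_leq/eq_card => x; rewrite !inE.
have [i ci] := prim_rootP pz cq.
move: c1; rewrite ci -exprM => /eqP; rewrite -(prim_order_dvd pz) {1}oq mulnC.
rewrite dvdn_pmul2r; last by lia.
move=> /dvdnP[k ek]; have := nsq (z ^+ k).
by rewrite ci ek exprM eqxx.
Qed.

Lemma cnum_nonsquare c J : c != 0 -> (forall x : F, x ^+ 2 != c) ->
  cnum c J.+1 #|F| = 0%N.
Proof.
move=> c0 nsq; have q1 : (1 < #|F|)%N by apply: finNzRing_gt1.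
have N0 : (0 < #|F| - 1)%N by rewrite subn_gt0.
rewrite /cnum; case: eqP => // e; exfalso.
have d2 : (2 %| gcdn (2 ^ J.+1) (#|F| - 1))%N.
  by rewrite dvdn_gcd expnS dvdn_mulr //= subn1 odd_predK // dvdn_mull.
have [k ek] := dvdnP d2.
have := nonsquare_expf c0 nsq; have -> : ((#|F|.-1)./2 = (#|F| - 1) %/ gcdn (2 ^ J.+1) (#|F| - 1) * k)%N.
  have := divnK (dvdn_gcdr (2 ^ J.+1) (#|F| - 1)); rewrite {2}ek mulnA subn1.
  by move=> {1}<-; rewrite muln2 doubleK.
rewrite exprM e expr1n => /eqP; rewrite -addr_eq0 -mulr2n.
by rewrite (negPf two_neq0).
Qed.

End Cnum.

Lemma cnum_ext (F : finFieldType) (c : F) (nsq : forall x : F, x ^+ 2 != c) x j Q :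
  cnum (qbase nsq x : qextF nsq) j Q = cnum x j Q.
Proof. by rewrite /cnum -rmorphXn fmorph_eq1. Qed.

(** In the extension [c] is the square of [g], and the Frobenius of [F] exchanges [g] and [- g], so
    the two summands of [cnum_split] are equal. *)
Lemma cnum_qgen (F : finFieldType) (c : F) (nsq : forall x : F, x ^+ 2 != c) J t :
    odd #|F| -> c != 0 ->
  cnum c J.+1 (#|F| ^ (2 ^ t.+1)) =
  (2 * cnum (qgen nsq : qextF nsq) J ((#|F| ^ 2) ^ (2 ^ t)))%N.
Proof.
move=> oF c0; set Q := (#|F| ^ _)%N.
have q1 : (1 < #|F|)%N by apply: finNzRing_gt1.
have oK : odd #|qextF nsq| by rewrite card_qext oddX oF.
have Q1 : (1 < Q)%N by rewrite -(expn0 #|F|) ltn_exp2l // expn_gt0.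
have oQ : odd Q by rewrite oddX oF orbT.
rewrite -expnM -expnS -/Q -(cnum_ext nsq) -qgen_sqr (cnum_split oK) //.
set g : qextF nsq := qgen nsq.
have gq : g ^+ #|F| = - g.
  have -> : #|F| = ((#|F|.-1)./2 * 2).+1.
    by rewrite -odd_predK // prednK // ltnW.
  rewrite exprS mulnC exprM qgen_sqr -rmorphXn (nonsquare_expf oF c0 nsq).
  by rewrite rmorphN rmorph1 mulrN1.
suff -> : cnum (- g) J Q = cnum g J Q by rewrite mul2n addnn.
rewrite /cnum; set k := (_ %/ _)%N; congr (if _ then _ else _).
apply/eqP/eqP => e; last by rewrite -gq exprAC e expr1n.
have -> : g = (- g) ^+ #|F| by rewrite exprNn -signr_odd oF expr1 mulN1r gq opprK.
by rewrite exprAC e expr1n.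
Qed.

(** The number of tuples [y] in the field with [#|F| ^ (2 ^ t)] elements such that
    [y i ^ (2 ^ j i) = a i], for nonzero [a i]. *)
Definition Mfun (F : finFieldType) m (a : 'I_m -> F) (j : 'I_m -> nat) (t : nat) : nat :=
  (\prod_i cnum (a i) (j i) (#|F| ^ (2 ^ t)))%N.

Definition dcoef (M : nat -> nat) (t : nat) : rat :=
  ((M t)%:R - (if t is t'.+1 then (M t')%:R else 0)) / 2 ^+ t.

Definition Aser (q : nat) (M : nat -> nat) : fps rat :=
  Fps (fun N => \sum_(t < N.+1 | (2 ^ t %| N)%N)
                  dcoef M t * Glog (q ^ (2 ^ t)) (N %/ 2 ^ t)%N).

Lemma AserE q M N : Aser q M N = \sum_(t < N.+1 | (2 ^ t %| N)%N)
                  dcoef M t * Glog (q ^ (2 ^ t)) (N %/ 2 ^ t)%N.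
Proof. by []. Qed.

Lemma AserD q M M' M'' : (forall t, M t = M' t + M'' t)%N ->
  Aser q M = Aser q M' + Aser q M''.
Proof.
move=> e; apply: fpsP => N; rewrite fpsD !AserE -big_split; apply: eq_bigr => t _.
rewrite /= -mulrDl; congr (_ * _); rewrite /dcoef -mulrDl; congr (_ / _).
by case: (nat_of_ord t) => [|s]; rewrite !e !natrD; ring.
Qed.

Lemma Glog0 Q : Glog Q 0%N = 0. Proof. by case: (isexp_Glog Q). Qed.

Lemma Aser1 q M : (forall t, M t = 1%N) -> Aser q M = Glog q.
Proof.
move=> e; apply: fpsP => N; rewrite AserE big_mkcond big_ord_recl.
rewrite expn0 dvd1n /= divn1 expn1 /dcoef e subr0 divr1 mul1r big1 ?addr0 // => t _.
by rewrite /= !e subrr !mul0r if_same.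
Qed.

Lemma AserE_nat q M N : Aser q M N = \sum_(0 <= t < N.+1)
  (if (2 ^ t %| N)%N then dcoef M t * Glog (q ^ (2 ^ t)) (N %/ 2 ^ t)%N else 0).
Proof. by rewrite AserE big_mkcond big_mkord. Qed.

(** Index [t + 1] over [q] is index [t] over [q ^ 2], and the factor 2 cancels against the
    denominator: the trace of a quadratic extension on the logarithm. *)
Lemma Aser_shift q M M' : M 0%N = 0%N -> (forall t, M t.+1 = 2 * M' t)%N ->
  Aser q M = fsub 2 (Aser (q ^ 2) M').
Proof.
move=> e0 eS; apply: fpsP => N.
rewrite [RHS]fsubE.
rewrite [LHS]AserE_nat.
rewrite [LHS]big_nat_recl; last exact: leq0n.
have -> : dcoef M 0 = 0 by rewrite /dcoef e0 subr0 mul0r.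
rewrite mul0r if_same add0r.
have dE t : dcoef M t.+1 = dcoef M' t.
  rewrite /dcoef eS exprS natrM; case: t => [|t]; rewrite ?e0 ?eS ?natrM; last first.
    by rewrite -mulrBr -mulf_div divff // mul1r.
  by rewrite !subr0 -mulf_div divff // mul1r.
case: ifP => [/dvdnP[k ->]|n2]; last first.
  apply: big1 => t _; case: ifP => // d; move: n2.
  by rewrite (dvdn_trans _ d) // expnS dvdn_mulr.
rewrite mulnK // AserE_nat.
pose f t := if (2 ^ t %| k)%N then dcoef M' t * Glog ((q ^ 2) ^ 2 ^ t) (k %/ 2 ^ t)%N else 0.
have fz t : (k < t)%N -> f t = 0.
  rewrite /f; case: ifP => // d ltkt; have [->|k0] := posnP k.
    by rewrite div0n Glog0 mulr0.
  have := dvdn_leq k0 d; have := ltn_expl t (isT : (1 < 2)%N).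
  by move=> h1 h2; have := ltn_trans (leq_ltn_trans h2 ltkt) h1; rewrite ltnn.
have fzz t : k = 0%N -> f t = 0.
  by rewrite /f => ->; rewrite div0n Glog0 mulr0 if_same.
(* The two sides are truncated at different [t]; the surplus terms vanish because [2 ^ t] exceeds
   [k]. *)
transitivity (\sum_(0 <= t < k * 2) f t).
  apply: eq_bigr => t _; rewrite /f dE.
  by rewrite expnS -expnM (mulnC k) dvdn_pmul2l // divnMl.
rewrite -[RHS]/(\sum_(0 <= t < k.+1) f t).
have [k0|k0] := posnP k.
  by rewrite !big1 // => t _; apply: fzz.
have le : (k.+1 <= k * 2)%N by lia.
rewrite (big_cat_nat (leq0n k.+1) le) /=.
rewrite [X in _ + X]big1_seq ?addr0 // => t.
by rewrite mem_index_iota => /andP[_ /andP[ltk _]]; rewrite fz.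
Qed.

Lemma gl_neq0 (F : finFieldType) k : (glcard k #|F|)%:R != 0 :> rat.
Proof.
rewrite pnatr_eq0 -lt0n -card_units card_gt0; apply/set0Pn; exists 1%:M.
by rewrite inE unitmx1.
Qed.

Definition Hser (F : finFieldType) m (a : 'I_m -> F) (j : 'I_m -> nat) : fps rat :=
  Fps (fun n => #|ctuples n a j|%:R / (glcard n #|F|)%:R).
Lemma HserE (F : finFieldType) m (a : 'I_m -> F) (j : 'I_m -> nat) n :
  Hser a j n = #|ctuples n a j|%:R / (glcard n #|F|)%:R.
Proof. by []. Qed.

(** Induction on the sum of the [j i], over all fields at once. Each step is matched on the side of
    [Mfun]: [split_count] by [cnum_split], and [nonsplit_count] by [cnum_qgen] and [cnum_nonsquare].
    In the base case the scalars leave one tuple in each dimension. *)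
Theorem isexp_Hser (F : finFieldType) m (a : 'I_m -> F) (j : 'I_m -> nat) :
  odd #|F| -> (forall i, a i != 0) -> isexp (Aser #|F| (Mfun a j)) (Hser a j).
Proof.
have [S eS] : exists S, (\sum_i j i)%N = S by eexists.
elim: S F a j eS => [|S IH] F a j eS oF a0.
  have j0 i : j i = 0%N.
    by apply/eqP; have /eqP := eS; rewrite sum_nat_eq0 => /forallP/(_ i).
  rewrite Aser1 => [|t]; last first.
    by rewrite /Mfun big1 // => i _; rewrite j0 cnum_0.
  rewrite (_ : Hser a j = Eser #|F|); first exact: isexp_Glog.
  apply: fpsP => n; rewrite HserE (_ : #|_| = 1%N); first by rewrite div1r.
  rewrite (_ : ctuples n a j = [set [ffun i => (a i)%:M]]) ?cards1 //.
  apply/setP => A; rewrite [RHS]inE; apply/ctuplesP/eqP => [[_ h2]|->].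
    by apply/ffunP => i; rewrite ffunE -h2 j0 expn0 expr1.
  by split=> [i k|i]; rewrite !ffunE ?j0 ?expn0 ?expr1 // scalar_mxC.
have [i0 ji0] : exists i0, (0 < j i0)%N.
  apply/existsP; apply: contraT; rewrite negb_exists => /forallP h.
  by move: eS; rewrite big1 // => i _; apply/eqP; rewrite -leqn0 leqNgt.
case E: (j i0) ji0 => [//|J0] _.
set j' := [eta j with i0 |-> J0].
have eS' : (\sum_i j' i)%N = S.
  move: eS; rewrite (bigD1 i0) //= E addSn => -[<-]; rewrite (bigD1 i0) //=.
  rewrite /j' /= eqxx; congr (_ + _)%N; apply: eq_bigr => i ni.
  by rewrite /= (negPf ni).
have q1 : (1 < #|F|)%N by apply: finNzRing_gt1.
have oX t : odd (#|F| ^ 2 ^ t) by rewrite oddX oF orbT.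
have X1 t : (1 < #|F| ^ 2 ^ t)%N by rewrite -(expn0 #|F|) ltn_exp2l // expn_gt0.
have [/existsP[b /eqP eb]|] := boolP [exists b : F, b ^+ 2 == a i0].
  have b0 : b != 0.
    by apply: contra (a0 i0) => /eqP b0; rewrite -eb b0 expr0n.
  have b2 : b *+ 2 != 0 by rewrite -mulr_natr mulf_neq0 // two_neq0.
  have nz c : c != 0 -> forall i, [eta a with i0 |-> c] i != 0.
    by move=> c0 i; rewrite /=; case: ifP.
  have bN0 : - b != 0 by rewrite oppr_eq0.
  have := isexpM (IH F _ j' eS' oF (nz _ b0)) (IH F _ j' eS' oF (nz _ bN0)).
  rewrite -(@AserD _ (Mfun a j)) => [|t]; last first.
    have Mx x : Mfun [eta a with i0 |-> x] j' t = (cnum x J0 (#|F| ^ 2 ^ t) *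
        \prod_(i | i != i0) cnum (a i) (j i) (#|F| ^ 2 ^ t))%N.
      rewrite /Mfun (bigD1 i0) //= eqxx; congr (_ * _)%N.
      by apply: eq_bigr => i ni; rewrite (negPf ni).
    rewrite !Mx -mulnDl -(cnum_split oF) // eb -E.
    by rewrite /Mfun (bigD1 i0).
  rewrite (_ : _ * _ = Hser a j) //; apply: fpsP => n.
  by rewrite HserE (split_count n E (esym eb) b2) fpsM.
rewrite negb_exists => /forallP nsq.
have nz i : [eta (fun i => qbase nsq (a i)) with i0 |-> (qgen nsq : qextF nsq)] i != 0.
  rewrite /=; case: ifP => _; last by rewrite fmorph_eq0.
  by rewrite xpair_eqE oner_eq0 andbF.
have oK : odd #|qextF nsq| by rewrite card_qext oddX oF.
have := isexp_fsub (ltn0Sn 1) (IH (qextF nsq) _ j' eS' oK nz).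
rewrite card_qext -(@Aser_shift _ (Mfun a j)); first last.
- move=> t; rewrite /Mfun card_qext (bigD1 i0) //= [in RHS](bigD1 i0) //= eqxx.
  rewrite E (cnum_qgen nsq) // mulnA; congr (_ * _)%N; apply: eq_bigr => i ni.
  by rewrite /= (negPf ni) cnum_ext -expnM -expnS.
- by rewrite /Mfun (bigD1 i0) //= E expn0 expn1 (cnum_nonsquare oF) ?mul0n.
rewrite (_ : fsub 2 _ = Hser a j) //; apply: fpsP => n.
by rewrite fsubE !HserE (nonsplit_count nsq n E erefl) card_qext.
Qed.

Section HomGL.
Local Open Scope nat_scope.
Local Open Scope group_scope.

(** * Homomorphisms as commuting tuples *)

Lemma bigdprod_gen (gT : finGroupType) (b : seq gT) (G : {group gT}) :
  \big[dprod/1]_(x <- b) <[x]> = G -> <<[set x in b]>> = G.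
Proof.
elim: b G => [|x b IH] G.
  rewrite big_nil => <-; have -> : [set x in [::]] = set0 :> {set gT}.
    by apply/setP => x; rewrite !inE.
  exact: gen0.
rewrite big_cons => /dprodP[[K H _ defH] defG _ _]; rewrite defH in defG.
have xG : x \in G by rewrite -cycle_subG -defG mulG_subl.
have sHG : H \subset G by rewrite -defG mulG_subr.
apply/eqP; rewrite eqEsubset; apply/andP; split.
  rewrite gen_subG; apply/subsetP => y; rewrite !inE => /orP[/eqP->//|yb].
  by rewrite (subsetP sHG) // -(IH _ defH) mem_gen // inE.
rewrite -defG mul_subG //; first by rewrite cycle_subG mem_gen // inE mem_head.
rewrite -(IH _ defH); apply: genS; apply/subsetP => y.
by rewrite !inE => ->; rewrite orbT.
Qed.

(** The universal property of a direct product of cyclic groups, for images that commute with each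
    other. *)
Lemma bigdprod_hom (gT hT : finGroupType) (b : seq gT) (y : nat -> hT)
    (G : {group gT}) :
    \big[dprod/1]_(x <- b) <[x]> = G ->
    (forall i, (i < size b)%N -> y i ^+ #[nth 1 b i] = 1) ->
    (forall i k, (i < size b)%N -> (k < size b)%N -> commute (y i) (y k)) ->
  exists f : {morphism G >-> hT},
    forall i, (i < size b)%N -> f (nth 1 b i) = y i.
Proof.
elim: b y G => [|x b IH] y G.
  by move=> _ _ _; exists [morphism of trivm G].
rewrite big_cons => defG ord com.
have /dprodP[[K H defK defH] _ _ _] := defG.
have [f fE] := IH (fun i => y i.+1) H defH (fun i => ord i.+1)
  (fun i k => com i.+1 k.+1).
have dvd_y : #[y 0%N] %| #[x] by rewrite order_dvdn; apply/eqP; apply: (ord 0%N).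
rewrite defH in defG.
have genH := bigdprod_gen defH.
have bH z : z \in b -> z \in H by move=> zb; rewrite -genH mem_gen // inE.
have cf : f @* H \subset 'C(eltm_morphism dvd_y @* <[x]>).
  rewrite im_eltm cent_cycle sub_morphim_pre // -{1}genH gen_subG.
  apply/subsetP => z; rewrite inE => zb; rewrite mem_morphpre ?bH //.
  have lti : (index z b < size b)%N by rewrite index_mem.
  have -> : z = nth 1 b (index z b) by rewrite nth_index.
  by rewrite fE //; apply/cent1P; apply: com.
exists (dprodm_morphism defG cf) => -[|i] lti /=.
  by rewrite dprodmEl ?cycle_id //= eltm_id.
by rewrite dprodmEr ?bH ?mem_nth // fE.
Qed.

Section HomTuples.
Variables (gT : finGroupType) (b : seq gT) (F : finFieldType) (n : nat).
Hypothesis defG : \big[dprod/1]_(x <- b) <[x]> = [set: gT].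
Hypothesis abG : abelian [set: gT].
Variable j : 'I_(size b) -> nat.
Hypothesis jE : forall i : 'I_(size b), #[nth 1 b i] = (2 ^ j i)%N.

Let gens (f : {ffun gT -> GLn n F}) : {ffun 'I_(size b) -> 'M[F]_n} :=
  [ffun i : 'I_(size b) => GLmx (f (nth 1 b i))].

Lemma homsetP (f : {ffun gT -> GLn n F}) :
  reflect {morph f : x y / x * y} (f \in homset gT (GLn n F)).
Proof.
rewrite inE; apply: (iffP forallP) => [h x y|h x].
  by apply/eqP; apply: (forallP (h x)).
by apply/forallP => y; rewrite h.
Qed.

Lemma GLmxX (A : GLn n F) k : GLmx (A ^+ k) = (GLmx A ^+ k)%R.
Proof. by elim: k => // k IH; rewrite expgS exprS /= IH. Qed.

Lemma gens_inj : {in homset gT (GLn n F) &, injective gens}.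
Proof.
move=> f f' /homsetP hf /homsetP hf' /ffunP e; apply/ffunP => x.
pose m := @Morphism _ _ [set: gT] f (in2W hf).
pose m' := @Morphism _ _ [set: gT] f' (in2W hf').
have gS : group_set [set x | m x == m' x].
  apply/group_setP; split=> [|y z]; first by rewrite inE !morph1.
  by rewrite !inE !morphM ?inE // => /eqP-> /eqP->.
have : <<[set x in b]>> \subset Group gS.
  rewrite gen_subG; apply/subsetP => y; rewrite !inE => yb.
  have lti : (index y b < size b)%N by rewrite index_mem.
  have := e (Ordinal lti); rewrite !ffunE /= nth_index // => e'.
  by apply/eqP; apply: val_inj.
rewrite (bigdprod_gen defG) => /subsetP/(_ x); rewrite !inE => /(_ isT).
by move/eqP.
Qed.

(** A morphism is determined by its values on a basis; conversely a matrix with a positive power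
    equal to 1 is invertible, so every commuting tuple arises. *)
Lemma card_homset : #|homset gT (GLn n F)| = #|ctuples n (fun _ : 'I_(size b) => 1%R : F) j|.
Proof.
rewrite -(card_in_imset gens_inj); apply: eq_card => A.
apply/imsetP/ctuplesP => [[f /homsetP hf ->]|[h1 h2]].
  pose m := @Morphism _ _ [set: gT] f (in2W hf).
  split=> [i k|i]; rewrite !ffunE.
    rewrite -[LHS]/(GLmx (f _ * f _)) -[RHS]/(GLmx (f _ * f _)) -!hf.
    by rewrite (centsP abG) ?inE.
  rewrite -GLmxX -(morphX m) ?inE // -jE expg_order.
  by rewrite morph1.
have uA i : A i \in unitmx.
  have := h2 i; rewrite -[(2 ^ j i)%N]prednK ?expn_gt0 // exprS.
  by case/mulmx1_unit.
pose y (i : nat) : GLn n F := if insub i is Some k then MkGLn (uA k) else 1.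
have yE (i : 'I_(size b)) : y i = MkGLn (uA i) by rewrite /y valK.
have ord i : (i < size b)%N -> y i ^+ #[nth 1 b i] = 1.
  move=> lti; pose k := Ordinal lti; rewrite -[i]/(val k) (jE k) yE.
  by apply: val_inj; rewrite [LHS]GLmxX h2.
have com i k : (i < size b)%N -> (k < size b)%N -> commute (y i) (y k).
  move=> lti ltk; rewrite -[i]/(val (Ordinal lti)) -[k]/(val (Ordinal ltk)) !yE.
  by apply: val_inj; apply: h1.
have [f fE] := bigdprod_hom defG ord com.
exists (finfun f).
  by apply/homsetP => u v; rewrite !ffunE morphM ?inE.
by apply/ffunP => i; rewrite !ffunE fE // yE.
Qed.

End HomTuples.

Lemma exponent_gen (gT : finGroupType) (b : seq gT) N :
    abelian [set: gT] -> <<[set x in b]>> = [set: gT] ->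
    {in b, forall x, x ^+ N = 1} -> exponent [set: gT] %| N.
Proof.
move=> abG gG bN; apply/exponentP => x _.
have gS : group_set [set x : gT | x ^+ N == 1].
  apply/group_setP; split=> [|y z]; first by rewrite inE expg1n.
  rewrite !inE => /eqP yN /eqP zN; rewrite expgMn ?yN ?zN ?mulg1 //.
  by apply: (centsP abG); rewrite inE.
have : <<[set x in b]>> \subset Group gS.
  by rewrite gen_subG; apply/subsetP => y; rewrite !inE => /bN->.
by rewrite gG => /subsetP/(_ x); rewrite !inE => /(_ isT)/eqP.
Qed.

Lemma prodC2_abelian r k : abelian [set: prodC2 r k].
Proof.
apply/centsP => x _ y _; apply/ffunP => i; rewrite !mulg_ffun.
by apply/ffunP => t; rewrite !mulg_ffun; apply: (@addrC 'Z_(2 ^ i.+1)).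
Qed.

Lemma prodC2_exponent r k : exponent [set: prodC2 r k] %| 2 ^ r.
Proof.
apply/exponentP => x _; apply/ffunP => i; apply/ffunP => t.
have E N : (x ^+ N) i t = (x i t *+ N)%R.
  by elim: N => [|N IH]; rewrite ?expgS ?mulrS ?mulg_ffun ?IH // !oneg_ffun.
rewrite E !oneg_ffun; have lti : (i < r)%N := ltn_ord i.
have -> : (2 ^ r = 2 ^ i.+1 * 2 ^ (r - i.+1))%N by rewrite -expnD subnKC.
rewrite mulrnA (_ : (x i t *+ 2 ^ i.+1)%R = 0%R) ?mul0rn //.
have p1 : 1 < 2 ^ i.+1 by rewrite -{1}(expn0 2) ltn_exp2l.
by rewrite -mulr_natr (pchar_Zp p1) mulr0.
Qed.

(** Only the largest exponent [r] and the total [r + s] of a basis are retained. The first comes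
    from bracketing the exponent of the group between its two descriptions, the second from its
    order. *)
Lemma prodC2_hom_tuples (r : nat) (k : nat -> nat) (gT G0 : finGroupType) (s : nat) :
    (0 < r)%N -> [set: gT] \isog [set: prodC2 r k] ->
    [set: gT] \isog [set: ('Z_(2 ^ r) * G0)%type] -> #|[set: G0]| = (2 ^ s)%N ->
  exists m (j : 'I_m -> nat),
    [/\ forall i, (j i <= r)%N, exists i, j i = r, (\sum_i j i)%N = (r + s)%N &
      forall (F : finFieldType) n,
        #|homset gT (GLn n F)| = #|ctuples n (fun _ : 'I_m => 1%R : F) j|].
Proof.
move=> r0 hG hG0 hs.
have p1 : 1 < 2 ^ r by rewrite -{1}(expn0 2) ltn_exp2l.
have abG : abelian [set: gT] by rewrite (isog_abelian hG) prodC2_abelian.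
have expG : exponent [set: gT] %| 2 ^ r by rewrite (exponent_isog hG) prodC2_exponent.
have cardG : #|[set: gT]| = (2 ^ (r + s))%N.
  rewrite (card_isog hG0) cardsT card_prod -[#|G0|]cardsT hs expnD; congr (_ * _)%N.
  by rewrite card_ord Zp_cast.
have expG2 : 2 ^ r %| exponent [set: gT].
  rewrite (exponent_isog hG0).
  pose z : 'Z_(2 ^ r) * G0 := (1%R, 1).
  have : #[z] %| exponent [set: 'Z_(2 ^ r) * G0] by rewrite dvdn_exponent ?inE.
  apply: dvdn_trans; have E N : (z ^+ N).1 = (N%:R)%R.
    by elim: N => // N IH; rewrite expgS mulrS -IH.
  have := E #[z]; rewrite expg_order => /(congr1 (@nat_of_ord _)).
  by rewrite val_Zp_nat // => /esym/eqP.
have [b defG _] := abelian_structure abG.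
pose j (i : 'I_(size b)) := logn 2 #[nth 1 b i].
have ordb (x : gT) : exists2 e, (e <= r)%N & #[x] = (2 ^ e)%N.
  apply/(dvdn_pfactor _ _ (isT : prime 2)); apply: dvdn_trans expG.
  by rewrite dvdn_exponent ?inE.
have jE (i : 'I_(size b)) : #[nth 1 b i] = (2 ^ j i)%N.
  by rewrite /j; have [e _ ->] := ordb (nth 1 b i); rewrite pfactorK.
have jr i : (j i <= r)%N.
  by rewrite /j; have [e le ->] := ordb (nth 1 b i); rewrite pfactorK.
exists (size b), j; split=> //.
- have [/existsP[i /eqP ei]|] := boolP [exists i, j i == r]; first by exists i.
  rewrite negb_exists => /forallP h; exfalso.
  have : exponent [set: gT] %| 2 ^ r.-1.
    apply: (exponent_gen abG (bigdprod_gen defG)) => x xb.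
    have lti : (index x b < size b)%N by rewrite index_mem.
    apply/eqP; rewrite -order_dvdn -(nth_index 1 xb) (jE (Ordinal lti)) dvdn_exp2l //.
    have := h (Ordinal lti); have := jr (Ordinal lti).
    by case: (ltngtP (j (Ordinal lti)) r) => // ltj _ _; rewrite -ltnS prednK.
  move/(dvdn_trans expG2); rewrite dvdn_Pexp2l // => le.
  by move: le; rewrite leqNgt prednK ?leqnn.
- apply/eqP; rewrite -(eqn_exp2l _ _ (isT : 1 < 2)) -cardG -(bigdprod_card defG).
  rewrite expn_sum (big_nth 1) big_mkord; apply/eqP/eq_bigr => i _.
  by rewrite -jE.
- by move=> F n; apply: card_homset.
Qed.

End HomGL.

(** * Assembly *)

(** Summation by parts: the correction term of [Gred] at index [t] is a [Glog] term at index
    [t + 1], as squaring [q ^ (2 ^ t)] gives [q ^ (2 ^ t.+1)]. *)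
Lemma Aser_Gred q M N : Aser q M N = \sum_(0 <= t < N.+1)
  (if (2 ^ t %| N)%N then
     (M t)%:R / 2 ^+ t * Gred (q ^ (2 ^ t)) (N %/ 2 ^ t)%N else 0).
Proof.
rewrite AserE_nat.
pose g t := if (2 ^ t %| N)%N then Glog (q ^ (2 ^ t)) (N %/ 2 ^ t)%N else 0.
(* The boundary term: [2 ^ N.+1] divides no positive [N], and [Glog] vanishes at 0. *)
have gS : g N.+1 = 0.
  rewrite /g; case: ifP => // d; have [->|N0] := posnP N.
    by rewrite div0n Glog0.
  have := dvdn_leq N0 d; have := ltn_expl N.+1 (isT : (1 < 2)%N).
  by move=> h1 h2; have := ltn_trans h1 (leq_ltn_trans h2 (ltnSn N)); rewrite ltnn.
transitivity (\sum_(0 <= t < N.+1) dcoef M t * g t).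
  by apply: eq_bigr => t _; rewrite /g; case: ifP; rewrite ?mulr0.
transitivity (\sum_(0 <= t < N.+1) ((M t)%:R / 2 ^+ t * g t - (M t)%:R / 2 ^+ t.+1 * g t.+1)); last first.
  apply: eq_bigr => t _; rewrite /g; case: ifPn => d; last first.
    rewrite mulr0 (_ : (2 ^ t.+1 %| N)%N = false) ?mulr0 ?subrr //.
    by apply: contraNF d; apply: dvdn_trans; rewrite dvdn_exp2l.
  rewrite GredE fsubE dvdn_divRL // -expnS -divnMA -expnSr -expnM -expnSr mulrBr.
  congr (_ - _); case: ifP => _; rewrite ?mulr0 //.
  by rewrite exprSr invfM !mulrA.
rewrite sumrB [X in _ - X](_ : _ = \sum_(0 <= t < N.+1)
    (if t is t'.+1 then (M t')%:R else 0) / 2 ^+ t * g t).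
  rewrite -sumrB; apply: eq_bigr => t _.
  by rewrite /dcoef mulrBl mulrBl.
rewrite [RHS]big_nat_recl; last exact: leq0n.
rewrite !mul0r add0r [LHS]big_nat_recr; last exact: leq0n.
by rewrite /= gS mulr0 addr0.
Qed.

Definition lamt (q t : nat) : nat := logn 2 (q ^ (2 ^ t) - 1).

Lemma oddpart N : (0 < N)%N -> exists2 m, odd m & N = (2 ^ logn 2 N * m)%N.
Proof.
move=> N0; exists (N`_2^')%N; first by rewrite odd_2'nat part_pnat.
by rewrite -p_part partnC.
Qed.

Section Assembly.
Variables (q l : nat) (mt : nat -> nat) (A H : fps rat).
Hypotheses (oq : odd q) (q1 : (1 < q)%N).
Hypothesis AE : A = Aser q (fun t => 2 ^ mt t)%N.
Hypothesis AH : isexp A H.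
(** Index [t] of [Aser_Gred] contributes valuation at least [mt t - t - lamt q t], which is positive
    for [t < l] and [- (2 e + 1)] at [t = l + e]. *)
Hypothesis lo : forall t, (t < l)%N -> (t + lamt q t < mt t)%N.
Hypothesis hi : forall e, (l + e + lamt q (l + e) = mt (l + e) + e.*2.+1)%N.

Let Q t := (q ^ (2 ^ t))%N.
Let oQ t : odd (Q t). Proof. by rewrite oddX oq orbT. Qed.
Let Q1 t : (1 < Q t)%N.
Proof. by rewrite -(expn0 q) ltn_exp2l // expn_gt0. Qed.

Let term t k : rat := (2 ^ mt t)%:R / 2 ^+ t * Gred (Q t) k.

(** [x] is [(Q t - 1) * Gred (Q t) k] divided by the odd part of [Q t - 1]. Balancing exponents
    through [c] and [d] avoids negative powers of 2. *)
Let termE t k : (0 < k)%N -> exists2 x, x \in z2 &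
  forall c d, (c + mt t = d + (t + lamt q t))%N ->
    2 ^+ c * term t k = 2 ^+ d * x /\ (k = 1%N -> z2o x).
Proof.
move=> k0; have N0 : (0 < Q t - 1)%N by rewrite subn_gt0.
have [m om em] := oddpart N0; rewrite -/(lamt q t) in em.
have m0 : m%:R != 0 :> rat by rewrite pnatr_eq0; case: m om {em}.
have tX n : (2 : rat) ^+ n != 0 by rewrite expf_neq0.
have eQ : (Q t)%:R - 1 = 2 ^+ lamt q t * m%:R :> rat.
  by rewrite -natrX -natrM -em natrB // ltnW.
exists (((Q t)%:R - 1) * Gred (Q t) k / m%:R).
  by rewrite rpredM ?Gred_z2 ?z2_invodd.
move=> c d ecd; split; last first.
  move=> ->; rewrite Gred1 // mulfV; first by rewrite mul1r; apply: z2o_invodd.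
  by rewrite eQ mulf_neq0.
rewrite /term eQ natrX; have := congr1 (fun n => (2 : rat) ^+ n) ecd.
rewrite /= !exprD; move: (tX c) (tX d) (tX (mt t)) (tX t) (tX (lamt q t)).
move: (2 ^+ c) (2 ^+ d) (2 ^+ mt t) (2 ^+ t) (2 ^+ lamt q t) (Gred _ _) => C D E T L G.
move=> C0 D0 E0 T0 L0 e; rewrite mulrA mulrA e; field.
by rewrite m0 T0.
Qed.

Let term_even t k c : (0 < k)%N -> (t + lamt q t < c + mt t)%N ->
  z2e (2 ^+ c * term t k).
Proof.
move=> k0 lt; have [x xz ex] := termE t k0.
have [-> _] := ex c (c + mt t - (t + lamt q t))%N (esym (subnK (ltnW lt))).
rewrite -(subnK (_ : 0 < c + mt t - (t + lamt q t))%N) ?subn_gt0 // addn1 exprS.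
rewrite -mulrA; apply: z2eMr; first by rewrite /z2e mulfV ?rpred1.
by rewrite rpredM ?rpredX ?(z2_nat 2).
Qed.

Let A_split c N t0 : (0 < N)%N -> (2 ^ t0 %| N)%N ->
    (forall t, t != t0 -> (2 ^ t %| N)%N -> (t + lamt q t < c + mt t)%N) ->
  z2e (2 ^+ c * A N - 2 ^+ c * term t0 (N %/ 2 ^ t0)).
Proof.
move=> N0 d0 h.
have lt0 : (t0 < N.+1)%N.
  by rewrite ltnS (leq_trans _ (dvdn_leq N0 d0)) // ltnW // ltn_expl.
rewrite AE Aser_Gred (bigD1_seq t0) ?mem_index_iota ?iota_uniq //= d0 mulrDr.
rewrite addrAC subrr add0r mulr_sumr.
elim/big_rec: _ => [|t x nt hx]; first by rewrite /z2e mul0r rpred0.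
apply: z2eD hx; case: ifP => d; last by rewrite mulr0 /z2e mul0r rpred0.
apply: term_even; last exact: h.
by rewrite divn_gt0 ?expn_gt0 // dvdn_leq.
Qed.

Let A_even c N : (0 < N)%N ->
    (forall t, (2 ^ t %| N)%N -> (t + lamt q t < c + mt t)%N) ->
  z2e (2 ^+ c * A N).
Proof.
move=> N0 h; rewrite -[_ * _](subrK (2 ^+ c * term 0 (N %/ 2 ^ 0))).
apply: z2eD; first by apply: A_split => // t _; apply: h.
by apply: term_even; [rewrite divn1 | apply: h].
Qed.

Let small N : ~~ (2 ^ l %| N)%N -> z2e (A N).
Proof.
move=> nd; have N0 : (0 < N)%N by case: N nd => //; rewrite dvdn0.
rewrite -[A N]mul1r -(expr0 2); apply: A_even => // t d.
apply: lo; rewrite ltnNge; apply: contra nd => le.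
by apply: dvdn_trans d; rewrite dvdn_exp2l.
Qed.

Let below c t : (t < l)%N -> (t + lamt q t < c + mt t)%N.
Proof. by move=> lt; apply: (leq_trans (lo lt)); apply: leq_addl. Qed.

Let above c t : (l <= t)%N -> ((t - l).*2.+1 < c)%N -> (t + lamt q t < c + mt t)%N.
Proof. by move=> lt; have := hi (t - l); rewrite subnKC //; lia. Qed.

Let dvd_odd e m t : odd m -> (2 ^ t %| 2 ^ e * m)%N -> (t <= e)%N.
Proof.
move=> om; rewrite Gauss_dvdl ?coprimeXl ?coprime2n //.
by rewrite dvdn_Pexp2l.
Qed.

Let large e m : odd m -> 2 ^+ (2 * e + 1) * A (2 ^ (l + e) * m)%N \in z2.
Proof.
move=> om; have N0 : (0 < 2 ^ (l + e) * m)%N.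
  by rewrite muln_gt0 expn_gt0; case: m om.
have : z2e (2 ^+ (2 * e + 1).+1 * A (2 ^ (l + e) * m)%N).
  apply: A_even => // t /(dvd_odd om) le; have [lt|lt] := ltnP t l; first exact: below.
  by apply: above => //; lia.
by rewrite /z2e exprSr mulrAC mulfK.
Qed.

(** The indices below [t0] have smaller denominators, and index [t0] is taken at [k = 1], where its
    valuation is exact. *)
Let lead t0 : (l <= t0)%N -> z2o (2 ^+ (t0 - l).*2.+1 * A (2 ^ t0)%N).
Proof.
move=> lt0; set c := _.*2.+1.
rewrite -[_ * _](subrK (2 ^+ c * term t0 (2 ^ t0 %/ 2 ^ t0)%N)).
apply: z2eoD.
  apply: A_split; rewrite ?expn_gt0 // => t nt d.
  have le : (t <= t0)%N by move: d; rewrite dvdn_Pexp2l.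
  have [lt|lt] := ltnP t l; first exact: below.
  by apply: above => //; rewrite /c; lia.
rewrite divnn expn_gt0; have [x xz ex] := termE t0 (isT : (0 < 1)%N).
have [] := ex c 0%N.
  by have := hi (t0 - l); rewrite subnKC // /c; lia.
by rewrite expr0 mul1r => -> /(_ erefl).
Qed.

Theorem assembly n : let v := 2 ^+ vphi l n * H n in
  v \in z2 /\ ((2 ^ l.+2 %| n)%N -> z2o v).
Proof.
apply: (exp_valuation AH small large).
  by have := lead (leqnn l); rewrite subnn expr1.
by have := lead (leqnSn l); rewrite subSnn (_ : 2 ^+ _ = 8).
Qed.

End Assembly.

Lemma z2o_not_even x : z2o x -> ~ z2e x.
Proof.
move=> xo xe; have : z2e (1 : rat).
  by rewrite (_ : 1 = x + - 1 * (x - 1)); [apply: z2eD => //; rewrite mulrC; apply: z2eMr | ring].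
by move=> h; have := @z2_dvd 1 1; rewrite expr1 => /(_ h).
Qed.

Lemma logn_ratio (phi h g l n : nat) : (0 < h)%N -> (0 < g)%N ->
    let v : rat := 2 ^+ phi * (h%:R / g%:R) in
    v \in z2 /\ ((2 ^ l %| n)%N -> z2o v) ->
  (logn 2 g <= phi + logn 2 h)%N /\
  ((2 ^ l %| n)%N -> logn 2 g = (phi + logn 2 h)%N).
Proof.
move=> h0 g0 v [vz vo]; have [m om em] := oddpart g0.
have m0 : m%:R != 0 :> rat by rewrite pnatr_eq0; case: m om {em}.
have N0 : (0 < 2 ^ phi * h)%N by rewrite muln_gt0 expn_gt0.
have vE : (2 ^ phi * h)%:R / 2 ^+ logn 2 g = v * m%:R :> rat.
  rewrite /v {2}em !natrM !natrX; have t0 : (2 : rat) ^+ logn 2 g != 0 by rewrite expf_neq0.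
  by move: t0; move: (2 ^+ logn 2 g) => G G0; field; rewrite m0 G0.
have L : logn 2 (2 ^ phi * h) = (phi + logn 2 h)%N.
  by rewrite lognM ?expn_gt0 // pfactorK.
have le : (logn 2 g <= phi + logn 2 h)%N.
  by rewrite -L -pfactor_dvdn //; apply: z2_dvd; rewrite vE rpredM ?z2_nat.
split=> // d; apply/eqP; rewrite eqn_leq le /= leqNgt; apply/negP => lt.
have : z2e ((2 ^ phi * h)%:R / 2 ^+ logn 2 g).
  rewrite -L in lt; have := lt; rewrite -pfactor_dvdn // => /dvdnP[k ->].
  rewrite expnS natrM natrM natrX mulrA mulfK ?expf_neq0 //.
  by rewrite /z2e mulfK ?z2_nat.
by rewrite vE; exact: (z2o_not_even (z2oM (vo d) (z2o_nat om))).
Qed.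

(** * Valuation of the order of the general linear group *)

Lemma logn_glcard q n : odd q -> (1 < q)%N ->
  logn 2 (glcard n q) = (\sum_(1 <= i < n.+1) logn 2 (q ^ i - 1))%N.
Proof.
move=> oq q1; rewrite /glcard lognM ?expn_gt0 ?(ltnW q1) //; last first.
  rewrite big_nat_cond; apply: prodn_cond_gt0 => i /andP[/andP[i0 _] _].
  by rewrite subn_gt0 -{1}(expn0 q) ltn_exp2l.
rewrite logn2_odd ?oddX ?oq ?orbT // add0n.
elim: n => [|n IH]; first by rewrite !big_geq // logn1.
rewrite !(big_nat_recr n.+1) //= lognM ?IH //.
  rewrite big_nat_cond; apply: prodn_cond_gt0 => i /andP[/andP[i0 _] _].
  by rewrite subn_gt0 -{1}(expn0 q) ltn_exp2l.
by rewrite subn_gt0 -{1}(expn0 q) ltn_exp2l.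
Qed.

Lemma lamtS q t : odd q -> (1 < q)%N ->
  lamt q t.+1 = (lamt q t + logn 2 (q ^ (2 ^ t) + 1))%N.
Proof.
move=> oq q1; rewrite /lamt expnSr expnM; set Q := (q ^ _)%N.
have Q1 : (1 < Q)%N by rewrite -(expn0 q) ltn_exp2l // expn_gt0.
by rewrite -[X in (_ - X)%N](exp1n 2) subn_sqr lognM ?subn_gt0 ?addn1.
Qed.

(** The odd part of [i] only contributes a sum of an odd number of odd terms. *)
Lemma logn_expn_sub1 q i : odd q -> (1 < q)%N -> (0 < i)%N ->
  logn 2 (q ^ i - 1) = lamt q (logn 2 i).
Proof.
move=> oq q1 i0; have [m om em] := oddpart i0.
rewrite {1}em expnM /lamt; set Q := (q ^ _)%N.
have Q1 : (1 < Q)%N by rewrite -(expn0 q) ltn_exp2l // expn_gt0.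
rewrite !subn1 predn_exp lognM; first by rewrite [X in (_ + X)%N]logn2_odd ?addn0 // odd_geo // oddX oq orbT.
  by rewrite -subn1 subn_gt0.
by rewrite lt0n; apply/eqP => e0; have := odd_geo m (_ : odd Q); rewrite e0 om oddX oq orbT => /(_ isT).
Qed.

Lemma lamt0 q : lamt q 0 = logn 2 (q - 1).
Proof. by rewrite /lamt expn0 expn1. Qed.

Lemma logn2_doubled m : odd m -> logn 2 (2 * m) = 1%N.
Proof. by move=> om; rewrite lognM ?(logn2_odd om) //; case: m om. Qed.

Lemma logn2_odd_sqr_add1 q : odd q -> logn 2 (q ^ 2 + 1) = 1%N.
Proof.
move=> oq; have -> : (q ^ 2 + 1 = 2 * (2 * (q./2 * q./2 + q./2) + 1))%N.
  have {1}-> : q = (q./2 * 2 + 1)%N by rewrite -{1}[q]odd_double_half oq muln2 addnC.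
  by rewrite -mulnn; ring.
by rewrite logn2_doubled // oddD oddM.
Qed.

(** After the first squaring, [q ^ (2 ^ t) + 1] is 2 modulo 4, so each further squaring adds exactly
    1; only the first one depends on [q] modulo 4. *)
Lemma lamtSS q t : odd q -> (1 < q)%N -> lamt q t.+2 = (lamt q t.+1).+1.
Proof.
move=> oq q1; rewrite lamtS // expnSr expnM logn2_odd_sqr_add1 ?addn1 //.
by rewrite oddX oq orbT.
Qed.

Lemma lamt_q1 q t : (q = 1 %[mod 4])%N -> (1 < q)%N ->
  lamt q t = (logn 2 (q - 1) + t)%N.
Proof.
move=> q4 q1; have oq : odd q by lia.
rewrite -lamt0; elim: t => [|[|t] IH]; first by rewrite addn0.
  rewrite lamtS // expn0 expn1 (_ : (q + 1 = 2 * (q./2 + 1))%N); last by lia.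
  by rewrite logn2_doubled //; lia.
by rewrite lamtSS // IH -addnS.
Qed.

Lemma lamt_q3 q t : odd q -> (1 < q)%N ->
  (lamt q t.+1).+1 = (logn 2 (q ^ 2 - 1) + t.+1)%N.
Proof.
move=> oq q1; elim: t => [|t IH]; first by rewrite /lamt expn1 addn1.
by rewrite lamtSS // IH -addnS.
Qed.

Lemma logn_sub1_q3 q : (q = 3 %[mod 4])%N -> logn 2 (q - 1) = 1%N.
Proof.
move=> q4; rewrite (_ : (q - 1 = 2 * (q./2))%N); last by lia.
by rewrite logn2_doubled //; lia.
Qed.

Lemma logn_fact_sum n : logn 2 n`! = (\sum_(1 <= i < n.+1) logn 2 i)%N.
Proof.
elim: n => [|n IH]; first by rewrite big_geq.
by rewrite factS lognM ?fact_gt0 // IH [RHS]big_nat_recr //= addnC.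
Qed.

Lemma logn_glcard_q1 q n : (q = 1 %[mod 4])%N -> (1 < q)%N ->
  logn 2 (glcard n q) = (logn 2 (q - 1) * n + logn 2 n`!)%N.
Proof.
move=> q4 q1; have oq : odd q by lia.
rewrite logn_glcard // logn_fact_sum.
rewrite (eq_big_nat _ _ (F2 := fun i => (logn 2 (q - 1) + logn 2 i)%N)); last first.
  by move=> i /andP[i0 _]; rewrite logn_expn_sub1 // lamt_q1.
by rewrite big_split /= sum_nat_const_nat subn1 mulnC.
Qed.

(** Writing [lam1] for the valuation of [q ^ 2 - 1], an odd [i] contributes 1 and an even [i]
    contributes [lam1 - 1] plus its own valuation. The term on the left avoids a truncated
    subtraction. *)
Lemma logn_glcard_q3 q n : (q = 3 %[mod 4])%N ->
  (logn 2 (glcard n q) + 2 * (n %/ 2) =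
   n + logn 2 (q ^ 2 - 1) * (n %/ 2) + logn 2 n`!)%N.
Proof.
move=> q4; have oq : odd q by lia.
have q1 : (1 < q)%N by lia.
rewrite logn_glcard // logn_fact_sum.
elim: n => [|n IH]; first by rewrite !big_geq // div0n !muln0.
rewrite [in LHS]big_nat_recr //= [in RHS]big_nat_recr //=.
rewrite (logn_expn_sub1 oq q1 (ltn0Sn n)).
have [on|en] := boolP (odd n.+1).
  rewrite logn2_odd // lamt0 logn_sub1_q3 //.
  have -> : (n.+1 %/ 2 = n %/ 2)%N by lia.
  by move: IH; generalize (n %/ 2)%N; lia.
have -> : (n.+1 %/ 2 = (n %/ 2).+1)%N by lia.
have : (0 < logn 2 n.+1)%N by rewrite logn_gt0 mem_primes /= dvdn2.
case: (logn 2 n.+1) => // t _.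
have := lamt_q3 t oq q1; rewrite !mulnS; move: IH; generalize (n %/ 2)%N; lia.
Qed.

(** * Exponents of the counts [M_t] and their comparison with the definition of [l] *)

Section Weights.
Variables (m : nat) (j : 'I_m -> nat) (r s : nat).
Hypotheses (jr : forall i, (j i <= r)%N) (jmax : exists i, j i = r).
Hypothesis jsum : (\sum_i j i)%N = (r + s)%N.

(** The exponent of 2 in the number of morphisms from [G] to a cyclic group whose order has 2-part
    [2 ^ x]. *)
Definition msum (x : nat) : nat := (\sum_i minn (j i) x)%N.

Lemma msum_ge x : (r <= x)%N -> msum x = (r + s)%N.
Proof.
move=> le; rewrite -jsum; apply: eq_bigr => i _.
exact: minn_idPl (leq_trans (jr i) le).
Qed.

Lemma minn_sum_le (I : finType) (P : pred I) (f : I -> nat) x :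
  (minn (\sum_(i | P i) f i) x <= \sum_(i | P i) minn (f i) x)%N.
Proof. by elim/big_rec2: _ => [|i y1 y2 _ le]; lia. Qed.

(** One factor has exponent [r]; the others, of total [s], contribute at least [minn s x] by
    subadditivity of truncation. *)
Lemma msum_lt x : (minn r x + minn s x <= msum x)%N.
Proof.
have [i0 ji0] := jmax; rewrite /msum (bigD1 i0) //= ji0 leq_add2l.
have <- : (\sum_(i | i != i0) j i)%N = s by have := jsum; rewrite (bigD1 i0) //= ji0; lia.
exact: minn_sum_le.
Qed.

Lemma la_q1_bounds (q l : nat) (a : int) : (q = 1 %[mod 4])%N -> (1 < q)%N -> a = - 1 ->
    la_q1 r s (logn 2 (q - 1)) l a ->
  (forall t, (t < l)%N -> (t + lamt q t < msum (lamt q t))%N) /\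
  (forall e, (l + e + lamt q (l + e) = msum (lamt q (l + e)) + e.*2.+1)%N).
Proof.
move=> q4 q1 ha; have lamE t := lamt_q1 t q4 q1.
have : (2 <= logn 2 (q - 1))%N.
  by rewrite -pfactor_dvdn ?subn_gt0 //; lia.
move: (logn 2 (q - 1)) lamE => c lamE c2 [h1 h2 h3 h4].
(* Common to all clauses compatible with [a = - 1]. The first relation makes the deficit at [l + e]
   equal to [2 e + 1]; with the second, [l <= s] and [r <= l + c]. *)
have [el es] : (2 * l + c = r + s + 1 /\ r + 1 <= s + c)%N by lia.
split=> [t lt|e]; rewrite lamE; last by rewrite msum_ge; lia.
have [le|lt'] := leqP r (c + t); first by rewrite msum_ge //; lia.
by have := msum_lt (c + t); lia.
Qed.

Lemma la_q3_bounds (q l : nat) (a : int) : (q = 3 %[mod 4])%N -> (0 < r)%N -> a = - 1 ->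
    la_q3 r s (logn 2 (q ^ 2 - 1)) l a ->
  (0 < l)%N /\
  (forall t, (t < l)%N -> (t + lamt q t < msum (lamt q t))%N) /\
  (forall e, (l + e + lamt q (l + e) = msum (lamt q (l + e)) + e.*2.+1)%N).
Proof.
move=> q4 r0 ha; have oq : odd q by lia.
have q1 : (1 < q)%N by lia.
have lamE t := lamt_q3 t oq q1.
have lam0 : lamt q 0 = 1%N by rewrite lamt0 logn_sub1_q3.
have : (3 <= logn 2 (q ^ 2 - 1))%N.
  rewrite -[X in (_ - X)%N](exp1n 2) subn_sqr lognM ?addn1 //; last by rewrite subn_gt0.
  rewrite logn_sub1_q3 // -[3%N]/(1 + 2)%N leq_add2l -pfactor_dvdn //; lia.
move: (logn 2 (q ^ 2 - 1)) lamE => c lamE c3 [h1 h2 h3 h4].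
have [el [es [s1 l0]]] : (2 * l + c = r + s + 2 /\ r + 2 <= s + c /\ 0 < s /\ 0 < l)%N by lia.
split=> //; split=> [[|t] lt|e].
(* At [t = 0] the valuation is 1 and not given by [lamE]; two nontrivial cyclic factors, from
   [r > 0] and [s > 0], are needed. *)
- by rewrite lam0; have := msum_lt 1; lia.
- have := lamE t; move: (lamt q t.+1) => x ex.
  have [le|lt'] := leqP r x; first by rewrite msum_ge //; lia.
  by have := msum_lt x; lia.
- case: l l0 el {h1 h2 h3 h4} => // l _ el; rewrite addSn.
  have := lamE (l + e)%N; move: (lamt q _) => x ex.
  by rewrite msum_ge; lia.
Qed.

End Weights.

(** * From [vphi] to the sums of floors *)

Lemma osum_recr m l f : osum m l.+1 f = osum m l f + f l.
Proof.
rewrite /osum; have [le|lt] := leqP m l.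
  by rewrite big_nat_recr // [X in _ - X]big_geq ?leqW // [X in _ = _ - X + _]big_geq // !subr0.
by rewrite [X in _ = _ - X + _]big_ltn // (big_geq lt) (big_geq (ltnW lt)); ring.
Qed.

Lemma osum_recl l f : osum 1 l f = f 1%N + osum 2 l f.
Proof.
elim: l => [|l IH]; last first.
  by rewrite (osum_recr 1) (osum_recr 2) IH -addrA.
by rewrite /osum unlock /=; ring.
Qed.

Lemma logn2_fact_osum n L : (logn 2 n`!)%:Z =
  osum 1 L.+1 (fun i => (n %/ 2 ^ i)%N%:Z) + (logn 2 (n %/ 2 ^ L)`!)%:Z.
Proof.
elim: L => [|L IH]; first by rewrite /osum !big_geq // subr0 add0r divn1.
by rewrite osum_recr -addrA IH logn2_fact -divnMA -expnSr PoszD.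
Qed.

(** Legendre's formula is stopped at level [l + 2], where its remainder cancels the factorial in
    [vphi]. Subtracting the rest of [vphi] removes level [l] and turns the sign of level [l + 2].
    The convention of [osum] covers small [l] uniformly. *)
Lemma bounds_from_vphi (n l g h : nat) (c : int) :
    (g <= vphi l n + h)%N /\ ((2 ^ l.+2 %| n)%N -> g = (vphi l n + h)%N) ->
    g%:Z = c + (logn 2 n`!)%:Z ->
  let B := c + osum 1 l (fun i => (n %/ 2 ^ i)%N%:Z) + (n %/ 2 ^ l.+1)%N%:Z
             - (n %/ 2 ^ l.+2)%N%:Z in
  B <= h%:Z /\ ((2 ^ l.+2 %| n)%N -> h%:Z = B).
Proof.
rewrite (logn2_fact_osum n l.+2) !osum_recr /vphi => -[le eq] eg.
by split=> [|/eq]; lia.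
Qed.

Theorem theorem2p21
  (r : nat) (k : nat -> nat) (hr : (0 < r)%N) (hk : (0 < k r)%N)
  (G : finGroupType) (hG : [set: G] \isog [set: prodC2 r k])
  (G0 : finGroupType) (s : nat)
  (hG0 : [set: G] \isog [set: ('Z_(2 ^ r) * G0)%type])
  (hs : #|[set: G0]| = (2 ^ s)%N)
  (F : finFieldType) (q : nat) (hq : #|F| = q) (hodd : odd q)
  (l : nat) (a : int) (ha : a = - 1) :
  let lam0 := logn 2 (q - 1) in
  let lam1 := logn 2 (q ^ 2 - 1) in
  let v (n : nat) : int := (logn 2 #|homset G (GLn n F)|)%:Z in
  let fl (n i : nat) : int := (n %/ 2 ^ i)%N%:Z in
  let B1 (n : nat) : int :=
    lam0%:Z * n%:Z + osum 1 l (fl n) + fl n l.+1 - fl n l.+2 in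
  let B3 (n : nat) : int :=
    n%:Z + (lam1%:Z - 1) * fl n 1%N + osum 2 l (fl n) + fl n l.+1 - fl n l.+2 in
  (q = 1 %[mod 4] -> la_q1 r s lam0 l a ->
     forall n : nat, B1 n <= v n /\ ((2 ^ l.+2 %| n)%N -> v n = B1 n)) /\
  (q = 3 %[mod 4] -> la_q3 r s lam1 l a ->
     forall n : nat, B3 n <= v n /\ ((2 ^ l.+2 %| n)%N -> v n = B3 n)).
Proof.
move=> lam0 lam1 v fl B1 B3.
have [m [j [jr jmax jsum cardE]]] := prodC2_hom_tuples hr hG hG0 hs.
have q1 : (1 < q)%N by rewrite -hq finNzRing_gt1.
have oF : odd #|F| by rewrite hq.
have valuation n :
    (forall t, (t < l)%N -> (t + lamt q t < msum j (lamt q t))%N) ->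
    (forall e, (l + e + lamt q (l + e) = msum j (lamt q (l + e)) + e.*2.+1)%N) ->
  let h := logn 2 #|homset G (GLn n F)| in
  (logn 2 (glcard n q) <= vphi l n + h)%N /\
  ((2 ^ l.+2 %| n)%N -> logn 2 (glcard n q) = (vphi l n + h)%N).
  move=> lo hi; rewrite cardE; apply: logn_ratio.
  (* The trivial tuple makes the count positive, so that its [logn] is a true valuation. *)
  - rewrite card_gt0; apply/set0Pn; exists [ffun _ => 1%:M].
    apply/ctuplesP; split=> [i i'|i]; rewrite !ffunE ?mulmx1 //.
    by elim: (2 ^ _)%N => // N IH; rewrite exprS IH mulr1.
  - by have := gl_neq0 F n; rewrite hq pnatr_eq0 lt0n.
  (* With all scalars equal to 1, every [cnum] is a power of 2 and [Mfun] is [2 ^ msum]. *)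
  have oM : isexp (Aser q (fun t => 2 ^ msum j (lamt q t))%N)
                  (Hser (fun _ => 1 : F) j).
    rewrite (_ : Aser q _ = Aser #|F| (Mfun (fun _ => 1 : F) j)).
      by apply: isexp_Hser => // i; apply: oner_neq0.
    rewrite hq; congr Aser; apply: boolp.funext => t; rewrite /Mfun /msum expn_sum.
    apply: eq_bigr => i _; rewrite cnum_1 hq //.
    by rewrite -(expn0 q) ltn_exp2l // expn_gt0.
  have := assembly hodd q1 erefl oM lo hi n.
  by rewrite HserE hq.
split=> [q4 la n|q4 la n].
  have [lo hi] := la_q1_bounds jr jmax jsum q4 q1 ha la.
  apply: (bounds_from_vphi (valuation n lo hi)).
  by rewrite logn_glcard_q1 // PoszD PoszM.
have [l0 [lo hi]] := la_q3_bounds jr jmax jsum q4 hr ha la.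
(* The constant has [lam1 - 2] where [B3] has [lam1 - 1]: the missing [n / 2] is the first term of
   [osum 1 l], split off by [osum_recl]. *)
have := @bounds_from_vphi n l _ _ (n%:Z + (lam1%:Z - 2) * fl n 1%N) (valuation n lo hi).
have -> : B3 n = n%:Z + (lam1%:Z - 2) * fl n 1%N + osum 1 l (fl n) + fl n l.+1 - fl n l.+2.
  by rewrite /B3 osum_recl; ring.
apply; have := logn_glcard_q3 n q4; rewrite /fl expn1 -/lam1.
move: (logn 2 (glcard n q)) (logn 2 n`!) (n %/ 2)%N => x y z.
by rewrite mulrBl -PoszM; lia.
Qed.
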